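(* Let $(\Sigma,g)=(\mathbb S^2,g_0)$ be the standard sphere, let $m=1$ and let $p_1\in\mathbb S^2$. (i) For any integer $N\geq1$ there exists a nonempty class of positive functions $K$ on $\mathbb S^2$ such that, for each $K$ in the class, if $$(0<)\ \alpha_1=2(N-1)+\frac{\varepsilon}{4\pi}\quad\text{with }\varepsilon>0\text{ small enough},$$ then $( * )_{\rho_{geo}}$ admits a solution, with $\rho_{geo}=8\pi N+\varepsilon$. (ii) For any integer $N\geq2$ there exists a nonempty class of positive functions $K$ on $\mathbb S^2$ such that, for each $K$ in the class, if $$(0<)\ \alpha_1=2(N-1)-\frac{\varepsilon}{4\pi}\quad\text{with }\varepsilon>0\text{ small enough},$$ then $( * )_{\rho_{geo}}$ admits a solution, with $\rho_{geo}=8\pi N-\varepsilon$.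
   Context: Let $(\Sigma,g)$ be a compact orientable surface without boundary, with Gauss curvature $\kappa_g$, area element $dV_g$, total area $|\Sigma|$, Euler characteristic $\chi(\Sigma)$, Laplace–Beltrami operator $\Delta_g$; let $K$ be a Lipschitz function on $\Sigma$, $p_1,\dots,p_m\in\Sigma$ distinct points and $\alpha_1,\dots,\alpha_m>-1$. $G(x,p)$ is the Green's function: $-\Delta_gG(\cdot,p)=\delta_p-\frac1{|\Sigma|}$, $\int_\Sigma G(x,p)\,dV_g(x)=0$. $f_g$ is the unique solution of $-\Delta_gf_g=\frac{4\pi\chi(\Sigma)}{|\Sigma|}-2\kappa_g$, $\int_\Sigma f_g\,dV_g=0$. Put $\tilde K(x)=K(x)e^{f_g(x)-4\pi\sum_{i=1}^m\alpha_iG(x,p_i)}$. Problem $( * )_{\rho_{geo}}$ is $$-\Delta_gv=\rho_{geo}\Big(\frac{\tilde K(x)e^v}{\int_\Sigma\tilde K(x)e^v\,dV_g}-\frac1{|\Sigma|}\Big)\quad\text{on }\Sigma,\qquad \rho_{geo}=4\pi\Big(\chi(\Sigma)+\sum_{i=1}^m\alpha_i\Big);$$ a solution is a weak solution $v\in H^1(\Sigma)$ with $\int_\Sigma\tilde Ke^v\,dV_g>0$. ''$\varepsilon>0$ small enough'' means $\varepsilon\in(0,\delta)$ for some $\delta>0$ that may depend on $K$ (and on $N$, $p_1$). On the standard sphere $\chi(\mathbb S^2)=2$ and $\kappa_{g_0}\equiv1$. *)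

(* Defs.v *)
From mathcomp Require Import all_boot all_order all_algebra.
From mathcomp Require Import all_classical all_reals all_analysis.
Set Implicit Arguments.
Unset Strict Implicit.
Unset Printing Implicit Defensive.
Import Order.TTheory GRing.Theory Num.Theory.
Import numFieldNormedType.Exports.
Local Open Scope classical_set_scope.
Local Open Scope ring_scope.

(* Functions and vector fields on the unit sphere S^2 are
   represented by functions on the ambient space 'rV[R]_3; no definition below
   depends on their values off the sphere.  The canonical norm on 'rV[R]_3 is
   the sup norm, hence the separate Euclidean norm [enorm]. *)

Section Sphere.
Variable R : realType.
Local Notation E3 := 'rV[R]_3.
Implicit Types (u v K f : E3 -> R) (X W : E3 -> E3) (x y p : E3).

Definition dot x y : R := \sum_(i < 3) x 0 i * y 0 i.

Definition enorm x : R := Num.sqrt (dot x x).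

Definition S2 : set E3 := [set x | enorm x = 1].

(* Spherical coordinates z = (theta, phi), theta being the colatitude; the area
   element of the round metric is sin theta dtheta dphi. *)
Definition sph (z : R * R) : E3 :=
  \row_(i < 3) [:: sin z.1 * cos z.2; sin z.1 * sin z.2; cos z.1]`_i.

Definition sph_dom : set (R * R) := `[0, pi] `*` `[0, 2 * pi].

Definition mu2 := (@lebesgue_measure R \x @lebesgue_measure R)%E.

Definition s_measurable u := measurable_fun sph_dom (u \o sph).

Definition s_integrable u :=
  mu2.-integrable sph_dom (fun z => (u (sph z) * sin z.1)%:E).

Definition s_int u : R := \int[mu2]_(z in sph_dom) (u (sph z) * sin z.1).

Definition s_area : R := s_int (fun=> 1).

Definition s_L2 u := s_measurable u /\ s_integrable (fun x => u x ^+ 2).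

(* The extension of u that is constant along rays.  At points of S^2 its
   Euclidean gradient and Laplacian are the intrinsic gradient and the
   Laplace-Beltrami operator of u, and the Euclidean divergence of the extension
   of a tangential field is its intrinsic divergence.  u is smooth on S^2 iff
   the extension is smooth off the origin. *)
Definition radial u : E3 -> R := fun x => u ((enorm x)^-1 *: x).

Definition partial (i : 'I_3) u : E3 -> R := fun x => 'D_('e_i) u x.

Definition s_smooth u := forall (s : seq 'I_3) x, x != 0 ->
  differentiable (foldr partial (radial u) s) x.

Definition s_grad u : E3 -> E3 := fun x => \row_(i < 3) partial i (radial u) x.

Definition laplace u : E3 -> R :=
  fun x => \sum_(i < 3) partial i (partial i (radial u)) x.

Definition tangential X := forall x, S2 x -> dot (X x) x = 0.

Definition smooth_field X :=
  tangential X /\ forall i, s_smooth (fun x => X x 0 i).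

Definition s_div X : E3 -> R :=
  fun x => \sum_(i < 3) partial i (radial (fun y => X y 0 i)) x.

(* v belongs to H^1(S^2) and its weak gradient is W. *)
Definition H1_with_grad v W :=
  [/\ s_L2 v, tangential W, forall i, s_L2 (fun x => W x 0 i) &
      forall X, smooth_field X ->
        s_int (fun x => dot (W x) (X x)) = - s_int (fun x => v x * s_div X x)].

Definition euler_char : R := 2.

Definition gauss_curv : E3 -> R := fun=> 1.

(* - Delta G(., p) = delta_p - 1/|S^2| in the sense of distributions. *)
Definition green_function (G : E3 -> E3 -> R) := forall p, S2 p ->
  [/\ s_integrable (G^~ p), s_int (G^~ p) = 0 &
      forall u, s_smooth u ->
        s_int (fun x => G x p * - laplace u x) = u p - s_int u / s_area].

Definition is_f_g f :=
  [/\ s_smooth f,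
      forall x, S2 x ->
        - laplace f x = 4 * pi * euler_char / s_area - 2 * gauss_curv x &
      s_int f = 0].

Section Problem.
Variables (G : E3 -> E3 -> R) (f_g K : E3 -> R).
Variables (m : nat) (p : 'I_m -> E3) (alpha : 'I_m -> R).

Definition K_tilde : E3 -> R := fun x =>
  K x * expR (f_g x - 4 * pi * \sum_(i < m) alpha i * G x (p i)).

Definition rho_geo : R := 4 * pi * (euler_char + \sum_(i < m) alpha i).

(* The integrability of K_tilde * e^v makes its integral meaningful; it is
   automatic (Moser-Trudinger) for v in H^1 and alpha_i > -1. *)
Definition weak_solution (rho : R) v :=
  let F := fun x => K_tilde x * expR (v x) in
  [/\ s_integrable F, 0 < s_int F &
      exists2 W, H1_with_grad v W &
        forall u, s_smooth u ->
          s_int (fun x => dot (W x) (s_grad u x)) =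
          rho * s_int (fun x => (F x / s_int F - s_area^-1) * u x)].

End Problem.

Definition lipschitz_S2 K := exists k : R, k.-lipschitz_S2 K.

Definition positive_S2 K := forall x, S2 x -> 0 < K x.

End Sphere.

(* Main.v *)
Require Import Defs.
From mathcomp Require Import all_boot all_order all_algebra.
From mathcomp Require Import all_classical all_reals all_analysis.
From mathcomp Require Import measurable_realfun ring lra.
Import Order.TTheory GRing.Theory Num.Theory.
Import numFieldNormedType.Exports.
Local Open Scope classical_set_scope.
Local Open Scope ring_scope.
Set Implicit Arguments.
Unset Strict Implicit.
Unset Printing Implicit Defensive.

(** Rotational symmetry about p1 reduces the problem to an ordinary differential
    equation, which is solved by elementary functions and a shooting argument.

    On the round sphere f_g is constant, and G(x, p1) is - ln (1 - s) / (4 pi)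
    plus a constant for almost every x, where s is the height dot x p1. Both
    follow from log_green and from sphere_unique: an integrable function that is
    orthogonal to all Laplacians is constant. (Laplacians of polynomials and the
    constants span the polynomials, and orthogonality to the polynomials passes
    to indicators of half-spaces and then of Borel sets.) Hence K_tilde is a
    positive multiple of K (1 - s)^a with a = alpha_1.

    Take K and v zonal. In the conformal coordinate t = ln ((1 - s) / (1 + s)) / 2
    of the sphere minus its poles, v = - 2 ln f(t) - ln (1 - s^2) - a ln (1 - s)
    solves the equation if f > 0 and f f'' - f'^2 = k K for a constant k. It is
    bounded, with bounded gradient, if f behaves like e^t at + oo (at - p1, a
    regular point) and like e^(- (1 + a) t) at - oo (at p1, a conical point of
    angle 2 pi (1 + a)).

    Let log K be 0 for t >= 0, - 2 m t on [-1, 0] and 2 m for t <= -1, with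
    m = 2 N. On each piece f is a sum of two exponentials, found from its initial
    values by conservation of energy (ivp). Start from f = e^(- t) + e * e^t on
    t >= 0. The exponent of f at - oo depends continuously on e, it is 1 for
    e = 0 and at least m for e = 1; so every g with 1 < g < m is attained
    (conical_family). The exponents g = 1 + alpha_1 = 2 N - 1 +- eps / (4 pi) of
    both parts are of this kind for eps < 4 pi, and K does not depend on eps.

    The solution is turned into a weak one by integrating by parts against zonal
    functions that are singular at the poles (zonal_singular_ibp and
    zonal_singular_green): replace s by lam s with lam < 1 and let lam tend to
    1. Testing with the constant 1 shows that the integral of K_tilde e^v is
    positive and has the right value. *)

(** * Derivatives of functions of one and of three variables *)

Section Calculus.
Variable R : realType.
Local Notation E3 := 'rV[R]_3.
Implicit Types (f g : E3 -> R) (x y : E3) (i j : 'I_3).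

Lemma near_eq_differentiable f g x :
  (\forall y \near x, f y = g y) -> differentiable f x -> differentiable g x.
Proof.
move=> fg df.
(* g - f vanishes near x, so its differential there is that of 0 *)
have dz : differentiable (g \- f) x.
  have z0 : \forall y \near x, (g \- f) y = 0.
    by near do (rewrite /=; apply/eqP; rewrite subr_eq0 eq_sym; apply/eqP).
  set z := g \- f in z0 *.
  apply/diffP => /=.
  apply: (@getPex _ (fun (dz : {linear E3 -> R}) => continuous dz /\
    forall y, z y = z (lim (nbhs x)) + dz (y - lim (nbhs x))
                    +o_(y \near x) (y - lim (nbhs x)))).
  exists ('d (cst 0 : E3 -> R) x); rewrite diff_cst; split; first exact: cst_continuous.
  move=> y; rewrite littleoE /=; first by rewrite addrC subrK.
  move=> e e0 /=; near=> u; rewrite lim_id// (nbhs_singleton z0) !add0r.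
  by rewrite (near z0 u)// !subr0 normr0 mulr_ge0//; exact: ltW.
have -> : g = f \+ (g \- f) by apply/funext => y /=; rewrite addrC subrK.
exact: differentiableD.
Unshelve. all: by end_near. Qed.

Lemma dotE x y : dot x y = x 0 0 * y 0 0 + x 0 1 * y 0 1 + x 0 2%:R * y 0 2%:R.
Proof.
rewrite /dot !big_ord_recr big_ord0 /= add0r.
by congr (_ * _ + _ * _ + _ * _); congr (_ _ _); apply/val_inj.
Qed.

Lemma sum3 (F : 'I_3 -> R) : \sum_(i < 3) F i = F 0 + F 1 + F 2%:R.
Proof.
rewrite !big_ord_recr big_ord0 /= add0r.
by congr (F _ + F _ + F _); apply/val_inj.
Qed.

Lemma diff_partial f x v : differentiable f x ->
  'd f x v = \sum_(i < 3) v 0 i * partial i f x.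
Proof.
move=> df; rewrite {1}(row_sum_delta v) raddf_sum; apply: eq_bigr => i _.
rewrite /partial deriveE//; exact: linearZ.
Qed.

Lemma is_derive_along f (c : R -> E3) (c' : E3) (t : R) :
  differentiable f (c t) ->
  (forall i, is_derive t 1 (fun s => c s 0 i) (c' 0 i)) ->
  is_derive t 1 (f \o c) (\sum_(i < 3) c' 0 i * partial i f (c t)).
Proof.
move=> df dc.
have cd : derivable c t 1 by apply/derivable_mxP => i j; rewrite ord1; case: (dc j).
have cD : 'D_1 c t = c'.
  rewrite derive_mx//; apply/rowP => j; rewrite !mxE; exact: (@derive_val _ _ _ _ _ _ _ (dc j)).
have cdiff : differentiable c t by apply/derivable1_diffP.
have fcdiff : differentiable (f \o c) t by exact: differentiable_comp.
apply: DeriveDef; first exact/derivable1_diffP.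
rewrite deriveE// diff_comp//= -(deriveE _ cdiff) cD.
exact: diff_partial.
Qed.

Lemma partialD f g x i : differentiable f x -> differentiable g x ->
  partial i (fun y => f y + g y) x = partial i f x + partial i g x.
Proof. by move=> df dg; rewrite /partial deriveD//; exact: diff_derivable. Qed.

Lemma partialM f g x i : differentiable f x -> differentiable g x ->
  partial i (fun y => f y * g y) x = f x * partial i g x + g x * partial i f x.
Proof. by move=> df dg; rewrite /partial deriveM//; exact: diff_derivable. Qed.

Lemma partial_cst (a : R) x i : partial i (fun=> a) x = 0.
Proof. by rewrite /partial derive_cst. Qed.

Lemma partial_coord x i j : partial i (fun y => y 0 j) x = (j == i)%:R.
Proof.
have := @derive_mx R E3 1 3 id x 'e_i (@derivable_id _ _ _ _).
rewrite derive_id => /matrixP/(_ 0 j); rewrite !mxE eqxx /= => H.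
by rewrite /partial -H.
Qed.

Lemma partial_comp (q : R -> R) dq f x i : is_derive (f x) 1 q dq ->
  differentiable f x -> partial i (q \o f) x = dq * partial i f x.
Proof.
move=> Dq df; have dq' : differentiable q (f x) by apply/derivable1_diffP; case: Dq.
rewrite /partial deriveE; last exact: differentiable_comp.
rewrite diff_comp//= -(deriveE _ df).
rewrite -[X in 'd q (f x) X]mulr1 -[X in 'd q (f x) X]/(_ *: 1) linearZ /= -(deriveE _ dq').
by rewrite derive_val mulrC.
Qed.

Lemma differentiable_compR (q : R -> R) dq f x : is_derive (f x) 1 q dq ->
  differentiable f x -> differentiable (q \o f) x.
Proof.
by move=> Dq df; apply: differentiable_comp => //; apply/derivable1_diffP; case: Dq.
Qed.

Lemma near_gt (a t : R) : a < t -> \forall s \near t, a < s.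
Proof. by move=> at_; apply: open_nbhs_nbhs; split; [exact: open_gt|]. Qed.

Lemma near_lt (a t : R) : t < a -> \forall s \near t, s < a.
Proof. by move=> at_; apply: open_nbhs_nbhs; split; [exact: open_lt|]. Qed.

Lemma isdM (f g : R -> R) (t df dg : R) : is_derive t 1 f df -> is_derive t 1 g dg ->
  is_derive t 1 (fun s => f s * g s) (df * g t + f t * dg).
Proof.
move=> Hf Hg; apply: (is_derive_eq (is_deriveM Hf Hg)).
by rewrite /GRing.scale /= addrC [g t * _]mulrC.
Qed.

Lemma isdD (f g : R -> R) (t df dg : R) : is_derive t 1 f df -> is_derive t 1 g dg ->
  is_derive t 1 (fun s => f s + g s) (df + dg).
Proof. by move=> Hf Hg; exact: is_deriveD. Qed.

Lemma isdN (f : R -> R) (t df : R) : is_derive t 1 f df ->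
  is_derive t 1 (fun s => - f s) (- df).
Proof. by move=> Hf; exact: is_deriveN. Qed.

Lemma isdZ (k : R) (f : R -> R) (t df : R) : is_derive t 1 f df ->
  is_derive t 1 (fun s => k * f s) (k * df).
Proof. by move=> Hf; exact: is_deriveZ. Qed.

Lemma isdC (k t : R) : is_derive t 1 (fun=> k) 0.
Proof. exact: is_derive_cst. Qed.

Lemma isdX (t : R) : is_derive t 1 (fun s : R => s) 1.
Proof. exact: is_derive_id. Qed.

Lemma isd_cont (f : R -> R) (t df : R) : is_derive t 1 f df -> {for t, continuous f}.
Proof.
by move=> Hf; apply: differentiable_continuous; apply/derivable1_diffP; case: Hf.
Qed.

Lemma isd_eq (f : R -> R) (t df df' : R) : is_derive t 1 f df -> df = df' -> is_derive t 1 f df'.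
Proof. by move=> ? <-. Qed.

Lemma isd_comp (f g : R -> R) (t a b : R) : is_derive (g t) 1 f a -> is_derive t 1 g b ->
  is_derive t 1 (fun s => f (g s)) (a * b).
Proof. exact: is_derive1_comp. Qed.

Lemma isdV (f : R -> R) (t df : R) : f t != 0 -> is_derive t 1 f df ->
  is_derive t 1 (fun s => (f s)^-1) (- (f t) ^- 2 * df).
Proof. by move=> f0 H; exact: is_deriveV. Qed.

End Calculus.

(** * Smooth functions off the origin and extension along rays *)

Section Smooth.
Variable R : realType.
Local Notation E3 := 'rV[R]_3.
Implicit Types (u f g : E3 -> R) (x y : E3) (i j : 'I_3) (n : nat).

Lemma dot_ge0 x : 0 <= dot x x.
Proof. by apply: sumr_ge0 => i _; rewrite -expr2 sqr_ge0. Qed.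

Lemma dot_gt0 x : x != 0 -> 0 < dot x x.
Proof.
move=> x0; rewrite lt_neqAle dot_ge0 andbT eq_sym; apply: contra x0.
rewrite /dot psumr_eq0; last by move=> i _; rewrite -expr2 sqr_ge0.
move=> /allP H; apply/eqP/rowP => i; rewrite mxE.
by have := H i (mem_index_enum i); rewrite mulf_eq0 orbb => /eqP.
Qed.

Lemma enorm_gt0 x : x != 0 -> 0 < enorm x.
Proof. by move=> x0; rewrite sqrtr_gt0 dot_gt0. Qed.

Lemma enorm_neq0 x : x != 0 -> enorm x != 0.
Proof. by move=> /enorm_gt0; rewrite lt_neqAle eq_sym => /andP[]. Qed.

Lemma enormE2 x : enorm x ^+ 2 = dot x x.
Proof. by rewrite sqr_sqrtr// dot_ge0. Qed.

Lemma S2_neq0 x : S2 x -> x != 0.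
Proof.
move=> Sx; apply/eqP => x0; move: Sx; rewrite x0 /S2/= /enorm /dot big1.
  by rewrite sqrtr0 => /esym/eqP; rewrite oner_eq0.
by move=> i _; rewrite mxE mul0r.
Qed.

Lemma S2_dot x : S2 x -> dot x x = 1.
Proof. by move=> Sx; rewrite -enormE2 Sx expr1n. Qed.

Lemma dot1_S2 x : dot x x = 1 -> S2 x.
Proof. by move=> xx; rewrite /S2/= /enorm xx sqrtr1. Qed.

Lemma dotZl a x y : dot (a *: x) y = a * dot x y.
Proof. by rewrite /dot mulr_sumr; apply: eq_bigr => i _; rewrite mxE mulrA. Qed.

Lemma dotC x y : dot x y = dot y x.
Proof. by rewrite /dot; apply: eq_bigr => i _; rewrite mulrC. Qed.

Lemma enormZ a x : 0 <= a -> enorm (a *: x) = a * enorm x.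
Proof.
move=> a0; rewrite /enorm dotZl dotC dotZl mulrA -expr2 sqrtrM ?sqr_ge0//.
by rewrite sqrtr_sqr ger0_norm.
Qed.

Lemma radial_S2 u x : S2 x -> radial u x = u x.
Proof. by move=> Sx; rewrite /radial Sx invr1 scale1r. Qed.

Lemma radial_sphere x : x != 0 -> S2 ((enorm x)^-1 *: x).
Proof.
move=> x0; rewrite /S2/= enormZ ?invr_ge0 ?sqrtr_ge0// mulVf//.
exact: enorm_neq0.
Qed.

Lemma radialZ u a x : 0 < a -> radial u (a *: x) = radial u x.
Proof.
move=> a0; have [->|x0] := eqVneq x 0; first by rewrite scaler0.
rewrite /radial enormZ ?ltW// scalerA; congr (u (_ *: _)).
by rewrite invfM mulrAC mulVf ?gt_eqF// mul1r.
Qed.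

Lemma near_neq0 x : x != 0 -> \forall y \near x, y != 0.
Proof. move=> x0; have cx : (id : E3 -> E3) @ x --> x by exact: cvg_id.
exact: (@cvgr_neq0 _ _ _ _ _ id x cx x0). Qed.

Lemma differentiable_dot x : differentiable (fun y : E3 => dot y y) x.
Proof.
rewrite (_ : (fun y => _) = \sum_(i < 3) (fun y : E3 => y 0 i * y 0 i)).
  by apply: differentiable_sum => i; apply: differentiableM; exact: differentiable_coord.
by apply/funext => y; rewrite fct_sumE.
Qed.

Lemma partial_dot i x : partial i (fun y : E3 => dot y y) x = 2 * x 0 i.
Proof.
have -> : (fun y : E3 => dot y y) =
    fun y : E3 => y 0 0 * y 0 0 + y 0 1 * y 0 1 + y 0 2%:R * y 0 2%:R.
  by apply/funext => y; rewrite dotE.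
have dc j z : differentiable (fun y : E3 => y 0 j : R) z by exact: differentiable_coord.
rewrite !partialD ?partialM ?partial_coord//;
  try (by do ?apply: differentiableM); last by apply: differentiableD; apply: differentiableM.
by case: i => -[|[|[|//]]] ?; rewrite -!val_eqE /= ?mulr0 ?mulr1 ?addr0 ?add0r;
  rewrite -mulr2n mulr_natl; congr (_ *+ _); congr (x _ _); apply/val_inj.
Qed.

Definition ninv x : R := (enorm x)^-1.

Lemma is_derive_rsqrt (s : R) : 0 < s ->
  is_derive s 1 (fun s : R => (Num.sqrt s)^-1) (- (2 * Num.sqrt s ^+ 3)^-1).
Proof.
move=> s0; have q0 : Num.sqrt s != 0 by rewrite gt_eqF// sqrtr_gt0.
have H := is_deriveV q0 (is_derive1_sqrt s0).
apply: (is_derive_eq H); rewrite /GRing.scale /=.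
by field.
Qed.

Lemma differentiable_ninv x : x != 0 -> differentiable ninv x.
Proof.
move=> /dot_gt0 x0; have -> : ninv = (fun s : R => (Num.sqrt s)^-1) \o (fun y : E3 => dot y y) by [].
apply: (@differentiable_compR R _ _ (fun y : E3 => dot y y) x (is_derive_rsqrt x0)); exact: differentiable_dot.
Qed.

Lemma partial_ninv i x : x != 0 -> partial i ninv x = - x 0 i * ninv x ^+ 3.
Proof.
move=> x0; have d0 := dot_gt0 x0.
have -> : partial i ninv = partial i ((fun s : R => (Num.sqrt s)^-1) \o (fun y : E3 => dot y y)) by [].
rewrite (@partial_comp R _ _ (fun y : E3 => dot y y) x i (is_derive_rsqrt d0)); last exact: differentiable_dot.
rewrite partial_dot /= /ninv -/(enorm x); have := enorm_neq0 x0; move: (enorm x) => e e0.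
by field.
Qed.

(** Differentiability to order n + 1 off the origin, by recursion on the partial
    derivatives: in this form closure under products is an induction. *)
Fixpoint Cn n f : Prop := (forall x, x != 0 -> differentiable f x) /\
  (if n is n'.+1 then forall i, Cn n' (partial i f) else True).

Definition smooth f := forall n, Cn n f.

Lemma Cn_diff n f x : Cn n f -> x != 0 -> differentiable f x.
Proof. by case: n => [|n] [H _]; exact: H. Qed.

Lemma near_partial f g x i : (\forall y \near x, f y = g y) ->
  partial i f x = partial i g x.
Proof. by move=> fg; exact: near_eq_derive. Qed.

Lemma off0_near f g x : (forall x, x != 0 -> f x = g x) -> x != 0 ->
  \forall y \near x, f y = g y.
Proof. by move=> fg x0; apply: filterS (near_neq0 x0). Qed.

Lemma Cn_ext n f g : (forall x, x != 0 -> f x = g x) -> Cn n f -> Cn n g.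
Proof.
elim: n f g => [|n IH] f g fg [df pf]; split=> // x.
- by move=> x0; apply: near_eq_differentiable (off0_near fg x0) (df _ x0).
- by move=> x0; apply: near_eq_differentiable (off0_near fg x0) (df _ x0).
- apply: IH (pf x) => y y0; exact: near_partial (off0_near fg y0).
Qed.

Lemma Cn_pred n f : Cn n.+1 f -> Cn n f.
Proof.
elim: n f => [|n IH] f [df pf]; split=> // i; exact: IH (pf i).
Qed.

Lemma CnD n f g : Cn n f -> Cn n g -> Cn n (fun x => f x + g x).
Proof.
elim: n f g => [|n IH] f g [df pf] [dg pg]; split=> // x.
- by move=> x0; apply: differentiableD; [exact: df|exact: dg].
- by move=> x0; apply: differentiableD; [exact: df|exact: dg].
- apply: Cn_ext (IH _ _ (pf x) (pg x)) => y y0; rewrite partialD//.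
    exact: df.
  exact: dg.
Qed.

Lemma CnM n f g : Cn n f -> Cn n g -> Cn n (fun x => f x * g x).
Proof.
elim: n f g => [|n IH] f g; first (move=> [df pf] [dg pg]; split=> // x x0).
  by apply: differentiableM; [exact: df|exact: dg].
move=> Cf Cg; have [df pf] := Cf; have [dg pg] := Cg; split=> x.
  by move=> x0; apply: differentiableM; [exact: df|exact: dg].
apply: Cn_ext (CnD (IH _ _ (Cn_pred Cf) (pg x)) (IH _ _ (Cn_pred Cg) (pf x))) => y y0.
by rewrite partialM//; [exact: df|exact: dg].
Qed.

Lemma Cn_cst n (a : R) : Cn n (fun=> a).
Proof.
elim: n a => [|n IH] a; first by split.
split=> // i.
by apply: Cn_ext (IH 0) => x _; rewrite partial_cst.
Qed.

Lemma Cn_coord n j : Cn n (fun x => x 0 j).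
Proof.
case: n => [|n]; split=> //; try by move=> x _; exact: differentiable_coord.
move=> i; by apply: Cn_ext (Cn_cst n (j == i)%:R) => x _; rewrite partial_coord.
Qed.

Lemma Cn_ninv n : Cn n ninv.
Proof.
elim: n => [|n IH]; split=> //; try exact: differentiable_ninv.
move=> i; apply: Cn_ext (CnM (CnM (Cn_cst n (-1)) (Cn_coord n i)) (CnM IH (CnM IH IH))) => x x0.
by rewrite partial_ninv//; ring.
Qed.

Lemma smooth_ext f g : (forall x, x != 0 -> f x = g x) -> smooth f -> smooth g.
Proof. by move=> fg sf n; exact: Cn_ext fg (sf n). Qed.
Lemma smoothD f g : smooth f -> smooth g -> smooth (fun x => f x + g x).
Proof. by move=> sf sg n; exact: CnD. Qed.
Lemma smoothM f g : smooth f -> smooth g -> smooth (fun x => f x * g x).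
Proof. by move=> sf sg n; exact: CnM. Qed.
Lemma smooth_cst (a : R) : smooth (fun=> a).
Proof. by move=> n; exact: Cn_cst. Qed.
Lemma smooth_coord j : smooth (fun x => x 0 j).
Proof. by move=> n; exact: Cn_coord. Qed.
Lemma smooth_ninv : smooth ninv.
Proof. by move=> n; exact: Cn_ninv. Qed.
Lemma smooth_partial i f : smooth f -> smooth (partial i f).
Proof. by move=> sf n; have [_ H] := sf n.+1; exact: H. Qed.
Lemma smooth_diff f x : smooth f -> x != 0 -> differentiable f x.
Proof. by move=> sf; exact: (Cn_diff (sf 0%N)). Qed.

Lemma smooth_sum (F : 'I_3 -> E3 -> R) : (forall i, smooth (F i)) ->
  smooth (fun x => \sum_(i < 3) F i x).
Proof.
move=> sF; apply: (@smooth_ext (fun x => F 0 x + F 1 x + F 2%:R x)).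
  by move=> x _; rewrite sum3.
by do !apply: smoothD.
Qed.

Lemma s_smoothP u : s_smooth u <-> smooth (radial u).
Proof.
split; last first.
  move=> su s; elim/last_ind: s (radial u) su => [|s i IH] f sf x x0.
    exact: smooth_diff.
  by rewrite foldr_rcons; apply: IH => //; exact: smooth_partial.
rewrite /s_smooth; move: (radial u) => f H n; elim: n f H => [|n IH] f H.
  by split=> // x; exact: (H [::]).
split=> [x|i]; first exact: (H [::]).
by apply: IH => s x x0; have := H (rcons s i) x x0; rewrite foldr_rcons.
Qed.

Lemma smooth_s_smooth f : smooth f -> (forall a x, 0 < a -> x != 0 -> f (a *: x) = f x) ->
  s_smooth f.
Proof.
move=> sf hf; apply/s_smoothP; apply: smooth_ext sf => x x0.
by rewrite /radial hf// invr_gt0 enorm_gt0.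
Qed.

(** Euler's identity in degree 0: differentiate along the ray through x. *)
Lemma radial_euler u x : x != 0 -> differentiable (radial u) x ->
  \sum_(i < 3) x 0 i * partial i (radial u) x = 0.
Proof.
move=> x0 du; pose c (t : R) : E3 := t *: x.
have dc i : is_derive (1 : R) 1 (fun s => c s 0 i) (x 0 i).
  rewrite (_ : (fun s => _) = fun s => x 0 i * s); last first.
    by apply/funext => s; rewrite mxE mulrC.
  have H : is_derive (1 : R) 1 (x 0 i \*: (id : R -> R)) (x 0 i *: 1) by exact: is_deriveZ.
  by apply: (is_derive_eq H); rewrite /GRing.scale/= mulr1.
have H : is_derive (1 : R) 1 (radial u \o c) (\sum_(i < 3) x 0 i * partial i (radial u) (c 1)).
  by apply: is_derive_along dc; rewrite /c scale1r.
have K : is_derive (1 : R) 1 (radial u \o c) 0.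
  apply: (@near_eq_is_derive _ _ _ (fun=> radial u x)).
  near=> t; rewrite /= /c radialZ//.
  by near: t; exact: near_gt.
rewrite -[RHS](@derive_val _ _ _ _ _ _ _ K) (@derive_val _ _ _ _ _ _ _ H).
by rewrite /c scale1r.
Unshelve. all: by end_near. Qed.

Lemma partial_radialZ u a x i : 0 < a -> differentiable (radial u) (a *: x) ->
  partial i (radial u) (a *: x) = a^-1 * partial i (radial u) x.
Proof.
move=> a0 du.
have E : radial u = radial u \o ( *:%R a).
  by apply/funext => y /=; rewrite radialZ.
have da : differentiable ( *:%R a : E3 -> E3) x by [].
have dc : differentiable (radial u \o ( *:%R a)) x by exact: differentiable_comp.
rewrite [in RHS]/partial [in RHS]E deriveE// diff_comp//= diff_val.
rewrite (_ : 'd _ _ _ = a * partial i (radial u) (a *: x)); last first.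
  rewrite /partial deriveE//; exact: linearZ.
by rewrite mulrA mulVf ?gt_eqF// mul1r.
Qed.

Lemma smooth_enorm : smooth (@enorm R).
Proof.
apply: (@smooth_ext (fun x => (\sum_(i < 3) x 0 i * x 0 i) * ninv x)).
  move=> x x0; rewrite -/(dot x x) -enormE2 /ninv expr2 -mulrA mulfV ?mulr1//.
  exact: enorm_neq0.
apply: smoothM smooth_ninv; apply: smooth_sum => i.
by apply: smoothM; exact: smooth_coord.
Qed.

Lemma partial_enorm i x : S2 x -> partial i (@enorm R) x = x 0 i.
Proof.
move=> Sx; have x0 := S2_neq0 Sx; have d0 := dot_gt0 x0.
have -> : partial i (@enorm R) = partial i (Num.sqrt \o (fun y : E3 => dot y y)) by [].
rewrite (@partial_comp R _ _ (fun y : E3 => dot y y) x i (is_derive1_sqrt d0)); last exact: differentiable_dot.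
by rewrite partial_dot /= -/(enorm x) Sx; field.
Qed.

Lemma radial_grad u i x : s_smooth u -> x != 0 ->
  radial (fun y => s_grad u y 0 i) x = enorm x * partial i (radial u) x.
Proof.
move=> /s_smoothP su x0; rewrite /radial mxE -/(radial u) partial_radialZ ?invr_gt0 ?enorm_gt0//.
  by rewrite invrK.
by apply: smooth_diff => //; apply: S2_neq0; exact: radial_sphere.
Qed.

Lemma smooth_field_grad u : s_smooth u -> smooth_field (s_grad u).
Proof.
move=> su; split=> [x Sx|i].
  rewrite /dot; under eq_bigr do rewrite mxE mulrC.
  apply: radial_euler; first exact: S2_neq0.
  by apply: smooth_diff (S2_neq0 Sx); exact/s_smoothP.
apply/s_smoothP.
apply: (@smooth_ext (fun x => enorm x * partial i (radial u) x)).
  by move=> x x0; rewrite radial_grad.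
by apply: smoothM smooth_enorm _; apply: smooth_partial; exact/s_smoothP.
Qed.

(** The gradient extends in degree 0 as enorm times the gradient of the
    extension of u; the radial term of the product rule is 0 by Euler. *)
Lemma laplace_div u x : s_smooth u -> S2 x -> laplace u x = s_div (s_grad u) x.
Proof.
move=> su Sx; have x0 := S2_neq0 Sx.
have sr : smooth (radial u) by exact/s_smoothP.
have -> : s_div (s_grad u) x =
    \sum_(i < 3) (partial i (partial i (radial u)) x + x 0 i * partial i (radial u) x).
  apply: eq_bigr => i _.
  rewrite (@near_partial _ (fun x => enorm x * partial i (radial u) x)); last first.
    by apply: off0_near x0 => y y0; rewrite radial_grad.
  rewrite partialM; [|exact: smooth_diff smooth_enorm _|
    by apply: smooth_diff x0; exact: smooth_partial].
  by rewrite partial_enorm// Sx mul1r [in X in _ + X = _]mulrC.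
rewrite big_split/= [X in _ = _ + X]radial_euler ?addr0//.
exact: smooth_diff.
Qed.

End Smooth.

(** * Integration on the sphere in spherical coordinates *)

Section SphereMeasure.
Variable R : realType.
Local Notation E3 := 'rV[R]_3.
Local Notation mu2 := (@mu2 R).
Local Notation D := (@sph_dom R).
Local Notation leb := (@lebesgue_measure R).
Implicit Types (u : E3 -> R) (x y p : E3) (z : R * R).

(** An open set is the union of the countably many products of balls with
    rational centres and radii 1 / (n + 1) that it contains. *)
Lemma open_measurable_prod (U : set (R * R)) : open U -> measurable U.
Proof.
move=> oU.
pose rect (i : rat * rat * nat) : set (R * R) :=
  ball (ratr i.1.1 : R) (i.2.+1%:R^-1) `*` ball (ratr i.1.2 : R) (i.2.+1%:R^-1).
pose F i := if pselect (rect i `<=` U) then rect i else set0.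
have -> : U = \bigcup_i F i.
  apply/seteqP; split=> [[a b] Uab|z [i _]]; last first.
    by rewrite /F; case: pselect => // H; exact: H.
  have /nbhs_ballP[e /= e0 beU] := open_nbhs_nbhs (conj oU Uab).
  have [n ne] : exists n, n.+1%:R^-1 < e / 2.
    have [n _ H] := near_infty_natSinv_lt (PosNum (divr_gt0 e0 (ltr0n R 2))).
    by exists n; exact: (H n (leqnn n)).
  have n0 : 0 < n.+1%:R^-1 :> R by rewrite invr_gt0 ltr0n.
  have H (t : R) : exists q : rat, ball (ratr q : R) n.+1%:R^-1 t.
    have /rat_in_itvoo[q] : t - n.+1%:R^-1 < t by rewrite ltrBlDr ltrDl.
    rewrite in_itv/= => /andP[q1 q2]; exists q.
    rewrite /ball/= ltr_norml; move: (ratr q) (_^-1) n0 q1 q2 => r d d0 q1 q2; apply/andP; split; lra.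
  have [q1 Hq1] := H a; have [q2 Hq2] := H b.
  exists (q1, q2, n) => //; rewrite /F; case: pselect => [//|]; case.
  move=> [c d] [/= Hc Hd]; apply: beU.
  have tri (q : rat) (s t : R) : ball (ratr q : R) n.+1%:R^-1 s ->
      ball (ratr q : R) n.+1%:R^-1 t -> ball s e t.
    rewrite /ball/= !ltr_norml; move: (ratr q) (_^-1) ne n0 => r d' ne n0.
    by move=> /andP[h1 h2] /andP[h3 h4]; apply/andP; split; lra.
  by split=> /=; [exact: (tri _ _ _ Hq1 Hc)|exact: (tri _ _ _ Hq2 Hd)].
apply: countable_bigcupT_measurable => // i.
rewrite /F; case: pselect => subU; last exact: measurable0.
by rewrite /rect; apply: measurableX; apply: open_measurable; apply: ball_open;
  rewrite invr_gt0 ltr0n.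
Qed.

Lemma continuous_measurable_prod (f : R * R -> R) :
  continuous f -> measurable_fun setT f.
Proof.
move=> /continuousP cf; apply: (measurability _ (RGenOpens.measurableE R)).
move=> _ [_ [a [b ->] <-]]; rewrite setTI; apply: open_measurable_prod.
exact/cf/interval_open.
Qed.

Lemma sph_S2 z : S2 (sph z).
Proof.
apply: dot1_S2; rewrite dotE !mxE /=.
have := cos2Dsin2 z.1; have := cos2Dsin2 z.2.
move: (cos z.1) (sin z.1) (cos z.2) (sin z.2) => a b c d h1 h2.
rewrite -[RHS]h2 -[in RHS](mulr1 (b ^+ 2)) -h1; ring.
Qed.

Lemma continuous_sph : continuous (@sph R).
Proof.
have -> : @sph R = fun z => (sin z.1 * cos z.2) *: 'e_0 +
    (sin z.1 * sin z.2) *: 'e_1 + (cos z.1) *: 'e_2%:R.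
  apply/funext => z; apply/rowP => i; rewrite !mxE /=.
  by case: i => -[|[|[|//]]] i3; rewrite -!val_eqE /= ?mulr1 ?mulr0 ?addr0 ?add0r.
move=> z.
have c1 : (fst : R * R -> R) y @[y --> z] --> z.1 by exact: cvg_fst.
have c2 : (snd : R * R -> R) y @[y --> z] --> z.2 by exact: cvg_snd.
have s1 : sin y.1 @[y --> z] --> sin z.1 by apply: continuous_cvg c1; exact: continuous_sin.
have s2 : sin y.2 @[y --> z] --> sin z.2 by apply: continuous_cvg c2; exact: continuous_sin.
have d1 : cos y.1 @[y --> z] --> cos z.1 by apply: continuous_cvg c1; exact: continuous_cos.
have d2 : cos y.2 @[y --> z] --> cos z.2 by apply: continuous_cvg c2; exact: continuous_cos.
apply: cvgD; last by apply: cvgZr_tmp; exact: d1.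
by apply: cvgD; apply: cvgZr_tmp; apply: cvgM.
Qed.

Lemma measurable_D : measurable D.
Proof. by apply: measurableX; exact: measurable_itv. Qed.

(** The Borel structure of R and the structure that carries Lebesgue measure
    have the same measurable sets under different displays. *)
Lemma measurable_D2 : measurable (D : set (measurableTypeR R * measurableTypeR R)).
Proof. exact: measurable_D. Qed.

Lemma measurable_fun_D2 (f : R * R -> R) : measurable_fun D f ->
  measurable_fun (D : set (measurableTypeR R * measurableTypeR R)) f.
Proof. exact. Qed.

Lemma mu2X (A B : set R) : measurable A -> measurable B -> mu2 (A `*` B) = (leb A * leb B)%E.
Proof. by move=> mA mB; rewrite /Defs.mu2 product_measure1E. Qed.

Lemma mu2_D_fin : (mu2 D < +oo)%E.
Proof.
rewrite mu2X; try exact: measurable_itv.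
rewrite !lebesgue_measure_itv /= !lte_fin pi_gt0 mulr_gt0// ?pi_gt0//.
by rewrite -!EFinB -EFinM ltry.
Qed.

Lemma D_sin z : D z -> 0 <= sin z.1.
Proof. by move=> [/= H _]; apply: sin_ge0_pi; move: H; rewrite in_itv. Qed.

Lemma eq_s_int u v : (forall x, S2 x -> u x = v x) -> s_int u = s_int v.
Proof. by move=> uv; apply: eq_Rintegral => z _; rewrite uv//; exact: sph_S2. Qed.

Lemma eq_s_integrable u v : (forall x, S2 x -> u x = v x) -> s_integrable u -> s_integrable v.
Proof. by move=> uv; apply: eq_integrable => [|z _]; [exact: measurable_D2|rewrite uv//; exact: sph_S2]. Qed.

Lemma eq_s_measurable u v : (forall x, S2 x -> u x = v x) -> s_measurable u -> s_measurable v.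
Proof. by move=> uv; apply: eq_measurable_fun => z _; rewrite /= uv//; exact: sph_S2. Qed.

Lemma measurable_sin1 : measurable_fun D (fun z : R * R => sin z.1).
Proof.
apply: measurable_funTS; apply: (measurableT_comp _ measurable_fst).
by apply: continuous_measurable_fun; exact: continuous_sin.
Qed.

Lemma s_measurable_weight u : s_measurable u -> measurable_fun D (fun z => u (sph z) * sin z.1).
Proof. by move=> mu; apply: measurable_funM => //; exact: measurable_sin1. Qed.

Lemma continuous_s_measurable u : (forall x, S2 x -> {for x, continuous u}) -> s_measurable u.
Proof.
move=> cu; apply: measurable_funTS; apply: continuous_measurable_prod => z.
by apply: continuous_comp; [exact: continuous_sph|apply: cu; exact: sph_S2].
Qed.

Lemma s_bounded_integrable u C : s_measurable u -> (forall x, S2 x -> `|u x| <= C) -> s_integrable u.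
Proof.
move=> mu uC; have := @measurable_bounded_integrable _ _ R mu2 (fun z => u (sph z) * sin z.1) D measurable_D2 mu2_D_fin (s_measurable_weight mu).
apply; exists C; split; first exact: num_real.
move=> M CM z Dz /=; apply: le_trans (ltW CM); rewrite normrM.
rewrite -[leRHS]mulr1 ler_pM//; first by apply: uC; exact: sph_S2.
exact: sin_max.
Qed.

Lemma s_measurableM u v : s_measurable u -> s_measurable v -> s_measurable (fun x => u x * v x).
Proof. exact: measurable_funM. Qed.
Lemma s_measurableD u v : s_measurable u -> s_measurable v -> s_measurable (fun x => u x + v x).
Proof. exact: measurable_funD. Qed.
Lemma s_measurable_cst (c : R) : s_measurable (fun=> c).
Proof. exact: measurable_cst. Qed.

Lemma s_intD u v : s_integrable u -> s_integrable v ->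
  s_int (fun x => u x + v x) = s_int u + s_int v.
Proof.
move=> iu iv; rewrite /s_int -RintegralD//; last exact: measurable_D2.
by apply: eq_Rintegral => z _; rewrite mulrDl.
Qed.

Lemma s_intZ c u : s_integrable u -> s_int (fun x => c * u x) = c * s_int u.
Proof.
move=> iu; rewrite /s_int -RintegralZl//; last exact: measurable_D2.
by apply: eq_Rintegral => z _; rewrite mulrA.
Qed.

Lemma s_integrableD u v : s_integrable u -> s_integrable v -> s_integrable (fun x => u x + v x).
Proof.
move=> iu iv; have := integrableD measurable_D2 iu iv.
by apply: eq_integrable => [|z _]; [exact: measurable_D2|rewrite /= -EFinD mulrDl].
Qed.

Lemma s_integrableZ c u : s_integrable u -> s_integrable (fun x => c * u x).
Proof.
move=> iu; have := integrableZl measurable_D2 c iu.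
by apply: eq_integrable => [|z _]; [exact: measurable_D2|rewrite /= -EFinM mulrA].
Qed.

Lemma le_s_int u v : s_integrable u -> s_integrable v ->
  (forall x, S2 x -> u x <= v x) -> s_int u <= s_int v.
Proof.
move=> iu iv uv; apply: le_Rintegral => //; first exact: measurable_D2.
move=> z Dz; rewrite ler_wpM2r//; first exact: D_sin.
by apply: uv; exact: sph_S2.
Qed.

Lemma s_integrable_meas u : s_integrable u -> measurable_fun D (fun z => u (sph z) * sin z.1).
Proof. by move=> /measurable_int /measurable_EFinP. Qed.

Lemma ae_off_parallels (a b : R) (P : R * R -> Prop) :
  (forall z, D z -> z.1 != a -> z.1 != b -> P z) -> {ae mu2, forall z, D z -> P z}.
Proof.
have mab : measurable [set a; b] by apply: measurableU; exact: measurable_set1.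
move=> H; exists ([set a; b] `*` setT); split.
- exact: (@measurableX _ _ (measurableTypeR R) (measurableTypeR R)).
- rewrite mu2X//; rewrite [X in (X * _)%E](_ : _ = 0%E) ?mul0e//.
  by apply: countable_lebesgue_measure0; exact: finite_set_countable.
- move=> z /= /not_implyP[Dz nP]; split=> //.
  have [->|za] := eqVneq z.1 a; first by left.
  have [->|zb] := eqVneq z.1 b; first by right.
  by exfalso; apply: nP; exact: H.
Qed.

Lemma sph_dotE p z : sph z = p -> cos z.1 = p 0 2%:R.
Proof. by move=> <-; rewrite mxE. Qed.

Lemma dotBB x y : dot (x - y) (x - y) = dot x x - 2 * dot x y + dot y y.
Proof. by rewrite !dotE !mxE; ring. Qed.

Lemma dot_S2_le1 x p : S2 x -> S2 p -> -1 <= dot x p <= 1.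
Proof.
move=> Sx Sp; have h1 := dot_ge0 (x - p); have h2 := dot_ge0 (x - - p).
move: h1 h2; rewrite !dotBB (S2_dot Sx) (S2_dot Sp).
have -> : dot (- p) (- p) = 1 by rewrite -(S2_dot Sp) !dotE !mxE; ring.
have -> : dot x (- p) = - dot x p by rewrite !dotE !mxE; ring.
by move=> h1 h2; apply/andP; split; lra.
Qed.

Lemma dot_eq0 x : dot x x = 0 -> x = 0.
Proof.
by move=> xx; apply/eqP; apply: contraT => /dot_gt0; rewrite xx ltxx.
Qed.

Lemma dot_S2_eq1 x p : S2 x -> S2 p -> dot x p = 1 -> x = p.
Proof.
move=> Sx Sp xp; apply/eqP; rewrite -subr_eq0; apply/eqP; apply: dot_eq0.
by rewrite dotBB (S2_dot Sx) (S2_dot Sp) xp; ring.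
Qed.

Lemma dot_S2_eqN1 x p : S2 x -> S2 p -> dot x p = -1 -> x = - p.
Proof.
move=> Sx Sp xp; apply/eqP; rewrite -subr_eq0; apply/eqP; apply: dot_eq0.
rewrite dotBB (S2_dot Sx).
have -> : dot (- p) (- p) = 1 by rewrite -(S2_dot Sp) !dotE !mxE; ring.
have -> : dot x (- p) = - dot x p by rewrite !dotE !mxE; ring.
by rewrite xp; ring.
Qed.

Lemma ae_D_sub (P Q : R * R -> Prop) : (forall z, D z -> P z -> Q z) ->
  {ae mu2, forall z, D z -> P z} -> {ae mu2, forall z, D z -> Q z}.
Proof.
move=> PQ [N [mN N0 sN]]; exists N; split=> // z /= nQ; apply: sN => /= H; apply: nQ => Dz.
exact: PQ (H Dz).
Qed.

Lemma ae_D_and (P Q : R * R -> Prop) : {ae mu2, forall z, D z -> P z} ->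
  {ae mu2, forall z, D z -> Q z} -> {ae mu2, forall z, D z -> P z /\ Q z}.
Proof.
move=> [N [mN N0 sN]] [M [mM M0 sM]]; exists (N `|` M); split.
- exact: measurableU.
- exact: null_set_setU.
- move=> z /= nPQ; apply: contrapT => NM; apply: nPQ => Dz; split.
    by apply: contrapT => nP; apply: NM; left; apply: sN => /= /(_ Dz).
  by apply: contrapT => nQ; apply: NM; right; apply: sM => /= /(_ Dz).
Qed.

(** The points p and - p lie on two parallels of latitude. *)
Lemma ae_off_poles p (P : R * R -> Prop) : S2 p ->
  (forall z, D z -> -1 < dot (sph z) p < 1 -> P z) -> {ae mu2, forall z, D z -> P z}.
Proof.
move=> Sp H; apply: (@ae_off_parallels (acos (p 0 2%:R)) (acos (- p 0 2%:R))) => z Dz za zb.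
apply: H => //; have /andP[h1 h2] := dot_S2_le1 (sph_S2 z) Sp.
have z1 : z.1 \in `[0, pi] by case: Dz.
rewrite !lt_neqAle h1 h2 !andbT; apply/andP; split.
  apply: contra zb => /eqP/esym/(dot_S2_eqN1 (sph_S2 z) Sp)/sph_dotE.
  by rewrite mxE => <-; rewrite cosK.
by apply: contra za => /eqP/(dot_S2_eq1 (sph_S2 z) Sp)/sph_dotE <-; rewrite cosK.
Qed.

(** Dominated convergence, with pointwise hypotheses off p and - p only: these
    are the points where zonal functions about p may be singular. *)
Lemma s_int_dct p (u_ : nat -> E3 -> R) u g : S2 p ->
  (forall n, s_measurable (u_ n)) -> measurable_fun D (fun z => u (sph z) * sin z.1) ->
  s_integrable g -> (forall n x, S2 x -> -1 < dot x p < 1 -> `|u_ n x| <= g x) ->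
  (forall x, S2 x -> -1 < dot x p < 1 -> u_ n x @[n --> \oo] --> u x) ->
  s_integrable u /\ s_int (u_ n) @[n --> \oo] --> s_int u.
Proof.
move=> Sp mu_ mu ig ug cu.
have [] := @dominated_convergence _ _ R mu2 D measurable_D2
  (fun n z => (u_ n (sph z) * sin z.1)%:E) (fun z => (u (sph z) * sin z.1)%:E)
  (fun z => (g (sph z) * sin z.1)%:E).
- by move=> n; apply/measurable_EFinP; exact: s_measurable_weight.
- exact/measurable_EFinP.
- apply: (ae_off_poles Sp) => z Dz zp; apply: cvg_EFin; first by near=> n.
  by apply: cvgMl_tmp || apply: cvgMr_tmp; apply: cu => //; exact: sph_S2.
- exact: ig.
- have H : {ae mu2, forall z, D z -> forall n, (`|(u_ n (sph z) * sin z.1)%:E| <= (g (sph z) * sin z.1)%:E)%E}.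
    apply: (ae_off_poles Sp) => z Dz zp n; rewrite lee_fin normrM (ger0_norm (D_sin Dz)).
    by rewrite ler_wpM2r ?D_sin//; apply: ug => //; exact: sph_S2.
  have [N [mN N0 sub]] := H; exists N; split=> // z /= nP; apply: sub => /= HH.
  by apply: nP => n Dz; exact: HH.
move=> iu _ cv; split; first exact: iu.
rewrite /s_int /Rintegral; apply: fine_cvg => /=.
rewrite fineK//; exact: (integrable_fin_num measurable_D2 iu).
Unshelve. all: by end_near. Qed.

(** Fatou's lemma, in place of a dominating function. *)
Lemma s_integrable_fatou p (u_ : nat -> E3 -> R) u C : S2 p ->
  (forall n, s_integrable (u_ n)) -> (forall n x, S2 x -> 0 <= u_ n x) ->
  (forall n, s_int (u_ n) <= C) -> s_measurable u -> (forall x, S2 x -> 0 <= u x) ->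
  (forall x, S2 x -> -1 < dot x p < 1 -> u_ n x @[n --> \oo] --> u x) -> s_integrable u.
Proof.
move=> Sp iu u0 uC mu uu0 cu.
pose f n z : \bar R := (u_ n (sph z) * sin z.1)%:E.
have mD : measurable (D : set (measurableTypeR R * measurableTypeR R)) by exact: measurable_D2.
have mf n : measurable_fun D (f n) by apply/measurable_EFinP; exact: s_integrable_meas (iu n).
have f0 n z : D z -> (0 <= f n z)%E.
  by move=> Dz; rewrite lee_fin mulr_ge0 ?D_sin//; apply: u0; exact: sph_S2.
have mul : measurable_fun D (fun z => (u (sph z) * sin z.1)%:E).
  by apply/measurable_EFinP; exact: s_measurable_weight.
apply/integrableP; split; first exact: mul.
have E : (\int[mu2]_(z in D) `|(u (sph z) * sin z.1)%:E| = \int[mu2]_(z in D) limn_einf (f ^~ z))%E.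
  apply: ae_eq_integral => //.
  - by apply: measurableT_comp => //.
  - apply: (measurableT_comp (@oppe_measurable R setT)); apply: (@measurable_fun_limn_esup _ _ _ D (fun n z => - f n z)%E) => n.
    exact: (measurableT_comp (@oppe_measurable R setT) (mf n)).
  - apply: (ae_off_poles Sp) => z Dz zp.
    have c : f n z @[n --> \oo] --> (u (sph z) * sin z.1)%:E.
      apply: cvg_EFin; first by near=> n.
      by apply: cvgMr_tmp; apply: cu => //; exact: sph_S2.
    rewrite (is_cvg_limn_einfE (cvgP _ c)) (cvg_lim _ c)//.
    by rewrite gee0_abs// lee_fin mulr_ge0 ?D_sin//; apply: uu0; exact: sph_S2.
have F := fatou mu2 mD mf f0.
rewrite E; apply: (@le_lt_trans _ _ C%:E); last exact: ltry.
apply: (le_trans F).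
rewrite limn_einf_lim; apply: lime_le; first exact: is_cvg_einfs.
apply: nearW => n; apply: le_trans (_ : (\int[mu2]_(z in D) f n z <= _)%E).
  by apply: ereal_inf_lbound; exists n => /=.
have := uC n; rewrite /s_int /Rintegral -lee_fin fineK//.
exact: (integrable_fin_num measurable_D2 (iu n)).
Unshelve. all: by end_near. Qed.

End SphereMeasure.

(** * Iterated integrals and the area of the sphere *)

Section Divergence.
Variable R : realType.
Local Notation E3 := 'rV[R]_3.
Local Notation mu2 := (@mu2 R).
Local Notation D := (@sph_dom R).
Local Notation leb := (@lebesgue_measure R).
Implicit Types (u : E3 -> R) (x y p : E3) (z : R * R).

Lemma compact_D : compact D.
Proof. by apply: compact_setX; exact: segment_compact. Qed.

Lemma continuous_bounded_D (f : R * R -> R) : continuous f ->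
  exists C, forall z, D z -> `|f z| <= C.
Proof.
move=> cf.
have D0 : D !=set0.
  exists (0, 0); split => /=; rewrite in_itv /= lexx ?pi_ge0//.
  by rewrite mulr_ge0// pi_ge0.
have [|c _ H] := compact_EVT_max D0 compact_D (f := fun z => `|f z|).
  apply: continuous_subspaceT => z; apply: continuous_comp; first exact: cf.
  exact: norm_continuous.
by exists `|f c| => z Dz; apply: H; rewrite inE.
Qed.

Lemma continuous_integrable_D (f : R * R -> R) : continuous f ->
  mu2.-integrable D (EFin \o f).
Proof.
move=> cf; have [C HC] := continuous_bounded_D cf.
apply: (@measurable_bounded_integrable _ _ R mu2 f D (@measurable_D2 R) (mu2_D_fin R)).
  by apply: measurable_fun_D2; apply: measurable_funTS; exact: continuous_measurable_prod.
exists C; split; first exact: num_real.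
by move=> M CM z Dz /=; apply: le_trans (ltW CM); exact: HC.
Qed.

Lemma fubini_D1 (f : R * R -> R) (g : R -> R) : continuous f ->
  (forall b, b \in `[0, 2 * pi] -> (\int[leb]_(a in `[0%R, pi]) (f (a, b))%:E = (g b)%:E)%E) ->
  (\int[mu2]_(z in D) (f z)%:E = \int[leb]_(b in `[0%R, (2 * pi)%R]) (g b)%:E)%E.
Proof.
move=> cf fg; rewrite integral_mkcond.
rewrite -(@integral21_prod_meas1 _ _ _ _ R leb leb ((EFin \o f) \_ D)); last first.
  exact: (integrable_mkcond _ (@measurable_D2 R)).1 (continuous_integrable_D cf).
rewrite [RHS]integral_mkcond; apply: eq_integral => b _.
rewrite /fubini_G patchE; case: ifPn => [|] bI.
  rewrite -fg; last by rewrite inE in bI.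
  rewrite [RHS]integral_mkcond; apply: eq_integral => a _; rewrite !patchE.
  rewrite (_ : ((a, b) \in D) = (a \in `[0, pi]%classic))//.
  rewrite inE in bI; apply/idP/idP; rewrite !inE; first by case.
  by move=> ?; split.
apply: integral0_eq => a _; rewrite patchE; case: ifPn => //.
by rewrite inE => -[_ /= H]; move: bI; rewrite notin_setE.
Qed.

Lemma fubini_D2 (f : R * R -> R) (g : R -> R) : continuous f ->
  (forall a, a \in `[0, pi] -> (\int[leb]_(b in `[0%R, (2 * pi)%R]) (f (a, b))%:E = (g a)%:E)%E) ->
  (\int[mu2]_(z in D) (f z)%:E = \int[leb]_(a in `[0%R, pi]) (g a)%:E)%E.
Proof.
move=> cf fg; rewrite integral_mkcond.
rewrite -(@integral12_prod_meas1 _ _ _ _ R leb leb ((EFin \o f) \_ D)); last first.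
  exact: (integrable_mkcond _ (@measurable_D2 R)).1 (continuous_integrable_D cf).
rewrite [RHS]integral_mkcond; apply: eq_integral => a _.
rewrite /fubini_F patchE; case: ifPn => [|] aI.
  rewrite -fg; last by rewrite inE in aI.
  rewrite [RHS]integral_mkcond; apply: eq_integral => b _; rewrite !patchE.
  rewrite (_ : ((a, b) \in D) = (b \in `[0, 2 * pi]%classic))//.
  rewrite inE in aI; apply/idP/idP; rewrite !inE; first by case.
  by move=> ?; split.
apply: integral0_eq => b _; rewrite patchE; case: ifPn => //.
by rewrite inE => -[/= H _]; move: aI; rewrite notin_setE.
Qed.

Lemma FTC (F f : R -> R) (a b : R) : a < b ->
  (forall t : R, is_derive t 1 F (f t)) -> continuous f ->
  (\int[leb]_(t in `[a, b]) (f t)%:E = (F b)%:E - (F a)%:E)%E.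
Proof.
move=> ab dF cf; apply: continuous_FTC2 => //.
- exact: continuous_subspaceT.
- split.
  + by move=> t _; case: (dF t).
  + apply: cvg_at_right_filter; exact: (isd_cont (dF a)).
  + apply: cvg_at_left_filter; exact: (isd_cont (dF b)).
- by move=> t _; rewrite derive1E derive_val.
Qed.

Lemma s_areaE : s_area R = 4 * pi.
Proof.
rewrite /s_area /s_int /Rintegral; under eq_integral do rewrite mul1r.
rewrite (@fubini_D2 _ (fun a => 2 * pi * sin a)); first last.
- move=> a _; transitivity (\int[leb]_(b in `[0%R, (2 * pi)%R]) (sin a)%:E)%E => //.
  rewrite lebesgue_integral_nonneg.integral_cstr//.
  have L : leb `[0, 2 * pi]%classic = (2 * pi)%:E.
    by rewrite lebesgue_measure_itv /= lte_fin mulr_gt0// ?pi_gt0// -EFinB subr0.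
  by rewrite [X in (_ * X)%E]L -EFinM mulrC.
- move=> z; apply: (@continuous_comp _ _ _ fst sin); [exact: cvg_fst|exact: continuous_sin].
have dF (t : R) : is_derive t (1 : R) (fun a => - (2 * pi) * cos a) (2 * pi * sin t).
  by apply: isd_eq (isdZ _ (is_derive_cos t)) _; ring.
have cs : continuous (fun t : R => 2 * pi * sin t).
  by move=> t; apply: cvgMl_tmp; exact: continuous_sin.
by rewrite (FTC (pi_gt0 R) dF cs) -EFinB /= cospi cos0; ring.
Qed.

End Divergence.

(** * The divergence theorem on the sphere *)

Section DivergenceTheorem.
Variable R : realType.
Local Notation E3 := 'rV[R]_3.
Local Notation mu2 := (@mu2 R).
Local Notation D := (@sph_dom R).
Implicit Types (u : E3 -> R) (x y p : E3) (z : R * R).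

(** The orthonormal frame of the coordinate directions; the derivative of sph in
    the second coordinate is sin theta times e_phi. *)
Definition e_theta (z : R * R) : E3 :=
  \row_(i < 3) [:: cos z.1 * cos z.2; cos z.1 * sin z.2; - sin z.1]`_i.
Definition e_phi (z : R * R) : E3 := \row_(i < 3) [:: - sin z.2; cos z.2; 0]`_i.

Lemma sph_dtheta (a b : R) i : is_derive a 1 (fun t => sph (t, b) 0 i) (e_theta (a, b) 0 i).
Proof.
rewrite mxE; case: i => -[|[|[|//]]] i3 /=.
- rewrite (_ : (fun t => _) = (fun t => sin t * cos b)); last by apply/funext => t; rewrite mxE.
  by apply: isd_eq (isdM (is_derive_sin a) (isdC _ a)) _; ring.
- rewrite (_ : (fun t => _) = (fun t => sin t * sin b)); last by apply/funext => t; rewrite mxE.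
  by apply: isd_eq (isdM (is_derive_sin a) (isdC _ a)) _; ring.
- rewrite (_ : (fun t => _) = cos); last by apply/funext => t; rewrite mxE.
  exact: is_derive_cos.
Qed.

Lemma sph_dphi (a b : R) i : is_derive b 1 (fun t => sph (a, t) 0 i) ((sin a *: e_phi (a, b)) 0 i).
Proof.
rewrite !mxE; case: i => -[|[|[|//]]] i3 /=.
- rewrite (_ : (fun t => _) = (fun t => sin a * cos t)); last by apply/funext => t; rewrite mxE.
  by apply: isdZ; exact: is_derive_cos.
- rewrite (_ : (fun t => _) = (fun t => sin a * sin t)); last by apply/funext => t; rewrite mxE.
  by apply: isdZ; exact: is_derive_sin.
- rewrite (_ : (fun t => _) = fun=> cos a); last by apply/funext => t; rewrite mxE.
  by rewrite mulr0; exact: isdC.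
Qed.

Lemma contD (f g : R * R -> R) : continuous f -> continuous g -> continuous (fun z => f z + g z).
Proof. by move=> cf cg z; apply: cvgD; [exact: cf|exact: cg]. Qed.
Lemma contM (f g : R * R -> R) : continuous f -> continuous g -> continuous (fun z => f z * g z).
Proof. by move=> cf cg z; apply: cvgM; [exact: cf|exact: cg]. Qed.
Lemma contN (f : R * R -> R) : continuous f -> continuous (fun z => - f z).
Proof. by move=> cf z; apply: cvgN; exact: cf. Qed.

Variable X : E3 -> E3.
Let Y i := fun x => X x 0 i.
Hypothesis dX : forall i x, S2 x -> differentiable (Y i) x.
Hypothesis cX : forall i j x, S2 x -> {for x, continuous (partial j (Y i))}.
Hypothesis tX : tangential X.

Let M i j z := partial j (Y i) (sph z).
Let G i z := Y i (sph z).

Let gradth i z := e_theta z 0 0 * M i 0 z + e_theta z 0 1 * M i 1 z + e_theta z 0 2%:R * M i 2%:R z.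
Let gradph i z := e_phi z 0 0 * M i 0 z + e_phi z 0 1 * M i 1 z + e_phi z 0 2%:R * M i 2%:R z.

Lemma G_dtheta i (a b : R) : is_derive a 1 (fun t => G i (t, b)) (gradth i (a, b)).
Proof.
have := @is_derive_along R (Y i) (fun t => sph (t, b)) (e_theta (a, b)) a (dX i (sph_S2 _)) (sph_dtheta a b).
by rewrite sum3.
Qed.

Lemma G_dphi i (a b : R) : is_derive b 1 (fun t => G i (a, t)) (sin a * gradph i (a, b)).
Proof.
have := @is_derive_along R (Y i) (fun t => sph (a, t)) (sin a *: e_phi (a, b)) b (dX i (sph_S2 _)) (sph_dphi a b).
have key (s e0 e1 e2 m0 m1 m2 : R) : s * e0 * m0 + s * e1 * m1 + s * e2 * m2 =
  s * (e0 * m0 + e1 * m1 + e2 * m2) by ring.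
by rewrite sum3 3!(@mxE _ _ _ _ (fun i j => _ * _)) => H; apply: isd_eq H _; exact: key.
Qed.

Let A z := sin z.1 * (G 0 z * (cos z.1 * cos z.2) + G 1 z * (cos z.1 * sin z.2) + G 2%:R z * (- sin z.1)).
Let B z := G 0 z * - sin z.2 + G 1 z * cos z.2.

Let dA z :=
  cos z.1 * (G 0 z * (cos z.1 * cos z.2) + G 1 z * (cos z.1 * sin z.2) + G 2%:R z * (- sin z.1)) +
  sin z.1 * (gradth 0 z * (cos z.1 * cos z.2) + gradth 1 z * (cos z.1 * sin z.2) + gradth 2%:R z * (- sin z.1)
   + (G 0 z * (- sin z.1 * cos z.2) + G 1 z * (- sin z.1 * sin z.2) + G 2%:R z * (- cos z.1))).
Let dB z := sin z.1 * (gradph 0 z * - sin z.2 + gradph 1 z * cos z.2) +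
  (G 0 z * - cos z.2 + G 1 z * - sin z.2).

Lemma A_deriv (a b : R) : is_derive a 1 (fun t => A (t, b)) (dA (a, b)).
Proof.
rewrite /A /=.
apply: isd_eq (isdM (is_derive_sin a) (isdD (isdD
  (isdM (G_dtheta 0 a b) (isdM (is_derive_cos a) (isdC (cos b) a)))
  (isdM (G_dtheta 1 a b) (isdM (is_derive_cos a) (isdC (sin b) a))))
  (isdM (G_dtheta 2%:R a b) (isdN (is_derive_sin a))))) _.
by rewrite /dA /=; ring.
Qed.

Lemma B_deriv (a b : R) : is_derive b 1 (fun t => B (a, t)) (dB (a, b)).
Proof.
rewrite /B /=.
apply: isd_eq (isdD (isdM (G_dphi 0 a b) (isdN (is_derive_sin b))) (isdM (G_dphi 1 a b) (is_derive_cos b))) _.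
by rewrite /dB /=; ring.
Qed.

Lemma cG i : continuous (G i).
Proof.
move=> z; apply: (@continuous_comp _ _ _ (@sph R) (Y i)); first exact: continuous_sph.
exact: differentiable_continuous (dX i (sph_S2 z)).
Qed.

Lemma cM i j : continuous (M i j).
Proof.
move=> z; apply: (@continuous_comp _ _ _ (@sph R) (partial j (Y i))); first exact: continuous_sph.
exact: cX (sph_S2 z).
Qed.

Lemma ctrig : [/\ continuous (fun z : R * R => sin z.1), continuous (fun z : R * R => cos z.1),
  continuous (fun z : R * R => sin z.2) & continuous (fun z : R * R => cos z.2)].
Proof.
split=> z.
- by apply: (@continuous_comp _ _ _ fst sin); [exact: cvg_fst|exact: continuous_sin].
- by apply: (@continuous_comp _ _ _ fst cos); [exact: cvg_fst|exact: continuous_cos].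
- by apply: (@continuous_comp _ _ _ snd sin); [exact: cvg_snd|exact: continuous_sin].
- by apply: (@continuous_comp _ _ _ snd cos); [exact: cvg_snd|exact: continuous_cos].
Qed.

Lemma cgradth i : continuous (gradth i).
Proof.
have [s1 c1 s2 c2] := ctrig.
have -> : gradth i = fun z => cos z.1 * cos z.2 * M i 0 z + cos z.1 * sin z.2 * M i 1 z +
    - sin z.1 * M i 2%:R z by apply/funext => z; rewrite /gradth !mxE.
exact: (contD (contD (contM (contM c1 c2) (@cM i 0)) (contM (contM c1 s2) (@cM i 1)))
  (contM (contN s1) (@cM i 2%:R))).
Qed.

Lemma cgradph i : continuous (gradph i).
Proof.
have [s1 c1 s2 c2] := ctrig.
have -> : gradph i = fun z => - sin z.2 * M i 0 z + cos z.2 * M i 1 z.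
  by apply/funext => z; rewrite /gradph !mxE /= mul0r addr0.
exact: (contD (contM (contN s2) (@cM i 0)) (contM c2 (@cM i 1))).
Qed.

Lemma cdA : continuous dA.
Proof.
have [s1 c1 s2 c2] := ctrig.
have H (f0 f1 f2 : R * R -> R) := fun h0 : continuous f0 => fun h1 : continuous f1 => fun h2 : continuous f2 =>
  contD (contD (contM h0 (contM c1 c2)) (contM h1 (contM c1 s2))) (contM h2 (contN s1)).
exact: (contD (contM c1 (H _ _ _ (@cG 0) (@cG 1) (@cG 2%:R)))
  (contM s1 (contD (H _ _ _ (@cgradth 0) (@cgradth 1) (@cgradth 2%:R))
    (contD (contD (contM (@cG 0) (contM (contN s1) c2)) (contM (@cG 1) (contM (contN s1) s2)))
      (contM (@cG 2%:R) (contN c1)))))).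
Qed.

Lemma cdB : continuous dB.
Proof.
have [s1 c1 s2 c2] := ctrig.
exact: (contD (contM s1 (contD (contM (@cgradph 0) (contN s2)) (contM (@cgradph 1) c2)))
  (contD (contM (@cG 0) (contN c2)) (contM (@cG 1) (contN s2)))).
Qed.

Lemma int_dA : (\int[mu2]_(z in D) (dA z)%:E = 0)%E.
Proof.
rewrite (@fubini_D1 _ _ (fun=> 0)); first by rewrite integral0_eq.
  exact: cdA.
move=> b _; have cf : continuous (fun t => dA (t, b)).
  move=> t; apply: (@continuous_comp _ _ _ (fun t => (t, b)) dA); last exact: cdA.
  by apply: (@cvg_pair _ _ _ _ (nbhs t) (nbhs b) _ _ _ id (fun=> b)); [exact: cvg_id|exact: cvg_cst].
rewrite (FTC (pi_gt0 R) (fun t => A_deriv t b) cf).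
by rewrite /A /= sinpi sin0 !mul0r subee.
Qed.

Lemma int_dB : (\int[mu2]_(z in D) (dB z)%:E = 0)%E.
Proof.
have pp : 0 < 2 * pi :> R by rewrite mulr_gt0// pi_gt0.
rewrite (@fubini_D2 _ _ (fun=> 0)); first by rewrite integral0_eq.
  exact: cdB.
move=> a _; have cf : continuous (fun t => dB (a, t)).
  move=> t; apply: (@continuous_comp _ _ _ (fun t => (a, t)) dB); last exact: cdB.
  by apply: (@cvg_pair _ _ _ _ (nbhs a) (nbhs t) _ _ _ (fun=> a) id); [exact: cvg_cst|exact: cvg_id].
rewrite (FTC pp (fun t => B_deriv a t) cf).
have -> : B (a, 2 * pi) = B (a, 0); last by rewrite subee.
have E : sph (a, 2 * pi) = sph (a, 0).
  by apply/rowP => i; rewrite !mxE /= mulr_natl cos2pi sin2pi cos0 sin0.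
by rewrite /B /G E /= mulr_natl cos2pi sin2pi cos0 sin0.
Qed.

(** The divergence minus the normal component of the normal derivative: the
    intrinsic divergence of a tangential field, however the field is extended
    off the sphere. *)
Definition tangential_div x := \sum_(i < 3) partial i (Y i) x -
  \sum_(i < 3) x 0 i * \sum_(j < 3) x 0 j * partial j (Y i) x.

(** dA and dB are the derivatives of sin theta times the e_theta component, and
    of the e_phi component, of the field. *)
Lemma tangential_div_sph z : tangential_div (sph z) * sin z.1 = dA z + dB z.
Proof.
rewrite /tangential_div !sum3 -!/(M _ _ z).
have := tX (sph_S2 z); rewrite dotE -[X (sph z) 0 0]/(G 0 z) -[X (sph z) 0 1]/(G 1 z) -[X (sph z) 0 2%:R]/(G 2%:R z).
rewrite /dA /dB /gradth /gradph !mxE /=.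
have := cos2Dsin2 z.1; have := cos2Dsin2 z.2.
move: (cos z.1) (sin z.1) (cos z.2) (sin z.2) => c s C S h2 h1 t.
move: (M 0 0 z) (M 0 1 z) (M 0 2%:R z) (M 1 0 z) (M 1 1 z) (M 1 2%:R z) (M 2%:R 0 z) (M 2%:R 1 z) (M 2%:R 2%:R z)
 => m00 m01 m02 m10 m11 m12 m20 m21 m22.
move: (G 0 z) (G 1 z) (G 2%:R z) t => g0 g1 g2 t.
(* sph, e_theta and e_phi resolve the identity matrix *)
have b00 : s * C * (s * C) + c * C * (c * C) + S * S = 1.
  by transitivity (C ^+ 2 * (c ^+ 2 + s ^+ 2) + S ^+ 2); [ring|rewrite h1 mulr1].
have b01 : s * C * (s * S) + c * C * (c * S) - S * C = 0.
  by transitivity (C * S * (c ^+ 2 + s ^+ 2 - 1)); [ring|rewrite h1 subrr mulr0].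
have b11 : s * S * (s * S) + c * S * (c * S) + C * C = 1.
  by transitivity (S ^+ 2 * (c ^+ 2 + s ^+ 2) + C ^+ 2); [ring|rewrite h1 mulr1 addrC].
have b22 : c * c + s * s = 1 by rewrite -h1; ring.
transitivity ((m00 * (s * C * (s * C) + c * C * (c * C) + S * S)
  + (m01 + m10) * (s * C * (s * S) + c * C * (c * S) - S * C)
  + m11 * (s * S * (s * S) + c * S * (c * S) + C * C)
  + m22 * (c * c + s * s)
  - (s * C * (s * C * m00 + s * S * m01 + c * m02) +
    s * S * (s * C * m10 + s * S * m11 + c * m12) +
    c * (s * C * m20 + s * S * m21 + c * m22))) * s).
  by rewrite b00 b01 b11 b22; ring.
have p0 : - C = - (s * (s * C) + c * (c * C)).
  by congr (- _); transitivity (C * (c ^+ 2 + s ^+ 2)); [rewrite h1 mulr1|ring].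
have p1 : - S = - (s * (s * S) + c * (c * S)).
  by congr (- _); transitivity (S * (c ^+ 2 + s ^+ 2)); [rewrite h1 mulr1|ring].
rewrite [X in _ = _ + (_ + X)](_ : _ = g0 * (- (s * (s * C) + c * (c * C))) + g1 * (- (s * (s * S) + c * (c * S)))); last by rewrite -p0 -p1.
apply/eqP; rewrite -subr_eq0; apply/eqP.
by transitivity (2 * s * (g0 * (s * C) + g1 * (s * S) + g2 * c)); [ring|rewrite t mulr0].
Qed.

(** Of the two derivatives that make up the density, the first integrates to 0
    because sin vanishes at 0 and pi, the second by periodicity. *)
Theorem divergence_theorem : s_int tangential_div = 0.
Proof.
rewrite /s_int /Rintegral; under eq_integral do rewrite tangential_div_sph EFinD.
rewrite integralD ?int_dA ?int_dB ?adde0//.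
- exact: measurable_D2.
- exact: (continuous_integrable_D cdA).
- exact: (continuous_integrable_D cdB).
Qed.

End DivergenceTheorem.

(** * Integration by parts on the sphere *)

Section IntegrationByParts.
Variable R : realType.
Local Notation E3 := 'rV[R]_3.
Implicit Types (u f g : E3 -> R) (Y : E3 -> E3) (x y p : E3) (z : R * R) (q : R -> R).

Lemma continuous_near f g x : (\forall y \near x, f y = g y) ->
  {for x, continuous f} -> {for x, continuous g}.
Proof.
move=> fg cf; have E : f x = g x by exact: nbhs_singleton fg.
rewrite /prop_for /continuous_at -E.
apply: (cvg_trans _ cf). exact: (@near_eq_cvg _ _ (nbhs x) _ f g fg).
Qed.

Definition sphere_C1 f := forall x, S2 x ->
  (\forall y \near x, differentiable f y) /\ forall i, {for x, continuous (partial i f)}.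

Lemma smooth_C1 f : smooth f -> sphere_C1 f.
Proof.
move=> sf x Sx; have x0 := S2_neq0 Sx; split.
  by apply: filterS (near_neq0 x0) => y; exact: smooth_diff.
move=> i; apply: differentiable_continuous; apply: smooth_diff x0.
exact: smooth_partial.
Qed.

Lemma C1_diff f x : sphere_C1 f -> S2 x -> differentiable f x.
Proof. by move=> Cf Sx; have [/nbhs_singleton] := Cf x Sx. Qed.

Lemma compact_S2 : compact (@S2 R).
Proof.
apply: bounded_closed_compact.
  exists 1; split; first exact: num_real.
  move=> M M1 x Sx; apply: le_trans (ltW M1).
  rewrite [leLHS]/Num.Def.normr/= mx_normrE bigmax_le// => -[i j] _ /=.
  rewrite ord1 -(ler_pXn2r (ltn0Sn 1)) ?nnegrE// expr1n real_normK ?num_real//.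
  rewrite -(S2_dot Sx) /dot (bigD1 j)//= expr2 lerDl sumr_ge0// => k _.
  by rewrite -expr2 sqr_ge0.
have -> : @S2 R = (fun x : E3 => dot x x) @^-1` [set 1].
  by apply/seteqP; split=> x; [exact: S2_dot|exact: dot1_S2].
apply: closed_comp; last exact: closed_eq.
by move=> x _; apply: differentiable_continuous; exact: differentiable_dot.
Qed.

Lemma sphere_bounded u : (forall x, S2 x -> {for x, continuous u}) ->
  exists C, forall x, S2 x -> `|u x| <= C.
Proof.
move=> cu; have S0 : @S2 R !=set0 by exists (sph (0, 0)); exact: sph_S2.
have [|c _ H] := EVT_max_rV S0 compact_S2 (f := fun x => `|u x|).
  apply: continuous_in_subspaceT => x /[!inE] Sx.
  by apply: continuous_comp; [exact: cu|exact: norm_continuous].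
by exists `|u c| => x Sx; apply: H; rewrite inE.
Qed.

Lemma sphere_cont_integrable u : (forall x, S2 x -> {for x, continuous u}) -> s_integrable u.
Proof.
move=> cu; have [C HC] := sphere_bounded cu.
by apply: s_bounded_integrable HC; exact: continuous_s_measurable.
Qed.

Lemma smooth_continuous f x : smooth f -> S2 x -> {for x, continuous f}.
Proof.
by move=> sf Sx; apply: differentiable_continuous; apply: smooth_diff (S2_neq0 Sx).
Qed.

Lemma s_smooth_continuous u x : s_smooth u -> S2 x -> {for x, continuous (radial u)}.
Proof. by move=> /s_smoothP; exact: smooth_continuous. Qed.

(** The divergence theorem for the product of f with the extension of Y along
    rays, whose normal derivative is 0. *)
Lemma div_mul_field f Y : sphere_C1 f -> smooth_field Y ->
  s_int (fun x => f x * s_div Y x + \sum_(i < 3) partial i f x * Y x 0 i) = 0.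
Proof.
move=> Cf [tY sY].
pose r i := radial (fun y => Y y 0 i).
have sr i : smooth (r i) by apply/s_smoothP; exact: sY.
pose X x : E3 := \row_(i < 3) (f x * r i x).
have XE i : (fun x => X x 0 i) = fun x => f x * r i x by apply/funext => x; rewrite mxE.
have pX i j x : S2 x -> \forall y \near x,
    partial j (fun x => X x 0 i) y = f y * partial j (r i) y + r i y * partial j f y.
  move=> Sx; have [df _] := Cf x Sx; near=> y; rewrite XE partialM//; first by near: y.
  by apply: smooth_diff => //; near: y; exact: near_neq0 (S2_neq0 Sx).
have t0 x : S2 x -> \sum_(i < 3) r i x * x 0 i = 0.
  move=> Sx; rewrite -[RHS](tY x Sx) /dot; apply: eq_bigr => i _.
  by rewrite /r radial_S2.
rewrite -[RHS](@divergence_theorem R X).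
- apply: eq_s_int => x Sx; rewrite /tangential_div.
  have E1 i : partial i (fun x => X x 0 i) x = f x * partial i (r i) x + r i x * partial i f x.
    exact: nbhs_singleton (pX i i x Sx).
  have E2 i : x 0 i * \sum_(j < 3) x 0 j * partial j (fun x => X x 0 i) x =
      r i x * x 0 i * \sum_(j < 3) x 0 j * partial j f x.
    under eq_bigr => j _.
      rewrite (nbhs_singleton (pX i j x Sx)) mulrDr mulrCA [x 0 j * (r i x * _)]mulrCA; over.
    rewrite big_split/= -mulr_sumr radial_euler; first last.
    - exact: (smooth_diff (sr i) (S2_neq0 Sx)).
    - exact: S2_neq0.
    by rewrite mulr0 add0r -mulr_sumr; ring.
  rewrite (eq_bigr _ (fun i _ => E1 i)) (eq_bigr _ (fun i _ => E2 i)).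
  rewrite -mulr_suml (t0 x Sx) mul0r subr0 big_split /= -mulr_sumr; congr (_ + _).
  by apply: eq_bigr => i _; rewrite /r radial_S2// mulrC.
- move=> i x Sx; rewrite XE; apply: differentiableM; first exact: C1_diff.
  exact: (smooth_diff (sr i) (S2_neq0 Sx)).
- move=> i j x Sx; have [_ cf] := Cf x Sx.
  apply: (@continuous_near (fun y => f y * partial j (r i) y + r i y * partial j f y)).
    by apply: filterS (pX i j x Sx) => y ->.
  have c1 : {for x, continuous f} by apply: differentiable_continuous; exact: C1_diff.
  have c2 : {for x, continuous (partial j (r i))}.
    by apply: smooth_continuous => //; exact: smooth_partial.
  have c3 : {for x, continuous (r i)} by exact: smooth_continuous.
  exact: (continuousD (continuousM c1 c2) (continuousM c3 (cf j))).
- move=> x Sx; transitivity (f x * \sum_(i < 3) r i x * x 0 i); last by rewrite (t0 x Sx) mulr0.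
  rewrite mulr_sumr /dot; apply: eq_bigr => i _.
  by rewrite mxE mulrA.
Unshelve. all: by end_near. Qed.

Lemma s_div_continuous Y x : smooth_field Y -> S2 x -> {for x, continuous (s_div Y)}.
Proof.
move=> [_ sY] Sx; apply: smooth_continuous => //.
by apply: smooth_sum => i; apply: smooth_partial; apply/s_smoothP; exact: sY.
Qed.

Lemma differentiable_dotr p x : differentiable (fun y : E3 => dot y p) x.
Proof.
rewrite (_ : (fun y => _) = \sum_(i < 3) (fun y : E3 => y 0 i * p 0 i)).
  apply: differentiable_sum => i; apply: differentiableM; first exact: differentiable_coord.
  exact: differentiable_cst.
by apply/funext => y; rewrite fct_sumE.
Qed.

Lemma partial_dotr p x i : partial i (fun y : E3 => dot y p) x = p 0 i.
Proof.
rewrite /partial; have -> : (fun y : E3 => dot y p) = \sum_(j < 3) (fun y : E3 => p 0 j * y 0 j).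
  by apply/funext => y; rewrite fct_sumE; apply: eq_bigr => j _; rewrite mulrC.
have dj j : derivable (fun y : E3 => p 0 j * y 0 j) x 'e_i.
  by apply: diff_derivable; apply: differentiableM; [exact: differentiable_cst|exact: differentiable_coord].
rewrite derive_sum// (bigD1 i)//= [X in _ + X]big1 ?addr0.
  rewrite [LHS](@partialM _ (fun=> p 0 i) (fun y => y 0 i)) ?partial_cst ?partial_coord ?eqxx ?mulr1 ?mulr0 ?addr0//.
  exact: differentiable_coord.
move=> j ji; rewrite [LHS](@partialM _ (fun=> p 0 j) (fun y => y 0 j)) ?partial_cst ?partial_coord//.
  by rewrite (negbTE ji) !mulr0 addr0.
exact: differentiable_coord.
Qed.

(** The profile is defined on a neighbourhood of [-1, 1], which makes the zonal
    function regular at its two poles. *)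
Lemma zonal_C1 q q' (b : R) p : S2 p -> 1 < b ->
  (forall s, -b < s < b -> is_derive s 1 q (q' s)) ->
  (forall s, -b < s < b -> {for s, continuous q'}) ->
  sphere_C1 (fun x => q (dot x p)) /\
  forall x i, S2 x -> partial i (fun x => q (dot x p)) x = q' (dot x p) * p 0 i.
Proof.
move=> Sp b1 dq cq.
have near_b x : S2 x -> \forall y \near x, -b < dot y p < b.
  move=> Sx; have /andP[h1 h2] := dot_S2_le1 Sx Sp.
  have cd : {for x, continuous (fun y : E3 => dot y p)}.
    by apply: differentiable_continuous; exact: differentiable_dotr.
  have n1 : \forall y \near x, -b < dot y p.
    by apply: (cd [set s | -b < s]); apply: near_gt; apply: lt_le_trans h1; lra.
  have n2 : \forall y \near x, dot y p < b.
    by apply: (cd [set s | s < b]); apply: near_lt; exact: le_lt_trans h2 b1.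
  by apply: filterS2 n1 n2 => y -> ->.
have pq x i : -b < dot x p < b -> partial i (fun x => q (dot x p)) x = q' (dot x p) * p 0 i.
  move=> xb; rewrite -(partial_dotr p x i).
  exact: (@partial_comp R q _ (fun y => dot y p) x i (dq _ xb) (differentiable_dotr _ _)).
split; last first.
  by move=> x i Sx; apply: pq; exact: nbhs_singleton (near_b x Sx).
move=> x Sx; split.
  apply: filterS (near_b x Sx) => y yb.
  exact: (@differentiable_compR R q _ (fun y => dot y p) y (dq _ yb) (differentiable_dotr _ _)).
move=> i; apply: (@continuous_near (fun y => q' (dot y p) * p 0 i)).
  by apply: filterS (near_b x Sx) => y yb; rewrite pq.
apply: (@continuousM _ _ (fun y => q' (dot y p)) (fun=> p 0 i)); last exact: cst_continuous.
apply: (@continuous_comp _ _ _ (fun y => dot y p) q').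
  by apply: differentiable_continuous; exact: differentiable_dotr.
by apply: cq; exact: nbhs_singleton (near_b x Sx).
Qed.

End IntegrationByParts.

(** * Zonal functions that are regular at the poles *)

Section Zonal.
Variable R : realType.
Local Notation E3 := 'rV[R]_3.
Implicit Types (u f g : E3 -> R) (Y : E3 -> E3) (x y p : E3) (z : R * R) (q : R -> R).

Lemma s_int_add0 u v : s_integrable u -> s_integrable v ->
  s_int (fun x => u x + v x) = 0 -> s_int u = - s_int v.
Proof. by move=> iu iv; rewrite s_intD// => /eqP; rewrite addr_eq0 => /eqP. Qed.

Lemma continuous_dotr p x : {for x, continuous (fun y : E3 => dot y p)}.
Proof. by apply: differentiable_continuous; exact: differentiable_dotr. Qed.

Lemma continuous_zonal q p x : {for dot x p, continuous q} ->
  {for x, continuous (fun y : E3 => q (dot y p))}.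
Proof.
move=> cq; apply: (@continuous_comp _ _ _ (fun y => dot y p) q) => //.
exact: continuous_dotr.
Qed.

Lemma smooth_field_continuous Y i x : smooth_field Y -> S2 x ->
  {for x, continuous (radial (fun y => Y y 0 i))}.
Proof. by move=> [_ sY]; exact: s_smooth_continuous. Qed.

(** Extended along rays, a smooth field is continuous around the sphere. *)
Definition rfield Y x : E3 := \row_i radial (fun y => Y y 0 i) x.

Lemma rfieldE Y x : S2 x -> rfield Y x = Y x.
Proof. by move=> Sx; apply/rowP => i; rewrite mxE radial_S2. Qed.

Lemma continuous_dot_field Y p x : smooth_field Y -> S2 x ->
  {for x, continuous (fun y => dot p (rfield Y y))}.
Proof.
move=> sY Sx; rewrite (_ : (fun y => _) = (fun y : E3 => p 0 0 * rfield Y y 0 0 +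
  p 0 1 * rfield Y y 0 1 + p 0 2%:R * rfield Y y 0 2%:R)); last first.
  by apply/funext => y; rewrite dotE.
have c i : {for x, continuous (fun y => p 0 i * rfield Y y 0 i)}.
  apply: (@continuousM _ _ (fun=> p 0 i) (fun y => rfield Y y 0 i)); first exact: cst_continuous.
  rewrite (_ : (fun y => _) = radial (fun y => Y y 0 i)); first exact: smooth_field_continuous.
  by apply/funext => y; rewrite mxE.
exact: (continuousD (continuousD (c 0) (c 1)) (c 2%:R)).
Qed.

Section Regular.
Variables (q q' : R -> R) (b : R) (p : E3).
Hypotheses (Sp : S2 p) (b1 : 1 < b).
Hypothesis dq : forall s, -b < s < b -> is_derive s 1 q (q' s).
Hypothesis cq : forall s, -b < s < b -> {for s, continuous q'}.

Lemma in_b x : S2 x -> -b < dot x p < b.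
Proof.
move=> Sx; have /andP[h1 h2] := dot_S2_le1 Sx Sp.
by rewrite (lt_le_trans _ h1) ?(le_lt_trans h2)// ltrN2.
Qed.

Lemma cont_q x : S2 x -> {for x, continuous (fun y => q (dot y p))}.
Proof. by move=> Sx; apply: continuous_zonal; exact: isd_cont (dq (in_b Sx)). Qed.

Lemma cont_q' x : S2 x -> {for x, continuous (fun y => q' (dot y p))}.
Proof. by move=> Sx; apply: continuous_zonal; exact: cq (in_b Sx). Qed.

Lemma zonal_ibp Y : smooth_field Y ->
  s_int (fun x => q (dot x p) * s_div Y x) = - s_int (fun x => q' (dot x p) * dot p (Y x)).
Proof.
move=> sY; have [C1 pE] := zonal_C1 Sp b1 dq cq.
apply: s_int_add0.
- apply: sphere_cont_integrable => x Sx.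
  by apply: (@continuousM _ _ (fun y => q (dot y p)) (s_div Y)); [exact: cont_q|exact: s_div_continuous].
- apply: (@eq_s_integrable _ (fun x => q' (dot x p) * dot p (rfield Y x))).
    by move=> x Sx; rewrite rfieldE.
  apply: sphere_cont_integrable => x Sx.
  apply: (@continuousM _ _ (fun y => q' (dot y p)) (fun x => dot p (rfield Y x))); first exact: cont_q'.
  exact: continuous_dot_field.
- rewrite -[RHS](div_mul_field C1 sY); apply: eq_s_int => x Sx; congr (_ + _).
  by rewrite mulr_sumr; apply: eq_bigr => i _; rewrite pE// mulrA.
Qed.

End Regular.

(** u times the tangential gradient of the height x |-> dot x p. *)
Definition merid p u x : E3 := u x *: (p - dot x p *: x).

Lemma radial_merid p u i x : x != 0 ->
  radial (fun y => merid p u y 0 i) x = radial u x * (p 0 i - dot x p * x 0 i * (ninv x * ninv x)).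
Proof.
move=> x0; rewrite /radial !mxE; congr (_ * (_ - _)).
by rewrite dotZl /ninv; ring.
Qed.

Lemma smooth_dotr p : smooth (fun x => dot x p).
Proof.
by apply: smooth_sum => i; apply: smoothM; [exact: smooth_coord|exact: smooth_cst].
Qed.

Lemma smooth_field_merid p u : S2 p -> s_smooth u -> smooth_field (merid p u).
Proof.
move=> Sp su; split=> [x Sx|i].
  rewrite /merid dotZl; have -> : dot (p - dot x p *: x) x = dot x p * (1 - dot x x).
    by rewrite !dotE !mxE; ring.
  by rewrite S2_dot// subrr !mulr0.
apply/s_smoothP.
apply: (@smooth_ext _ (fun x => radial u x * (p 0 i + -1 * (dot x p * x 0 i * (ninv x * ninv x))))).
  by move=> x x0; rewrite radial_merid// mulN1r.
apply: smoothM; first exact/s_smoothP.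
apply: smoothD; first exact: smooth_cst.
apply: smoothM; first exact: smooth_cst.
apply: smoothM; last by apply: smoothM; exact: smooth_ninv.
by apply: smoothM; [exact: smooth_dotr|exact: smooth_coord].
Qed.

Lemma s_div_merid p u x : S2 p -> s_smooth u -> S2 x ->
  s_div (merid p u) x = dot p (s_grad u x) - 2 * dot x p * u x.
Proof.
move=> Sp su Sx; have x0 := S2_neq0 Sx.
have sr : smooth (radial u) by exact/s_smoothP.
have dr := smooth_diff sr x0.
have dd := differentiable_dotr p x.
have dn := differentiable_ninv x0.
have n1 : ninv x = 1 by rewrite /ninv Sx invr1.
have E i : partial i (radial (fun y => merid p u y 0 i)) x =
   p 0 i * partial i (radial u) x - dot x p * (x 0 i * partial i (radial u) x)
   - u x * (p 0 i * x 0 i + dot x p - 2 * dot x p * (x 0 i * x 0 i)).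
  have dc : differentiable (fun y : E3 => y 0 i : R) x by exact: differentiable_coord.
  rewrite (@near_partial _ _ (fun x => radial u x * (p 0 i + (-1) * (dot x p * x 0 i * (ninv x * ninv x))))); last first.
    by apply: off0_near x0 => y y0; rewrite radial_merid// mulN1r.
  have d1 : differentiable (fun x => dot x p * x 0 i) x by exact: differentiableM.
  have d2 : differentiable (fun x => ninv x * ninv x) x by exact: differentiableM.
  have d3 : differentiable (fun x => dot x p * x 0 i * (ninv x * ninv x)) x by exact: differentiableM.
  have dk (k : R) : differentiable (fun _ : E3 => k) x by exact: differentiable_cst.
  have d4 : differentiable (fun x => (-1) * (dot x p * x 0 i * (ninv x * ninv x))) x by exact: differentiableM.
  have d5 : differentiable (fun x => p 0 i + (-1) * (dot x p * x 0 i * (ninv x * ninv x))) x by exact: differentiableD.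
  rewrite (partialM _ dr d5) (partialD _ (dk _) d4) (partialM _ (dk _) d3) !partial_cst.
  rewrite (partialM _ d1 d2) (partialM _ dd dc) (partialM _ dn dn) partial_ninv// partial_dotr partial_coord eqxx n1 radial_S2//.
  rewrite (_ : true%:R = 1)//.
  by move: (partial i (radial u) x) (dot x p) (x 0 i) (p 0 i) (u x) => a1 a2 a3 a4 a5; ring.
rewrite /s_div (eq_bigr _ (fun i _ => E i)) !sumrB -!mulr_sumr radial_euler//.
have -> : dot p (s_grad u x) = \sum_(i < 3) p 0 i * partial i (radial u) x.
  by rewrite /dot; apply: eq_bigr => i _; rewrite mxE.
have := S2_dot Sx; rewrite dotE !sum3 [dot x p]dotE => h.
have -> : x 0 0 * x 0 0 = 1 - x 0 1 * x 0 1 - x 0 2%:R * x 0 2%:R by rewrite -h; ring.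
move: (partial 0 (radial u) x) (partial 1 (radial u) x) (partial 2%:R (radial u) x) => a0 a1 a2.
by move: (u x) (x 0 0) (x 0 1) (x 0 2%:R) (p 0 0) (p 0 1) (p 0 2%:R) => *; ring.
Qed.

Lemma dot_merid p u x : S2 p -> dot p (merid p u x) = (1 - dot x p ^+ 2) * u x.
Proof.
move=> Sp; transitivity ((dot p p - dot x p ^+ 2) * u x); last by rewrite S2_dot.
by rewrite /merid !dotE !mxE; move: (u x) (x 0 0) (x 0 1) (x 0 2%:R) (p 0 0) (p 0 1) (p 0 2%:R) => *; ring.
Qed.

Lemma continuous_sgrad p u x : s_smooth u -> S2 x -> {for x, continuous (fun y => dot p (rfield (s_grad u) y))}.
Proof. by move=> su; apply: continuous_dot_field; exact: smooth_field_grad. Qed.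

Section Regular2.
Variables (q q' : R -> R) (b : R) (p : E3).
Hypotheses (Sp : S2 p) (b1 : 1 < b).
Hypothesis dq : forall s, -b < s < b -> is_derive s 1 q (q' s).
Hypothesis cq : forall s, -b < s < b -> {for s, continuous q'}.

(** Integration by parts against merid p u; its divergence contains u times the
    Laplacian - 2 (dot x p) of the height. *)
Lemma zonal_green_grad u : s_smooth u ->
  s_int (fun x => q (dot x p) * dot p (s_grad u x)) =
  - s_int (fun x => ((1 - dot x p ^+ 2) * q' (dot x p) - 2 * dot x p * q (dot x p)) * u x).
Proof.
move=> su; have sY := smooth_field_merid Sp su.
have := zonal_ibp Sp b1 dq cq sY.
rewrite (@eq_s_int _ _ (fun x => q (dot x p) * dot p (s_grad u x) + (- 2 * dot x p * q (dot x p)) * u x)); last first.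
  by move=> x Sx; rewrite s_div_merid//; ring.
have cd x : S2 x -> {for x, continuous (fun y : E3 => dot y p)} by move=> _; exact: continuous_dotr.
have i1 : s_integrable (fun x => q (dot x p) * dot p (s_grad u x)).
  apply: (@eq_s_integrable _ (fun x => q (dot x p) * dot p (rfield (s_grad u) x))).
    by move=> x Sx; rewrite rfieldE.
  apply: sphere_cont_integrable => x Sx.
  apply: (@continuousM _ _ (fun y => q (dot y p)) (fun x => dot p (rfield (s_grad u) x))).
    exact: (cont_q Sp b1 dq).
  exact: continuous_sgrad.
have i2 : s_integrable (fun x => (- 2 * dot x p * q (dot x p)) * u x).
  apply: (@eq_s_integrable _ (fun x => (- 2 * dot x p * q (dot x p)) * radial u x)).
    by move=> x Sx; rewrite radial_S2.
  apply: sphere_cont_integrable => x Sx.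
  apply: (@continuousM _ _ (fun x => (- 2 * dot x p * q (dot x p))) (radial u)); last exact: s_smooth_continuous.
  apply: (@continuousM _ _ (fun x => (- 2 * dot x p)) (fun x => q (dot x p))); last exact: (cont_q Sp b1 dq).
  by apply: (@continuousM _ _ (fun=> -2) (fun x => dot x p)); [exact: cst_continuous|exact: continuous_dotr].
have i3 : s_integrable (fun x => (1 - dot x p ^+ 2) * q' (dot x p) * u x).
  apply: (@eq_s_integrable _ (fun x => (1 - dot x p * dot x p) * q' (dot x p) * radial u x)).
    by move=> x Sx; rewrite radial_S2// expr2.
  apply: sphere_cont_integrable => x Sx.
  apply: (@continuousM _ _ (fun x => ((1 - dot x p * dot x p) * q' (dot x p))) (radial u)); last exact: s_smooth_continuous.
  apply: (@continuousM _ _ (fun x => (1 - dot x p * dot x p)) (fun x => q' (dot x p))); last exact: (cont_q' Sp b1 cq).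
  have c1 : {for x, continuous (fun=> 1 : R)} by exact: cst_continuous.
  have c2 : {for x, continuous (fun y : E3 => dot y p * dot y p)}.
    by apply: (@continuousM _ _ (fun x => dot x p) (fun x => dot x p)); exact: continuous_dotr.
  exact: (continuousB c1 c2).
rewrite (s_intD i1 i2) (@eq_s_int _ (fun x => q' (dot x p) * dot p (merid p u x)) (fun x => (1 - dot x p ^+ 2) * q' (dot x p) * u x)); last first.
  by move=> x Sx; rewrite dot_merid//; ring.
rewrite (@eq_s_int _ (fun x => (_ - _) * u x) (fun x => (1 - dot x p ^+ 2) * q' (dot x p) * u x
   + (- 2 * dot x p * q (dot x p)) * u x)); last by move=> x Sx; ring.
by rewrite (s_intD i3 i2); lra.
Qed.

End Regular2.

End Zonal.

(** * Zonal functions that are singular at the poles *)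

Section ZonalLimit.
Variable R : realType.
Local Notation E3 := 'rV[R]_3.
Implicit Types (u f g : E3 -> R) (Y : E3 -> E3) (x y p : E3) (z : R * R) (q : R -> R).

Lemma smooth_laplace u : s_smooth u -> smooth (laplace u).
Proof.
move=> /s_smoothP su; apply: smooth_sum => i.
by apply: smooth_partial; exact: smooth_partial.
Qed.

Lemma zonal_green_laplace q q' q'' (b : R) p u : S2 p -> 1 < b ->
  (forall s, -b < s < b -> is_derive s 1 q (q' s)) ->
  (forall s, -b < s < b -> is_derive s 1 q' (q'' s)) ->
  (forall s, -b < s < b -> {for s, continuous q''}) -> s_smooth u ->
  s_int (fun x => q (dot x p) * laplace u x) =
  s_int (fun x => ((1 - dot x p ^+ 2) * q'' (dot x p) - 2 * dot x p * q' (dot x p)) * u x).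
Proof.
move=> Sp b1 dq dq' cq su.
have cq' s : -b < s < b -> {for s, continuous q'} by move=> /dq'; exact: isd_cont.
rewrite -[RHS]opprK -(zonal_green_grad Sp b1 dq' cq su).
rewrite -(zonal_ibp Sp b1 dq cq' (smooth_field_grad su)).
by apply: eq_s_int => x Sx; rewrite laplace_div.
Qed.

(** Both sides are minus the Dirichlet form of f and u. *)
Lemma green_smooth f u : s_smooth f -> s_smooth u ->
  s_int (fun x => f x * laplace u x) = s_int (fun x => u x * laplace f x).
Proof.
move=> sf su.
have H v w : s_smooth v -> s_smooth w -> s_int (fun x => v x * laplace w x) =
    - s_int (fun x => \sum_(i < 3) partial i (radial v) x * partial i (radial w) x).
  move=> sv sw; have sr := (s_smoothP v).1 sv; have sr' := (s_smoothP w).1 sw.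
  apply: s_int_add0.
  - apply: (@eq_s_integrable _ (fun x => radial v x * laplace w x)).
      by move=> x Sx; rewrite radial_S2.
    apply: sphere_cont_integrable => x Sx; apply: smooth_continuous => //.
    by apply: smoothM => //; exact: smooth_laplace.
  - apply: sphere_cont_integrable => x Sx; apply: smooth_continuous => //.
    by apply: smooth_sum => i; apply: smoothM; exact: smooth_partial.
  - rewrite -[RHS](div_mul_field (smooth_C1 sr) (smooth_field_grad sw)).
    apply: eq_s_int => x Sx; rewrite laplace_div// radial_S2//; congr (_ + _).
    by apply: eq_bigr => i _; rewrite mxE.
refine (eq_trans (H f u sf su) (eq_trans _ (esym (H u f su sf)))).
rewrite (@eq_s_int _ _ (fun x => \sum_(i < 3) partial i (radial u) x * partial i (radial f) x)) // => x _.
by apply: eq_bigr => i _; rewrite mulrC.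
Qed.

(** Contraction factors increasing to 1: replacing a zonal profile phi(s) by
    phi(lam s) makes it regular at the two poles. *)
Definition lam (n : nat) : R := 1 - harmonic n / 2.

Lemma lam_itv n : 0 < lam n < 1.
Proof.
have h0 : 0 < harmonic n :> R by exact: harmonic_gt0.
have h1 : harmonic n <= 1 :> R by rewrite /harmonic invf_le1 ?ltr0n// ler1n.
rewrite /lam; apply/andP; split; lra.
Qed.

Lemma cvg_lam : lam n @[n --> \oo] --> (1 : R).
Proof.
rewrite -[X in _ --> X]subr0 -[X in _ - X](mul0r (2^-1 : R)).
apply: cvgB; first exact: cvg_cst.
by apply: cvgMr_tmp; exact: cvg_harmonic.
Qed.

Lemma lam_in n s : - (lam n)^-1 < s < (lam n)^-1 -> -1 < lam n * s < 1.
Proof.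
have /andP[l0 l1] := lam_itv n => /andP[h1 h2]; apply/andP; split.
  by rewrite -(ltr_pM2l l0) mulrN mulfV ?gt_eqF in h1.
by rewrite -(ltr_pM2l l0) mulfV ?gt_eqF in h2.
Qed.

Lemma lam_gt1 n : 1 < (lam n)^-1.
Proof. by have /andP[l0 l1] := lam_itv n; rewrite invf_gt1. Qed.

Lemma lam_cvg q s : {for s, continuous q} -> q (lam n * s) @[n --> \oo] --> q s.
Proof.
move=> cq; apply: (@continuous_cvg _ _ _ _ _ (fun n => lam n * s) q s) => //.
rewrite -[X in _ --> X]mul1r; apply: cvgMr_tmp; exact: cvg_lam.
Qed.

Lemma lam_dot n x p : S2 x -> S2 p -> -1 < lam n * dot x p < 1.
Proof.
move=> Sx Sp; apply: lam_in; have /andP[h1 h2] := dot_S2_le1 Sx Sp.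
have l1 := lam_gt1 n; apply/andP; split; lra.
Qed.

Lemma is_derive_scaled q (q' : R -> R) (n : nat) : (forall s : R, -1 < s < 1 -> is_derive s 1 q (q' s)) ->
  forall s : R, - (lam n)^-1 < s < (lam n)^-1 ->
  is_derive s 1 (fun s => q (lam n * s)) (lam n * q' (lam n * s)).
Proof.
move=> dq s /lam_in sb.
have H : is_derive s 1 (fun s : R => lam n * s) (lam n) by apply: isd_eq (isdZ _ (isdX s)) _; rewrite mulr1.
by rewrite mulrC; apply: is_derive1_comp (dq _ sb) H.
Qed.

Lemma continuous_scaled q (n : nat) : (forall s : R, -1 < s < 1 -> {for s, continuous q}) ->
  forall s : R, - (lam n)^-1 < s < (lam n)^-1 -> {for s, continuous (fun s => q (lam n * s))}.
Proof.
move=> cq s /lam_in sb; apply: (@continuous_comp _ _ _ (fun s => lam n * s) q).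
  by apply: cvgMl_tmp; exact: cvg_id.
exact: cq.
Qed.

Lemma s_measurableB u f : s_measurable u -> s_measurable f -> s_measurable (fun x => u x - f x).
Proof. exact: measurable_funB. Qed.

Lemma s_measurable_zonal q p : measurable_fun setT q -> s_measurable (fun x => q (dot x p)).
Proof.
move=> mq; have m : s_measurable (fun x => dot x p); last exact: (measurableT_comp mq m).
by apply: continuous_s_measurable => x Sx; exact: continuous_dotr.
Qed.

Lemma s_measurable_dotf Y p : smooth_field Y -> s_measurable (fun x => dot p (Y x)).
Proof.
move=> sY; apply: (@eq_s_measurable _ (fun x => dot p (rfield Y x))).
  by move=> x Sx; rewrite rfieldE.
by apply: continuous_s_measurable => x; exact: continuous_dot_field.
Qed.

Lemma field_bounded Y p : smooth_field Y -> exists C, forall x, S2 x -> `|dot p (Y x)| <= C.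
Proof.
move=> sY; have [C HC] := sphere_bounded (fun x => @continuous_dot_field _ Y p x sY).
by exists C => x Sx; have := HC x Sx; rewrite rfieldE.
Qed.

Lemma s_int_dct_bdd p (u_ : nat -> E3 -> R) u C : S2 p ->
  (forall n, s_measurable (u_ n)) -> s_measurable u ->
  (forall n x, S2 x -> `|u_ n x| <= C) ->
  (forall x, S2 x -> -1 < dot x p < 1 -> u_ n x @[n --> \oo] --> u x) ->
  s_int (u_ n) @[n --> \oo] --> s_int u.
Proof.
move=> Sp mu_ mu uC cu; have ic : @s_integrable R (fun=> C).
  by apply: (@s_bounded_integrable _ _ `|C|) => //; exact: s_measurable_cst.
by have [_ H] := @s_int_dct R p u_ u (fun=> C) Sp mu_ (s_measurable_weight mu) ic
  (fun n x Sx _ => uC n x Sx) cu.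
Qed.

Section Profile.
Variables (w w' : R -> R) (p : E3) (C : R).
Hypothesis Sp : S2 p.
Hypothesis dw : forall s : R, -1 < s < 1 -> is_derive s 1 w (w' s).
Hypothesis cw : forall s : R, -1 < s < 1 -> {for s, continuous w'}.
Hypothesis mw : measurable_fun setT w.
Hypothesis mw' : measurable_fun setT w'.
Hypothesis bw : forall s : R, -1 < s < 1 -> `|w s| <= C.

Let C0 : 0 <= C.
Proof. by apply: le_trans (normr_ge0 (w 0)) (bw _); apply/andP; split; lra. Qed.

Let cw0 s : -1 < s < 1 -> {for s, continuous w}.
Proof. by move=> /dw; exact: isd_cont. Qed.

Let cl n x : S2 x -> {for x, continuous (fun y : E3 => w (lam n * dot y p))}.
Proof.
move=> Sx; apply: (@continuous_zonal _ (fun s => w (lam n * s))).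
by apply: (continuous_scaled cw0); exact: (in_b Sp (lam_gt1 n)).
Qed.

Let cl' n x : S2 x -> {for x, continuous (fun y : E3 => w' (lam n * dot y p))}.
Proof.
move=> Sx; apply: (@continuous_zonal _ (fun s => w' (lam n * s))).
by apply: (continuous_scaled cw); exact: (in_b Sp (lam_gt1 n)).
Qed.

(** The regular case for s |-> w (lam n s), followed by dominated convergence. *)
Lemma zonal_singular_ibp Y : smooth_field Y -> (forall s : R, -1 < s < 1 -> `|w' s| <= C) ->
  s_int (fun x => w (dot x p) * s_div Y x) = - s_int (fun x => w' (dot x p) * dot p (Y x)).
Proof.
move=> sY bw'; have [C1 HC1] := sphere_bounded (fun x => @s_div_continuous _ Y x sY).
have [C2 HC2] := field_bounded p sY.
have md : s_measurable (s_div Y).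
  by apply: continuous_s_measurable => x; exact: s_div_continuous.
have L1 : s_int (fun x => w (lam n * dot x p) * s_div Y x) @[n --> \oo] -->
    s_int (fun x => w (dot x p) * s_div Y x).
  apply: (@s_int_dct_bdd p _ _ (C * C1) Sp) => [n||n x Sx|x Sx xp].
  - by apply: s_measurableM => //; apply: continuous_s_measurable => x; exact: cl.
  - by apply: s_measurableM => //; exact: s_measurable_zonal.
  - by rewrite normrM ler_pM//; [apply: bw; exact: lam_dot|exact: HC1].
  - by apply: cvgMr_tmp; apply: lam_cvg; exact: cw0.
have L2 : s_int (fun x => lam n * w' (lam n * dot x p) * dot p (Y x)) @[n --> \oo] -->
    s_int (fun x => w' (dot x p) * dot p (Y x)).
  have mY := s_measurable_dotf p sY.
  apply: (@s_int_dct_bdd p _ _ (C * C2) Sp) => [n||n x Sx|x Sx xp].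
  - apply: s_measurableM => //; apply: s_measurableM; first exact: s_measurable_cst.
    by apply: continuous_s_measurable => x; exact: cl'.
  - by apply: s_measurableM => //; exact: s_measurable_zonal.
  - have /andP[l0 l1] := lam_itv n.
    rewrite normrM ler_pM//; last exact: HC2.
    rewrite normrM -[leRHS]mul1r ler_pM//; first by rewrite ger0_norm// ltW.
    by apply: bw'; exact: lam_dot.
  - apply: cvgMr_tmp; rewrite -[X in _ --> X]mul1r; apply: cvgM; first exact: cvg_lam.
    by apply: lam_cvg; exact: cw.
have E n : s_int (fun x => w (lam n * dot x p) * s_div Y x) =
    - s_int (fun x => lam n * w' (lam n * dot x p) * dot p (Y x)).
  apply: (@zonal_ibp _ (fun s => w (lam n * s)) (fun s => lam n * w' (lam n * s)) (lam n)^-1) => //.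
  - exact: lam_gt1.
  - exact: is_derive_scaled.
  - move=> s sb; apply: (@continuousM _ _ (fun=> lam n) (fun s => w' (lam n * s))); first exact: cst_continuous.
    exact: (continuous_scaled cw).
by move: L1; rewrite (funext E) => L1; exact: (cvg_unique _ L1 (cvgN L2)).
Qed.

(** The same limit: 1 - s^2 tames a derivative that blows up at the poles. *)
Lemma zonal_singular_green u : s_smooth u -> (forall s : R, -1 < s < 1 -> (1 - s ^+ 2) * `|w' s| <= C) ->
  s_int (fun x => w (dot x p) * dot p (s_grad u x)) =
  - s_int (fun x => ((1 - dot x p ^+ 2) * w' (dot x p) - 2 * dot x p * w (dot x p)) * u x).
Proof.
move=> su bw'; have sY := smooth_field_grad su.
have [C2 HC2] := field_bounded p sY.
have [C1 HC1] := sphere_bounded (fun x => @s_smooth_continuous _ u x su).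
have mu : s_measurable u.
  apply: (@eq_s_measurable _ (radial u)); first by move=> x Sx; rewrite radial_S2.
  by apply: continuous_s_measurable => x; exact: s_smooth_continuous.
have ms : s_measurable (fun x : E3 => dot x p).
  by apply: continuous_s_measurable => x _; exact: continuous_dotr.
have ms2 : s_measurable (fun x : E3 => 1 - dot x p ^+ 2).
  by apply: measurable_funB; [exact: measurable_cst|apply: measurable_funX].
have ms3 : s_measurable (fun x : E3 => 2 * dot x p).
  by apply: s_measurableM => //; exact: s_measurable_cst.
have L1 : s_int (fun x => w (lam n * dot x p) * dot p (s_grad u x)) @[n --> \oo] -->
    s_int (fun x => w (dot x p) * dot p (s_grad u x)).
  have mY := s_measurable_dotf p sY.
  apply: (@s_int_dct_bdd p _ _ (C * C2) Sp) => [n||n x Sx|x Sx xp].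
  - by apply: s_measurableM => //; apply: continuous_s_measurable => x; exact: cl.
  - by apply: s_measurableM => //; exact: s_measurable_zonal.
  - by rewrite normrM ler_pM//; [apply: bw; exact: lam_dot|exact: HC2].
  - by apply: cvgMr_tmp; apply: lam_cvg; exact: cw0.
have L2 : s_int (fun x => ((1 - dot x p ^+ 2) * (lam n * w' (lam n * dot x p)) -
      2 * dot x p * w (lam n * dot x p)) * u x) @[n --> \oo] -->
    s_int (fun x => ((1 - dot x p ^+ 2) * w' (dot x p) - 2 * dot x p * w (dot x p)) * u x).
  apply: (@s_int_dct_bdd p _ _ ((C + 2 * C) * C1) Sp) => [n||n x Sx|x Sx xp].
  - apply: s_measurableM => //; apply: s_measurableB.
      apply: s_measurableM => //; apply: s_measurableM; first exact: s_measurable_cst.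
      by apply: continuous_s_measurable => x; exact: cl'.
    by apply: s_measurableM => //; apply: continuous_s_measurable => x; exact: cl.
  - apply: s_measurableM => //; apply: s_measurableB.
      by apply: s_measurableM => //; exact: s_measurable_zonal.
    by apply: s_measurableM => //; exact: s_measurable_zonal.
  - have /andP[l0 l1] := lam_itv n.
    rewrite normrM ler_pM//; last by rewrite -(radial_S2 u Sx); exact: HC1.
    have ld := lam_dot n Sx Sp; have /andP[d1 d2] := dot_S2_le1 Sx Sp.
    apply: le_trans (ler_normB _ _) _; apply: lerD.
      rewrite normrM ger0_norm; last by nra.
      rewrite normrM (ger0_norm (ltW l0)).
      apply: le_trans (bw' _ ld); rewrite mulrA ler_wpM2r//.
      by nra.
    rewrite normrM ler_pM//; last exact: bw.
    by rewrite normrM ger0_norm// -[leRHS]mulr1 ler_wpM2l// ler_norml d1 d2.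
  - apply: cvgMr_tmp; apply: cvgB; last by apply: cvgMl_tmp; apply: lam_cvg; exact: cw0.
    apply: cvgMl_tmp; rewrite -[X in _ --> X]mul1r; apply: cvgM; first exact: cvg_lam.
    by apply: lam_cvg; exact: cw.
have E n : s_int (fun x => w (lam n * dot x p) * dot p (s_grad u x)) =
    - s_int (fun x => ((1 - dot x p ^+ 2) * (lam n * w' (lam n * dot x p)) -
      2 * dot x p * w (lam n * dot x p)) * u x).
  apply: (@zonal_green_grad _ (fun s => w (lam n * s)) (fun s => lam n * w' (lam n * s)) (lam n)^-1) => //.
  - exact: lam_gt1.
  - exact: is_derive_scaled.
  - move=> s sb; apply: (@continuousM _ _ (fun=> lam n) (fun s => w' (lam n * s))); first exact: cst_continuous.
    exact: (continuous_scaled cw).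
by move: L1; rewrite (funext E) => L1; exact: (cvg_unique _ L1 (cvgN L2)).
Qed.

End Profile.

End ZonalLimit.

(** * The logarithm and its regularizations *)

Section LogKernel.
Variable R : realType.
Local Notation E3 := 'rV[R]_3.
Implicit Types (u f g : E3 -> R) (x y p : E3) (z : R * R).

(** With a = shift1 n > 1 the singularity of - ln (a - s) lies off the sphere. *)
Definition shift1 (n : nat) : R := 1 + harmonic n.

Lemma shift1_itv n : 1 < shift1 n <= 2.
Proof.
have h0 : 0 < harmonic n :> R by exact: harmonic_gt0.
have h1 : harmonic n <= 1 :> R by rewrite /harmonic invf_le1 ?ltr0n// ler1n.
rewrite /shift1; apply/andP; split; lra.
Qed.

Lemma cvg_shift1 : shift1 n @[n --> \oo] --> (1 : R).
Proof.
rewrite -[X in _ --> X]addr0; apply: cvgD; [exact: cvg_cst|exact: cvg_harmonic].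
Qed.

Section FixedPole.
Variable p : E3.
Hypothesis Sp : S2 p.

Section Shift.
Variable a : R.
Hypothesis a12 : 1 < a <= 2.

Let a1 : 1 < a. Proof. by case/andP: a12. Qed.

Lemma dq_log (s : R) : -a < s < a -> is_derive s 1 (fun s => - ln (a - s)) (a - s)^-1.
Proof.
move=> /andP[_ sa]; have as0 : 0 < a - s by rewrite subr_gt0.
have H : is_derive s 1 (fun s : R => a - s) (-1).
  by apply: isd_eq (isdD (isdC a s) (isdN (isdX s))) _; rewrite add0r.
have K := @is_derive1_comp R (@ln R) (fun s => a - s) s _ _ (is_derive1_ln as0) H.
by apply: isd_eq (isdN K) _; rewrite mulrN1 opprK.
Qed.

Lemma dq_inv (s : R) : -a < s < a -> is_derive s 1 (fun s => (a - s)^-1) ((a - s) ^- 2).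
Proof.
move=> /andP[_ sa]; have as0 : a - s != 0 by rewrite subr_eq0 gt_eqF.
have H : is_derive s 1 (fun s : R => a - s) (-1).
  by apply: isd_eq (isdD (isdC a s) (isdN (isdX s))) _; rewrite add0r.
have K := @isdV R (fun s => a - s) s _ as0 H.
by apply: isd_eq K _; rewrite mulrN1 opprK.
Qed.

Lemma cq_inv (s : R) : -a < s < a -> {for s, continuous (fun s => (a - s)^-1)}.
Proof. by move=> /dq_inv; exact: isd_cont. Qed.

Lemma cq_inv2 (s : R) : -a < s < a -> {for s, continuous (fun s => (a - s) ^- 2)}.
Proof.
move=> sa; rewrite (_ : (fun s => _) = fun s => (a - s)^-1 * (a - s)^-1).
  by apply: (@continuousM _ _ (fun s => (a - s)^-1) (fun s => (a - s)^-1)); exact: cq_inv.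
by apply/funext => t; rewrite expr2 invfM.
Qed.

(** The Laplacian of - ln (a - dot x p) is 1 - kern; as a decreases to 1 the
    kernel tends to 4 pi times the Dirac mass at p. *)
Definition kern x := (a ^+ 2 - 1) / (a - dot x p) ^+ 2.

Lemma as_gt0 x : S2 x -> 0 < a - dot x p.
Proof. by move=> Sx; have /andP[_ h] := dot_S2_le1 Sx Sp; rewrite subr_gt0 (le_lt_trans h). Qed.

Lemma kern_ge0 x : 0 <= kern x.
Proof.
apply: mulr_ge0; last by rewrite invr_ge0 sqr_ge0.
by rewrite subr_ge0 expr_ge1 ?ltW// (lt_trans _ a1).
Qed.

Lemma kern_cont x : S2 x -> {for x, continuous kern}.
Proof.
move=> Sx; apply: (@continuousM _ _ (fun=> a ^+ 2 - 1) (fun x => (a - dot x p) ^- 2)).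
  exact: cst_continuous.
apply: (@continuous_zonal _ (fun s => (a - s) ^- 2)); apply: cq_inv2.
exact: (in_b Sp a1).
Qed.

Lemma kern_integrable u : (forall x, S2 x -> {for x, continuous u}) -> s_integrable (fun x => kern x * u x).
Proof.
move=> cu; apply: sphere_cont_integrable => x Sx.
by apply: (@continuousM _ _ kern u); [exact: kern_cont|exact: cu].
Qed.

Lemma log_green_shift u : s_smooth u ->
  s_int (fun x => - ln (a - dot x p) * laplace u x) = s_int u - s_int (fun x => kern x * u x).
Proof.
move=> su; have := zonal_green_laplace Sp a1 dq_log dq_inv cq_inv2 su => ->.
have cu x (Sx : S2 x) : {for x, continuous (radial u)} by exact: s_smooth_continuous.
have i1 : s_integrable u.
  apply: (@eq_s_integrable _ (radial u)); first by move=> x Sx; rewrite radial_S2.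
  exact: sphere_cont_integrable.
have i2 : s_integrable (fun x => kern x * u x).
  apply: (@eq_s_integrable _ (fun x => kern x * radial u x)); first by move=> x Sx; rewrite radial_S2.
  exact: kern_integrable.
have := s_intD i1 (s_integrableZ (-1) i2); rewrite (s_intZ _ i2) mulN1r => <-.
apply: eq_s_int => x Sx; rewrite /kern; have := as_gt0 Sx; move: (dot x p) => s s0.
by field; rewrite gt_eqF.
Qed.

Lemma s_smooth1 : @s_smooth R (fun=> 1).
Proof. by apply: smooth_s_smooth => //; exact: smooth_cst. Qed.

Lemma laplace1 x : laplace (fun=> 1 : R) x = 0.
Proof.
rewrite /laplace big1// => i _.
have -> : partial i (radial (fun=> 1 : R)) = fun=> 0 by apply/funext => y; exact: partial_cst.
by rewrite partial_cst.
Qed.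

(** Test log_green_shift with u = 1. *)
Lemma kern_mass : s_int kern = 4 * pi.
Proof.
have := log_green_shift s_smooth1.
rewrite (@eq_s_int _ _ (fun=> 0 * 1)); last by move=> x _; rewrite laplace1 !mulr0 ?mul0r.
have i1 : @s_integrable R (fun=> 1) by apply: sphere_cont_integrable => x _; exact: cst_continuous.
rewrite (s_intZ 0 i1) mul0r => /esym/eqP; rewrite subr_eq0 => /eqP.
rewrite -/(s_area R) s_areaE => ->; apply: eq_s_int => x _; by rewrite mulr1.
Qed.

Lemma s_grad1 x : s_grad (fun=> 1 : R) x = 0.
Proof.
by apply/rowP => i; rewrite !mxE partial_cst.
Qed.

(** The case u = 1 of zonal_green_grad: a moment of the logarithm that vanishes
    for every a. *)
Lemma log_mean : s_int (fun x => (1 - dot x p ^+ 2) * (a - dot x p)^-1 - 2 * dot x p * - ln (a - dot x p)) = 0.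
Proof.
have := zonal_green_grad Sp a1 dq_log cq_inv s_smooth1.
rewrite (@eq_s_int _ _ (fun=> 0 * 1)); last first.
  have d0 x : dot p (s_grad (fun=> 1 : R) x) = 0.
    by rewrite /dot big1// => i _; rewrite s_grad1 mxE mulr0.
  by move=> x _; rewrite d0 mulr0 mul0r.
have i1 : @s_integrable R (fun=> 1) by apply: sphere_cont_integrable => x _; exact: cst_continuous.
rewrite (s_intZ 0 i1) mul0r => /esym/eqP; rewrite oppr_eq0 => /eqP H.
rewrite -[RHS]H; by apply: eq_s_int => x _; rewrite mulr1.
Qed.

(** A multiple of the integrand of log_mean plus a constant dominates the
    logarithm, which bounds its integral uniformly in a; the constant comes from
    1 - s^2 <= 2 (a - s) and - (1 - s) ln (a - s) <= 1. *)
Lemma log_le x : S2 x -> - ln (a - dot x p) <=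
  - 2^-1 * ((1 - dot x p ^+ 2) * (a - dot x p)^-1 - 2 * dot x p * - ln (a - dot x p)) + 2.
Proof.
move=> Sx; have := as_gt0 Sx; have /andP[] := dot_S2_le1 Sx Sp.
move: (dot x p) => s s1 s2 s0.
set L := ln (a - s).
have e1 : (1 - s ^+ 2) * (a - s)^-1 <= 2.
  rewrite ler_pdivrMr//; have h := sqr_ge0 (1 - s); have h2 := a1.
  have -> : 1 - s ^+ 2 = 2 * (1 - s) - (1 - s) ^+ 2 by ring.
  lra.
have e2 : (1 - s) * - L <= 1.
  have [L0|L0] := leP 0 L; first by nra.
  have eL : expR L = a - s by rewrite /L lnK// posrE.
  have h : 1 + - L <= (a - s)^-1 by rewrite -eL -expRN; exact: expR_ge1Dx.
  have i0 : 0 < (a - s)^-1 by rewrite invr_gt0.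
  have : (a - s) * (1 + - L) <= (a - s) * (a - s)^-1 by rewrite ler_pM2l.
  rewrite mulfV ?gt_eqF// => h2; have a1_ := a1.
  by nra.
by lra.
Qed.

End Shift.

Definition logk x : R := - ln (1 - dot x p).

Lemma measurable_logk : s_measurable logk.
Proof.
apply: (@s_measurable_zonal _ (fun s => - ln (1 - s))).
apply: measurable_funN; apply: (measurableT_comp (@measurable_ln R)).
by apply: measurable_funB; [exact: measurable_cst|exact: measurable_id].
Qed.

Lemma cvg_log_shift (s : R) : s < 1 -> - ln (shift1 n - s) @[n --> \oo] --> - ln (1 - s).
Proof.
move=> s1; apply: cvgN; apply: continuous_cvg; first by apply: continuous_ln; rewrite subr_gt0.
by apply: cvgB; [exact: cvg_shift1|exact: cvg_cst].
Qed.

Lemma cont_log_shift n x : S2 x -> {for x, continuous (fun x => - ln (shift1 n - dot x p))}.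
Proof.
move=> Sx; have /andP[a1 _] := shift1_itv n.
apply: (@continuous_zonal _ (fun s => - ln (shift1 n - s))).
by apply: isd_cont (dq_log _); exact: (in_b Sp a1).
Qed.

Lemma log_shift_bounds n x : S2 x -> - ln 3 <= - ln (shift1 n - dot x p) /\
  (-1 < dot x p < 1 -> `|- ln (shift1 n - dot x p)| <= `|logk x| + ln 3).
Proof.
move=> Sx; have /andP[a1 a2] := shift1_itv n; have /andP[s1 s2] := dot_S2_le1 Sx Sp.
have l3 : 0 <= ln 3 :> R by apply: ln_ge0; lra.
have H : - ln 3 <= - ln (shift1 n - dot x p).
  rewrite lerN2 ler_ln ?posrE; lra.
split=> // /andP[_ s3].
have K : - ln (shift1 n - dot x p) <= logk x.
  rewrite /logk lerN2 ler_ln ?posrE; lra.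
rewrite ler_norml; apply/andP; split; have := normr_ge0 (logk x); have := ler_norm (logk x); lra.
Qed.

(** The regularized logarithms have bounded integrals by log_le and log_mean. *)
Lemma logk_integrable : s_integrable logk.
Proof.
have i1 : @s_integrable R (fun=> 1) by apply: sphere_cont_integrable => x _; exact: cst_continuous.
have iq n : s_integrable (fun x => - ln (shift1 n - dot x p)).
  by apply: sphere_cont_integrable => x; exact: cont_log_shift.
have H : s_integrable (fun x => logk x + ln 3 * 1).
  apply: (@s_integrable_fatou _ p (fun n x => - ln (shift1 n - dot x p) + ln 3 * 1) _ (2 * (4 * pi) + ln 3 * (4 * pi)) Sp).
  - by move=> n; apply: s_integrableD => //; exact: s_integrableZ.
  - by move=> n x Sx; have [h _] := log_shift_bounds n Sx; lra.
  - move=> n; rewrite s_intD//; last exact: s_integrableZ.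
    rewrite (s_intZ _ i1) -/(s_area R) s_areaE lerD2r.
    have /andP[a1 a2] := shift1_itv n.
    pose E x := (1 - dot x p ^+ 2) * (shift1 n - dot x p)^-1 - 2 * dot x p * - ln (shift1 n - dot x p).
    have iE : s_integrable E.
      apply: sphere_cont_integrable => x Sx; apply: (@continuous_zonal _ (fun s => (1 - s ^+ 2) * (shift1 n - s)^-1 - 2 * s * - ln (shift1 n - s))).
      have sb := in_b Sp a1 Sx.
      have D1 := isdD (isdC 1 (dot x p)) (isdN (isdM (isdX (dot x p)) (isdX (dot x p)))).
      have D2 := isdM D1 (dq_inv sb).
      have D3 := isdM (isdZ 2 (isdX (dot x p))) (dq_log sb).
      exact: isd_cont (isdD D2 (isdN D3)).
    apply: (@le_trans _ _ (s_int (fun x => - 2^-1 * E x + 2 * 1))).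
      apply: le_s_int => //.
        by apply: s_integrableD; exact: s_integrableZ.
      by move=> x Sx; rewrite mulr1; exact: log_le (shift1_itv n) _ Sx.
    rewrite s_intD; [|exact: s_integrableZ|exact: s_integrableZ].
    by rewrite (s_intZ _ iE) (log_mean (shift1_itv n)) mulr0 add0r (s_intZ _ i1) -/(s_area R) s_areaE.
  - by apply: s_measurableD; [exact: measurable_logk|exact: s_measurable_cst].
  - move=> x Sx; have /andP[s1 s2] := dot_S2_le1 Sx Sp.
    have l3 : 0 <= ln 3 :> R by apply: ln_ge0; lra.
    have [e|s3] := eqVneq (dot x p) 1; first by rewrite /logk e subrr ln0// oppr0 add0r mulr1.
    rewrite /logk addrC mulr1 subr_ge0 ler_ln ?posrE; first lra.
      by rewrite subr_gt0 lt_neqAle s3.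
    lra.
  - move=> x Sx /andP[_ s1]; apply: cvgD; last exact: cvg_cst.
    exact: cvg_log_shift.
have := s_integrableD H (s_integrableZ (- ln 3) i1).
by apply: eq_s_integrable => x _; lra.
Qed.

End FixedPole.
End LogKernel.

(** * The Laplacian of the logarithm *)

Section LogGreen.
Variable R : realType.
Local Notation E3 := 'rV[R]_3.
Implicit Types (u f g : E3 -> R) (x y p : E3) (z : R * R).

Lemma sqr_norm_le_dot x : `|x| ^+ 2 <= dot x x.
Proof.
have -> : dot x x = Num.sqrt (dot x x) ^+ 2 by rewrite sqr_sqrtr// dot_ge0.
rewrite ler_pXn2r ?nnegrE// ?sqrtr_ge0//.
rewrite [leLHS]/Num.Def.normr/= mx_normrE bigmax_le ?sqrtr_ge0// => -[i j] _ /=.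
rewrite ord1 -(ler_pXn2r (ltn0Sn 1)) ?nnegrE ?sqrtr_ge0// real_normK ?num_real//.
rewrite sqr_sqrtr ?dot_ge0// /dot (bigD1 j)//= -expr2 lerDl sumr_ge0// => k _.
by rewrite -expr2 sqr_ge0.
Qed.

(** Close to p this is continuity; elsewhere 2 (1 - dot x p), the squared
    distance to p, is bounded below. *)
Lemma sphere_modulus u p e : S2 p -> s_smooth u -> 0 < e ->
  exists2 C, 0 <= C & forall x, S2 x -> `|u x - u p| <= e + C * (1 - dot x p).
Proof.
move=> Sp su e0; have cu := s_smooth_continuous su Sp.
have [M HM] := sphere_bounded (fun x => @s_smooth_continuous _ u x su).
have M0 : 0 <= M by apply: le_trans (HM p Sp).
have /cvgrPdist_lt/(_ e e0)/nbhs_normP[d /= d0 Hd] := cu.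
have K0 : 0 <= 4 * M / d ^+ 2 by apply: divr_ge0; [exact: mulr_ge0|exact: sqr_ge0].
exists (4 * M / d ^+ 2) => //.
move=> x Sx; have /andP[s1 s2] := dot_S2_le1 Sx Sp.
have [xd|xd] := ltP `|p - x| d.
  have := Hd x xd; rewrite /= !radial_S2// distrC => /ltW h; apply: le_trans h _.
  by rewrite lerDl mulr_ge0// subr_ge0.
have h2 : d ^+ 2 <= 2 * (1 - dot x p).
  have -> : 2 * (1 - dot x p) = dot (p - x) (p - x).
    by rewrite dotBB (S2_dot Sx) (S2_dot Sp) dotC; ring.
  by apply: le_trans (sqr_norm_le_dot _); rewrite ler_pXn2r ?nnegrE// ltW.
have h3 : `|u x - u p| <= 2 * M.
  apply: le_trans (ler_normB _ _) _; have := HM x Sx; have := HM p Sp.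
  by rewrite !radial_S2// => a b; lra.
apply: le_trans h3 _.
have E1 : 2 * M = (2 * M / d ^+ 2) * d ^+ 2 by rewrite divfK// expf_neq0// gt_eqF.
have E2 : 4 * M / d ^+ 2 * (1 - dot x p) = (2 * M / d ^+ 2) * (2 * (1 - dot x p)) by ring.
have h4 : (2 * M / d ^+ 2) * d ^+ 2 <= (2 * M / d ^+ 2) * (2 * (1 - dot x p)).
  by apply: ler_wpM2l => //; apply: divr_ge0; [exact: mulr_ge0|exact: sqr_ge0].
rewrite E2; apply: (le_trans (eq_ind_r (fun t => t <= _) h4 E1)).
by rewrite lerDr ltW.
Qed.

Lemma s_integrable1 : @s_integrable R (fun=> 1).
Proof. by apply: sphere_cont_integrable => x _; exact: cst_continuous. Qed.

Lemma s_smooth_integrable u : s_smooth u -> s_integrable u.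
Proof.
move=> su; apply: (@eq_s_integrable _ (radial u)); first by move=> x Sx; rewrite radial_S2.
by apply: sphere_cont_integrable => x; exact: s_smooth_continuous.
Qed.

Lemma s_smooth_measurable u : s_smooth u -> s_measurable u.
Proof.
move=> su; apply: (@eq_s_measurable _ (radial u)); first by move=> x Sx; rewrite radial_S2.
by apply: continuous_s_measurable => x; exact: s_smooth_continuous.
Qed.

Lemma s_integrable_norm u : s_integrable u -> s_integrable (fun x => `|u x|).
Proof.
move=> /integrable_norm; apply: eq_integrable => [|z zD]; first exact: measurable_D2.
rewrite inE in zD.
by rewrite /= normrM [X in _ * X]ger0_norm// D_sin.
Qed.

Section Kernel.
Variable p : E3.
Hypothesis Sp : S2 p.
Let k n x := kern p (shift1 R n) x.

Lemma kern_tail : s_int (fun x => k n x * (1 - dot x p)) @[n --> \oo] --> (0 : R).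
Proof.
have z0 : s_int (fun=> 0 * 1 : R) = 0 by rewrite (s_intZ 0 s_integrable1) mul0r.
rewrite -[X in _ --> X]z0.
have c1 x : {for x, continuous (fun x => 1 - dot x p)}.
  apply: (@continuous_zonal _ (fun s => 1 - s)).
  exact: isd_cont (isdD (isdC 1 _) (isdN (isdX _))).
apply: (@s_int_dct_bdd R p _ _ 3 Sp).
- move=> n; apply: continuous_s_measurable => x Sx.
  by apply: (@continuousM _ _ (k n) (fun x => 1 - dot x p)) => //; exact: kern_cont (shift1_itv _ n) _ _.
- exact: s_measurable_cst.
- move=> n x Sx; have /andP[a1 a2] := shift1_itv R n; have /andP[s1 s2] := dot_S2_le1 Sx Sp.
  rewrite ger0_norm; last by rewrite mulr_ge0 ?subr_ge0// kern_ge0// shift1_itv.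
  rewrite /k /kern; move: (shift1 R n) (dot x p) a1 a2 s1 s2 => a s a1 a2 s1 s2.
  have d0 : 0 < a - s by lra.
  rewrite mulrAC ler_pdivrMr ?exprn_gt0//.
  have h : (a ^+ 2 - 1) * (1 - s) <= (a + 1) * ((a - 1) * (a - s)).
    have -> : a ^+ 2 - 1 = (a + 1) * (a - 1) by ring.
    rewrite -mulrA ler_wpM2l; [|lra|]; rewrite ?ler_wpM2l; lra.
  apply: (le_trans h).
  have h2 : (a - 1) * (a - s) <= (a - s) * (a - s) by rewrite ler_wpM2r; lra.
  apply: (@le_trans _ _ (3 * ((a - 1) * (a - s)))).
    by rewrite ler_wpM2r; [|rewrite mulr_ge0; lra|lra].
  by rewrite expr2 ler_wpM2l.
- move=> x Sx /andP[s1 s2].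
  have s0 : 1 - dot x p != 0 by rewrite subr_eq0 gt_eqF.
  have ca := @cvg_shift1 R.
  have E : (1 ^+ 2 - 1) / (1 - dot x p) ^+ 2 * (1 - dot x p) = 0 * 1 :> R by rewrite expr1n subrr !mul0r.
  rewrite -E /k /kern; apply: cvgMr_tmp; apply: cvgM.
    apply: cvgB; last exact: cvg_cst.
    rewrite (_ : (fun n => _) = (fun n => shift1 R n * shift1 R n)); last by apply/funext => n; rewrite expr2.
    by rewrite expr2; apply: cvgM.
  apply: cvgV; first by rewrite expf_neq0.
  rewrite (_ : (fun n => _) = (fun n => (shift1 R n - dot x p) * (shift1 R n - dot x p))); last by apply/funext => n; rewrite expr2.
  by rewrite expr2; apply: cvgM; apply: cvgB => //; exact: cvg_cst.
Qed.

Lemma kern_integrable_smooth n u : s_smooth u -> s_integrable (fun x => k n x * u x).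
Proof.
move=> su; apply: (@eq_s_integrable _ (fun x => k n x * radial u x)); first by move=> x Sx; rewrite radial_S2.
by apply: kern_integrable (shift1_itv _ n) _ _ => // x; exact: s_smooth_continuous.
Qed.

(** By sphere_modulus the error is a small multiple of the mass 4 pi plus a
    multiple of kern_tail. *)
Lemma kern_dirac u : s_smooth u -> s_int (fun x => k n x * u x) @[n --> \oo] --> 4 * pi * u p.
Proof.
move=> su; apply/cvgrPdist_le => /= e e0.
have e1 : 0 < e / (8 * pi) by rewrite divr_gt0// mulr_gt0// pi_gt0.
have [C C0 HC] := sphere_modulus Sp su e1.
have e2 : 0 < e / (2 * (C + 1)) by rewrite divr_gt0// mulr_gt0// ltr_wpDl.
have := kern_tail => /cvgrPdist_le/(_ _ e2); apply: filterS => n.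
rewrite sub0r normrN => Hn.
have A12 := shift1_itv R n.
have i1 : s_integrable (k n).
  by apply: sphere_cont_integrable => x; exact: kern_cont.
have iku := kern_integrable_smooth n su.
have is' : s_integrable (fun x => k n x * (1 - dot x p)).
  apply: kern_integrable => // x Sx; apply: (@continuous_zonal _ (fun s => 1 - s)).
  exact: isd_cont (isdD (isdC 1 _) (isdN (isdX _))).
have E : s_int (fun x => k n x * u x) - 4 * pi * u p = s_int (fun x => k n x * u x + - u p * k n x).
  by rewrite s_intD//; [rewrite (s_intZ _ i1) (kern_mass Sp A12); ring|exact: s_integrableZ].
rewrite distrC E.
have ib : s_integrable (fun x => e / (8 * pi) * k n x + C * (k n x * (1 - dot x p))).
  by apply: s_integrableD; exact: s_integrableZ.
have ia : s_integrable (fun x => k n x * u x + - u p * k n x).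
  by apply: s_integrableD => //; exact: s_integrableZ.
have ib' := s_integrableZ (-1) ib.
have bnd : s_int (fun x => e / (8 * pi) * k n x + C * (k n x * (1 - dot x p))) <= e.
  rewrite s_intD; [|exact: s_integrableZ|exact: s_integrableZ].
  rewrite (s_intZ _ i1) (s_intZ _ is') (kern_mass Sp A12).
  have pi0 : pi != 0 :> R := lt0r_neq0 (pi_gt0 R).
  have -> : e / (8 * pi) * (4 * pi) = e / 2.
    by move: (pi : R) pi0 => P P0; field.
  have h : C * s_int (fun x => k n x * (1 - dot x p)) <= C * (e / (2 * (C + 1))).
    by rewrite ler_wpM2l//; apply: le_trans Hn; exact: ler_norm.
  have h2 : C * (e / (2 * (C + 1))) <= e / 2.
    have -> : C * (e / (2 * (C + 1))) = (e / 2) * (C / (C + 1)) by field; rewrite lt0r_neq0// ltr_wpDl.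
    rewrite -[leRHS]mulr1 ler_wpM2l//; first by rewrite divr_ge0// ltW.
    by rewrite ler_pdivrMr ?ltr_wpDl// mul1r lerDl.
  by rewrite [leRHS](splitr e) lerD2l; exact: le_trans h h2.
have pt x : S2 x -> `|k n x * u x + - u p * k n x| <= e / (8 * pi) * k n x + C * (k n x * (1 - dot x p)).
  move=> Sx; have k0 : 0 <= k n x by exact: kern_ge0.
  have -> : k n x * u x + - u p * k n x = k n x * (u x - u p) by ring.
  have -> : e / (8 * pi) * k n x + C * (k n x * (1 - dot x p)) = k n x * (e / (8 * pi) + C * (1 - dot x p)) by ring.
  by rewrite normrM ger0_norm// ler_wpM2l// HC.
rewrite ler_norml; apply/andP; split.
  rewrite -(opprK (s_int _)) lerN2 -mulN1r -(s_intZ _ ia); apply: le_trans bnd.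
  apply: le_s_int => //; first exact: s_integrableZ.
  by move=> x Sx; rewrite mulN1r; apply: le_trans (pt x Sx); rewrite -normrN ler_norm.
apply: le_trans bnd; apply: le_s_int => // x Sx.
by apply: le_trans (pt x Sx); exact: ler_norm.
Qed.

(** The limit of log_green_shift as the singularity reaches the sphere. *)
Theorem log_green u : s_smooth u ->
  s_int (fun x => logk p x * laplace u x) = s_int u - 4 * pi * u p.
Proof.
move=> su; have sl := smooth_laplace su.
have [C HC] := sphere_bounded (fun x => @smooth_continuous _ (laplace u) x sl).
have ml : s_measurable (laplace u).
  by apply: continuous_s_measurable => x; exact: smooth_continuous.
have mL := measurable_logk p.
have C0 : 0 <= C by apply: le_trans (HC p Sp).
have l3 : 0 <= ln 3 :> R by apply: ln_ge0; lra.
have L1 : s_int (fun x => - ln (shift1 R n - dot x p) * laplace u x) @[n --> \oo] -->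
    s_int (fun x => logk p x * laplace u x).
  apply: (@s_int_dct R p _ _ (fun x => C * (`|logk p x| + ln 3 * 1)) Sp _ _ _ _ _).2.
  - move=> n; apply: s_measurableM => //; apply: continuous_s_measurable => x Sx.
    exact: cont_log_shift.
  - by apply: (@s_measurable_weight _ (fun x => logk p x * laplace u x)); exact: s_measurableM.
  - apply: s_integrableZ; apply: s_integrableD; last exact: s_integrableZ s_integrable1.
    exact: s_integrable_norm (logk_integrable Sp).
  - move=> n x Sx xp; have [_ /(_ xp) h] := log_shift_bounds Sp n Sx.
    by rewrite normrM mulrC mulr1 ler_pM// HC.
  - move=> x Sx /andP[_ s1]; apply: cvgMr_tmp; exact: cvg_log_shift.
have E n : s_int (fun x => - ln (shift1 R n - dot x p) * laplace u x) =
    s_int u - s_int (fun x => k n x * u x).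
  exact: log_green_shift (shift1_itv R n) _ su.
move: L1; rewrite (funext E) => L1.
have L2 : s_int u - s_int (fun x => k n x * u x) @[n --> \oo] --> s_int u - 4 * pi * u p.
  by apply: (@cvgB _ _ _ _ _ (fun=> s_int u)); [exact: cvg_cst|exact: kern_dirac].
exact: (cvg_unique _ L1 L2).
Qed.

End Kernel.
End LogGreen.

(** * Orthogonality to Laplacians and to polynomials *)

Section Polynomials.
Variable R : realType.
Local Notation E3 := 'rV[R]_3.
Implicit Types (u f g h : E3 -> R) (x y p : E3) (z : R * R) (d e : nat).

(** Homogeneous polynomials kept as functions, so that partial applies to them;
    the index is the degree. *)
Inductive hpoly : nat -> (E3 -> R) -> Prop :=
| hp_cst c : hpoly 0 (fun=> c)
| hp_coord d i f : hpoly d f -> hpoly d.+1 (fun x => x 0 i * f x)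
| hp_add d f g : hpoly d f -> hpoly d g -> hpoly d (fun x => f x + g x).

Lemma hp_ext d f g : hpoly d f -> (forall x, f x = g x) -> hpoly d g.
Proof. by move=> hf /funext <-. Qed.

Lemma hp_zero d : hpoly d (fun=> 0).
Proof.
elim: d => [|d IH]; first exact: hp_cst.
by apply: hp_ext (hp_coord 0 IH) _ => x; rewrite mulr0.
Qed.

Lemma hp_scale d f c : hpoly d f -> hpoly d (fun x => c * f x).
Proof.
elim=> {d f} [k|d i f _ IH|d f g _ IHf _ IHg]; first exact: hp_cst.
  by apply: hp_ext (hp_coord i IH) _ => x; rewrite mulrCA.
by apply: hp_ext (hp_add IHf IHg) _ => x; rewrite mulrDr.
Qed.

Lemma hp_mul d e f g : hpoly d f -> hpoly e g -> hpoly (d + e) (fun x => f x * g x).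
Proof.
move=> hf hg; elim: hf => {d f} [k|d i f _ IH|d f f' _ IHf _ IHg]; first exact: hp_scale.
  by apply: hp_ext (hp_coord i IH) _ => x; rewrite mulrA.
by apply: hp_ext (hp_add IHf IHg) _ => x; rewrite mulrDl.
Qed.

Lemma hp_smooth d f : hpoly d f -> smooth f.
Proof.
elim=> {d f} [k|d i f _ IH|d f g _ IHf _ IHg]; first exact: smooth_cst.
  by apply: smoothM IH; exact: smooth_coord.
exact: smoothD.
Qed.

Lemma hp_diff d f x : hpoly d f -> differentiable f x.
Proof.
elim=> {d f} [k|d i f _ IH|d f g _ IHf _ IHg]; first exact: differentiable_cst.
  by apply: differentiableM => //; exact: differentiable_coord.
exact: differentiableD.
Qed.

Lemma hp_homog d f a x : hpoly d f -> f (a *: x) = a ^+ d * f x.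
Proof.
elim=> {d f} [k|d i f _ IH|d f g _ IHf _ IHg]; first by rewrite expr0 mul1r.
  by rewrite IH mxE exprS; ring.
by rewrite IHf IHg mulrDr.
Qed.

Lemma hp_partial d f i : hpoly d f ->
  if d is d'.+1 then hpoly d' (partial i f) else partial i f = fun=> 0.
Proof.
elim=> {d f} [k|d j f hf IH|d f g hf IHf hg IHg].
- by apply/funext => x; rewrite partial_cst.
- have E x : partial i (fun x => x 0 j * f x) x = x 0 j * partial i f x + (j == i)%:R * f x.
    rewrite partialM ?partial_coord//; first by ring.
      exact: differentiable_coord.
    exact: hp_diff hf.
  apply: (@hp_ext _ (fun x => x 0 j * partial i f x + (j == i)%:R * f x)); last by move=> x; rewrite E.
  apply: hp_add; last exact: hp_scale.
  case: d hf IH {E} => [|d] hf IH; last exact: hp_coord.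
  by apply: hp_ext (hp_zero 0) _ => x; rewrite IH mulr0.
- have E x : partial i (fun x => f x + g x) x = partial i f x + partial i g x.
    by rewrite partialD//; [exact: hp_diff hf|exact: hp_diff hg].
  case: d hf hg IHf IHg => [|d] hf hg IHf IHg.
    by apply/funext => x; rewrite E IHf IHg addr0.
  by apply: hp_ext (hp_add IHf IHg) _ => x; rewrite E.
Qed.

(** Euler's identity. *)
Lemma hp_euler d f x : hpoly d f -> \sum_(i < 3) x 0 i * partial i f x = d%:R * f x.
Proof.
elim=> {d f} [k|d j f hf IH|d f g hf IHf hg IHg].
- by rewrite mul0r big1// => i _; rewrite partial_cst mulr0.
- under eq_bigr => i _.
    rewrite partialM ?partial_coord//; [|exact: differentiable_coord|exact: hp_diff hf].
    rewrite mulrDr mulrCA; over.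
  rewrite big_split /= -mulr_sumr IH (bigD1 j)//= eqxx big1 ?addr0.
    rewrite -natr1 (_ : true%:R = 1)//; ring.
  by move=> i ij; rewrite eq_sym (negbTE ij) !mulr0.
- under eq_bigr => i _.
    rewrite partialD; [|exact: hp_diff hf|exact: hp_diff hg].
    rewrite mulrDr; over.
  by rewrite big_split /= IHf IHg mulrDr.
Qed.

Lemma smooth_ninvX d : smooth (fun x => ninv x ^+ d).
Proof.
elim: d => [|d IH]; first by apply: smooth_ext (smooth_cst 1) => x _; rewrite expr0.
by apply: smooth_ext (smoothM (@smooth_ninv R) IH) => x _; rewrite exprS.
Qed.

Lemma partial_ninvX d i x : x != 0 ->
  partial i (fun x => ninv x ^+ d) x = - d%:R * x 0 i * ninv x ^+ d.+2.
Proof.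
move=> x0; elim: d => [|d IH].
  rewrite (_ : (fun x => _) = fun=> 1); first by rewrite partial_cst oppr0 !mul0r.
  by apply/funext => y; rewrite expr0.
rewrite (_ : (fun x => _) = fun x => ninv x * ninv x ^+ d); last by apply/funext => y; rewrite exprS.
rewrite partialM; [|exact: differentiable_ninv|exact: smooth_diff (smooth_ninvX d) x0].
rewrite IH partial_ninv// -natr1 !exprS; ring.
Qed.

Lemma radial_hp d f x : hpoly d f -> radial f x = ninv x ^+ d * f x.
Proof. by move=> hf; rewrite /radial (hp_homog _ _ hf). Qed.

Lemma hp_s_smooth d f : hpoly d f -> s_smooth f.
Proof.
move=> hf; apply/s_smoothP; apply: smooth_ext (smoothM (smooth_ninvX d) (hp_smooth hf)) => x _.
by rewrite (radial_hp _ hf).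
Qed.

(** The Laplacian of enorm^(- d) f, by Euler's identity; Delta f has degree
    d - 2, so f is an eigenfunction up to lower degree. *)
Lemma laplace_hp d f x : hpoly d f -> S2 x ->
  laplace f x = \sum_(i < 3) partial i (partial i f) x - (d * d.+1)%:R * f x.
Proof.
move=> hf Sx; have x0 := S2_neq0 Sx.
have n1 : ninv x = 1 by rewrite /ninv Sx invr1.
have sp i := smooth_partial i (hp_smooth hf).
have rf : radial f = fun x => ninv x ^+ d * f x by apply/funext => y; rewrite (radial_hp _ hf).
have P1 i y : y != 0 -> partial i (radial f) y =
    - d%:R * (y 0 i * (ninv y ^+ d.+2 * f y)) + ninv y ^+ d * partial i f y.
  move=> y0; rewrite rf partialM; [|exact: smooth_diff (smooth_ninvX d) y0|exact: hp_diff hf].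
  by rewrite partial_ninvX//; ring.
have P2 i : partial i (partial i (radial f)) x =
    d%:R * d.+2%:R * f x * (x 0 i * x 0 i) - 2 * d%:R * (x 0 i * partial i f x) - d%:R * f x
    + partial i (partial i f) x.
  rewrite (@near_partial _ _ (fun y => - d%:R * (y 0 i * (ninv y ^+ d.+2 * f y)) + ninv y ^+ d * partial i f y)); last first.
    by apply: off0_near x0 => y; exact: P1.
  have s1 : smooth (fun y => ninv y ^+ d.+2 * f y) by apply: smoothM; [exact: smooth_ninvX|exact: hp_smooth hf].
  have s2 : smooth (fun y => y 0 i * (ninv y ^+ d.+2 * f y)) by apply: smoothM s1; exact: smooth_coord.
  have s3 : smooth (fun y => - d%:R * (y 0 i * (ninv y ^+ d.+2 * f y))) by apply: smoothM s2; exact: smooth_cst.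
  have s4 : smooth (fun y => ninv y ^+ d * partial i f y) by apply: smoothM; [exact: smooth_ninvX|].
  rewrite (partialD _ (smooth_diff s3 x0) (smooth_diff s4 x0)).
  rewrite (partialM _ (smooth_diff (smooth_cst _) x0) (smooth_diff s2 x0)) partial_cst mulr0 addr0.
  rewrite (partialM _ (smooth_diff (smooth_coord R i) x0) (smooth_diff s1 x0)) partial_coord eqxx.
  rewrite (partialM _ (smooth_diff (smooth_ninvX _) x0) (hp_diff _ hf)) partial_ninvX//.
  rewrite (partialM _ (smooth_diff (smooth_ninvX _) x0) (smooth_diff (sp i) x0)) partial_ninvX//.
  rewrite n1 !expr1n (_ : true%:R = 1)//.
  by move: (partial i (partial i f) x) (partial i f x) (f x) (x 0 i) (d%:R : R) (d.+2%:R : R) => *; ring.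
have -> : laplace f x = \sum_(i < 3) (d%:R * d.+2%:R * f x * (x 0 i * x 0 i) - 2 * d%:R * (x 0 i * partial i f x) - d%:R * f x
    + partial i (partial i f) x) by apply: eq_bigr => i _; exact: P2.
rewrite !big_split /= !sumrN -!mulr_sumr (hp_euler _ hf).
rewrite -[\sum_(i < 3) x 0 i * x 0 i]/(dot x x) (S2_dot Sx) sumr_const card_ord.
rewrite natrM -!natr1.
by move: (\sum_(i < 3) _) (f x) (d%:R : R) => *; ring.
Qed.

Lemma s_integrableMb h u C : s_integrable h -> s_measurable u ->
  (forall x, S2 x -> `|u x| <= C) -> s_integrable (fun x => h x * u x).
Proof.
move=> ih mu uC; have iC := s_integrableZ C (s_integrable_norm ih).
apply: (le_integrable _ _ _ iC); first exact: measurable_D2.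
  apply/measurable_EFinP.
  rewrite (_ : (fun z => _) = (fun z => (h (sph z) * sin z.1) * u (sph z))); last by apply/funext => z; ring.
  by apply: measurable_funM => //; exact: s_integrable_meas.
move=> z Dz /=; rewrite lee_fin !normrM normr_id ler_wpM2r// mulrC ler_wpM2r//.
by apply: le_trans (uC _ (sph_S2 z)) _; exact: ler_norm.
Qed.

Lemma hp_bounded d f : hpoly d f -> s_measurable f /\ exists C, forall x, S2 x -> `|f x| <= C.
Proof.
move=> hf; have cf x : S2 x -> {for x, continuous f}.
  by move=> Sx; exact: differentiable_continuous (hp_diff _ hf).
by split; [exact: continuous_s_measurable|exact: sphere_bounded].
Qed.

Lemma hp_integrable h d f : s_integrable h -> hpoly d f -> s_integrable (fun x => h x * f x).
Proof. by move=> ih /hp_bounded[mf [C fC]]; exact: s_integrableMb fC. Qed.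

Lemma hp0_const f : hpoly 0 f -> exists c, f = fun=> c.
Proof.
suff H d : hpoly d f -> d = 0%N -> exists c, f = fun=> c by move=> /H; exact.
elim=> // {d f} [c|d f g _ IHf _ IHg].
  by exists c.
by move=> d0; have [a ->] := IHf d0; have [b ->] := IHg d0; exists (a + b).
Qed.

Section Orthogonal.
Variable h : E3 -> R.
Hypothesis ih : s_integrable h.
Hypothesis h_lap : forall u, s_smooth u -> s_int (fun x => h x * laplace u x) = 0.
Hypothesis h0 : s_int h = 0.

(** Induction on the degree: laplace_hp writes f as a Laplacian plus a
    polynomial of degree d - 2, up to factors. *)
Lemma orth_hp d f : hpoly d f -> s_int (fun x => h x * f x) = 0.
Proof.
have [n] := ubnP d; elim: n d f => // n IH d f; rewrite ltnS => dn hf.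
case: d dn hf => [|d] dn hf.
  have [c ->] := hp0_const hf.
  rewrite (@eq_s_int _ _ (fun x => c * h x)); last by move=> x _; rewrite mulrC.
  by rewrite (s_intZ _ ih) h0 mulr0.
pose g x := \sum_(i < 3) partial i (partial i f) x.
have hg : exists2 e, (e < n)%N & hpoly e g.
  have h1 i := hp_partial i hf.
  have h2 i := hp_partial i (h1 i).
  case: d dn hf h1 h2 => [|d] dn hf h1 h2.
    exists 0%N => //; apply: hp_ext (hp_zero 0) _ => x.
    by rewrite /g big1// => i _; rewrite h2.
  exists d; first by apply: leq_trans dn.
  apply: (@hp_ext _ (fun x => partial 0 (partial 0 f) x + partial 1 (partial 1 f) x + partial 2%:R (partial 2%:R f) x)).
    by apply: hp_add; [apply: hp_add|]; exact: h2.
  by move=> x; rewrite /g sum3.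
have [e en hge] := hg.
have := h_lap (hp_s_smooth hf).
rewrite (@eq_s_int _ _ (fun x => h x * g x + - (d.+1 * d.+2)%:R * (h x * f x))); last first.
  by move=> x Sx; rewrite (laplace_hp hf Sx) /g; ring.
have i1 := hp_integrable ih hge; have i2 := hp_integrable ih hf.
rewrite s_intD//; last exact: s_integrableZ.
rewrite (s_intZ _ i2) (IH e g en hge) add0r => /eqP; rewrite mulf_eq0 oppr_eq0 pnatr_eq0 muln_eq0 /=.
by move/eqP.
Qed.

End Orthogonal.

Inductive polyfun : (E3 -> R) -> Prop :=
| polyfun_h d f : hpoly d f -> polyfun f
| polyfun_add f g : polyfun f -> polyfun g -> polyfun (fun x => f x + g x).

Lemma polyfun_ext f g : polyfun f -> (forall x, f x = g x) -> polyfun g.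
Proof. by move=> hf /funext <-. Qed.

Lemma polyfun_mul f g : polyfun f -> polyfun g -> polyfun (fun x => f x * g x).
Proof.
move=> pf pg; elim: pf => {f} [d f hf|f f' _ IHf _ IHf'].
  elim: pg => {g} [e g hg|g g' _ IHg _ IHg']; first exact: polyfun_h (hp_mul hf hg).
  by apply: polyfun_ext (polyfun_add IHg IHg') _ => x; rewrite mulrDr.
by apply: polyfun_ext (polyfun_add IHf IHf') _ => x; rewrite mulrDl.
Qed.

Lemma polyfun_cst c : polyfun (fun=> c).
Proof. exact: polyfun_h (hp_cst c). Qed.

Lemma polyfun_X f n : polyfun f -> polyfun (fun x => f x ^+ n).
Proof.
move=> pf; elim: n => [|n IH].
  by apply: polyfun_ext (polyfun_cst 1) _ => x; rewrite expr0.
by apply: polyfun_ext (polyfun_mul pf IH) _ => x; rewrite exprS.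
Qed.

Lemma polyfun_affine p c : polyfun (fun x => dot x p + c).
Proof.
apply: polyfun_add (polyfun_cst c); apply: (@polyfun_h 1).
have H i : hpoly 1 (fun x => p 0 i * x 0 i).
  by apply: hp_ext (hp_scale (p 0 i) (hp_coord i (hp_cst 1))) _ => x; rewrite mulr1.
apply: hp_ext (hp_add (hp_add (H 0) (H 1)) (H 2%:R)) _ => x.
by rewrite dotE; ring.
Qed.

Lemma polyfun_bounded f : polyfun f -> s_measurable f /\ exists C, forall x, S2 x -> `|f x| <= C.
Proof.
elim=> {f} [d f|f g _ [mf [C fC]] _ [mg [C' gC]]]; first exact: hp_bounded.
split; first exact: s_measurableD.
exists (C + C') => x Sx; apply: le_trans (ler_normD _ _) _.
by rewrite lerD ?fC ?gC.
Qed.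

Lemma orth_poly h : s_integrable h ->
  (forall u, s_smooth u -> s_int (fun x => h x * laplace u x) = 0) -> s_int h = 0 ->
  forall f, polyfun f -> s_int (fun x => h x * f x) = 0.
Proof.
move=> ih hl h0 f; elim=> {f} [d f|f g pf IHf pg IHg]; first exact: orth_hp.
have [mf [C fC]] := polyfun_bounded pf; have [mg [C' gC]] := polyfun_bounded pg.
rewrite (@eq_s_int _ _ (fun x => h x * f x + h x * g x)); last by move=> x _; rewrite mulrDr.
by rewrite (s_intD (s_integrableMb ih mf fC) (s_integrableMb ih mg gC)) IHf IHg addr0.
Qed.

End Polynomials.

(** * Polynomial approximation of a step *)

Section Threshold.
Variable R : realType.
Implicit Types (t y z : R) (n k : nat).

Lemma bernoulli_lower y k : 0 <= y <= 1 -> 1 - k%:R * y <= (1 - y) ^+ k.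
Proof.
move=> /andP[y0 y1]; elim: k => [|k IH]; first by rewrite mul0r subr0 expr0.
rewrite exprS -natr1; have k0 : 0 <= k%:R :> R by exact: ler0n.
have h : (1 - y) * (1 - k%:R * y) <= (1 - y) * (1 - y) ^+ k by rewrite ler_wpM2l// subr_ge0.
apply: le_trans h; have : 0 <= k%:R * y * y by rewrite !mulr_ge0.
lra.
Qed.

Lemma bernoulli_upper y k : 0 <= y <= 1 -> (1 - y) ^+ k <= (1 + k%:R * y)^-1.
Proof.
move=> /andP[y0 y1]; have k0 : 0 <= k%:R :> R by exact: ler0n.
have d0 : 0 < 1 + k%:R * y by rewrite ltr_pwDl// mulr_ge0.
rewrite -[leRHS]mul1r ler_pdivlMr//.
have h : 1 + k%:R * y <= (1 + y) ^+ k.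
  elim: k k0 {d0} => [|k IH] k0; first by rewrite mul0r addr0 expr0.
  have k1 : 0 <= k%:R :> R by exact: ler0n.
  rewrite exprS -natr1; have h : (1 + y) * (1 + k%:R * y) <= (1 + y) * (1 + y) ^+ k.
    by rewrite ler_wpM2l ?IH// addr_ge0.
  apply: le_trans h; have : 0 <= k%:R * y * y by rewrite !mulr_ge0.
  lra.
apply: (@le_trans _ _ ((1 - y) ^+ k * (1 + y) ^+ k)).
  by rewrite ler_wpM2l// exprn_ge0// subr_ge0.
rewrite -exprMn exprn_ile1//; first by nra.
nra.
Qed.

Lemma cvg_n_expr z : 0 <= z < 1 -> n%:R * z ^+ n @[n --> \oo] --> (0 : R).
Proof.
move=> /andP[z0 z1]; set y := Num.sqrt z.
have y0 : 0 <= y by exact: sqrtr_ge0.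
have yy : y * y = z by rewrite -expr2 sqr_sqrtr.
have y1 : y < 1 by rewrite ltNge; apply/negP => h; move: z1; rewrite -yy; nra.
have d0 : 0 < (1 - y)^-1 by rewrite invr_gt0 subr_gt0.
have h : (1 - y)^-1 * y ^+ n @[n --> \oo] --> (0 : R).
  rewrite -[X in _ --> X](mulr0 (1 - y)^-1); apply: cvgMl_tmp; apply: cvg_expr.
  by rewrite ger0_norm.
apply: (@squeeze_cvgr _ _ _ _ (fun=> 0) _ _ _ _ (cvg_cst _) h); apply: nearW => n.
have yn0 : 0 <= y ^+ n by exact: exprn_ge0.
rewrite mulr_ge0 ?exprn_ge0//=; rewrite -yy exprMn mulrA ler_wpM2r//.
have b := @bernoulli_upper (1 - y) n.
rewrite subKr in b; apply: le_trans (ler_wpM2l (ler0n _ n) (b _)) _.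
  by apply/andP; split; lra.
rewrite ler_pdivrMr; last by rewrite ltr_pwDl// mulr_ge0// subr_ge0 ltW.
by rewrite mulrDr mulr1 mulrCA mulVf ?gt_eqF ?subr_gt0// mulr1 lerDr ltW.
Qed.

(** Polynomials converging boundedly, at every point of the unit interval, to
    the indicator function of the open lower half. *)
Definition threshold n t : R := (1 - t ^+ n) ^+ (n * 2 ^ n).

Lemma threshold_bound n t : 0 <= t <= 1 -> 0 <= threshold n t <= 1.
Proof.
move=> /andP[t0 t1]; have h : t ^+ n <= 1 by exact: exprn_ile1.
have h0 : 0 <= t ^+ n by exact: exprn_ge0.
by rewrite /threshold exprn_ge0 ?subr_ge0//= exprn_ile1 ?subr_ge0// gerBl.
Qed.

Lemma cvg_threshold t : 0 <= t <= 1 -> threshold n t @[n --> \oo] --> ((t < 2^-1)%R%:R : R).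
Proof.
move=> /andP[t0 t1].
have tn n : 0 <= t ^+ n <= 1 by rewrite exprn_ge0//= exprn_ile1.
have [lt|ge] := ltP t 2^-1.
  have z1 : 0 <= 2 * t < 1 by apply/andP; split; lra.
  have h : 1 - n%:R * (2 * t) ^+ n @[n --> \oo] --> (1 : R).
    rewrite -[X in _ --> X]subr0; apply: cvgB; first exact: cvg_cst.
    exact: cvg_n_expr.
  apply: (@squeeze_cvgr _ _ _ _ _ (fun=> 1) _ _ _ h (cvg_cst _)); apply: nearW => n.
  have /andP[_ ->] := @threshold_bound n t (introT andP (conj t0 t1)); rewrite andbT.
  have := bernoulli_lower (n * 2 ^ n) (tn n).
  by rewrite natrM natrX exprMn mulrA.
apply: (@squeeze_cvgr _ _ _ _ (fun=> 0) _ _ _ _ (cvg_cst _) (@cvg_harmonic R)); apply: nearW => n.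
have /andP[-> _] := @threshold_bound n t (introT andP (conj t0 t1)); rewrite /=.
apply: le_trans (bernoulli_upper (n * 2 ^ n) (tn n)) _.
rewrite /harmonic lef_pV2 ?posrE ?ltr0n//; last first.
  by rewrite ltr_pwDl// mulr_ge0// exprn_ge0.
rewrite -natr1 addrC lerD2l natrM natrX -mulrA -exprMn -[leLHS]mulr1 ler_wpM2l//.
by rewrite exprn_ege1//; lra.
Qed.

End Threshold.

(** * A density orthogonal to all polynomials vanishes *)

Section Uniqueness.
Variable R : realType.
Local Notation E3 := 'rV[R]_3.
Local Notation mu2 := (@mu2 R).
Local Notation D := (@sph_dom R).
Implicit Types (P : E3 -> R) (x y p : E3) (z : R * R) (g k : R * R -> R).

Variable H : R * R -> R.
Hypothesis iH : mu2.-integrable D (EFin \o H).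
Hypothesis sH : forall z, D z -> H z != 0 -> 0 < z.1 < pi /\ 0 < z.2 < 2 * pi.
Hypothesis oH : forall P, polyfun P -> \int[mu2]_(z in D) (H z * P (sph z)) = 0.

Lemma mulH_integrable k C : measurable_fun D k -> (forall z, D z -> `|k z| <= C) ->
  mu2.-integrable D (fun z => (H z * k z)%:E).
Proof.
move=> mk kC; have iC := integrableZl (@measurable_D2 R) `|C| iH.
apply: (le_integrable _ _ _ iC); first exact: measurable_D2.
  apply/measurable_EFinP; apply: measurable_funM => //.
  by apply/measurable_EFinP; exact: measurable_int iH.
move=> z Dz /=; rewrite lee_fin !normrM normr_id mulrC ler_wpM2r//.
by apply: le_trans (kC z Dz) _; exact: ler_norm.
Qed.

(** These multipliers of H form a vector space that is stable under bounded
    limits and under polynomials. *)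
Definition orth_weight g := [/\ measurable_fun D g, exists C, forall z, D z -> `|g z| <= C &
  forall P, polyfun P -> \int[mu2]_(z in D) (H z * (g z * P (sph z))) = 0].

Lemma polyfun_sph P : polyfun P -> measurable_fun D (P \o @sph R) /\ exists C, forall z, D z -> `|P (sph z)| <= C.
Proof.
by move=> /polyfun_bounded[mP [C PC]]; split => //; exists C => z _; apply: PC; exact: sph_S2.
Qed.

Lemma HgP_integrable g P C : measurable_fun D g -> (forall z, D z -> `|g z| <= C) -> polyfun P ->
  mu2.-integrable D (fun z => (H z * (g z * P (sph z)))%:E).
Proof.
move=> mg gC /polyfun_sph[mP [C' PC']].
apply: (@mulH_integrable _ (C * C')); first exact: measurable_funM.
by move=> z Dz; rewrite normrM ler_pM ?gC ?PC'.
Qed.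

Lemma orth_weight_lim (g_ : nat -> R * R -> R) g C : (forall n, orth_weight (g_ n)) ->
  (forall n z, D z -> `|g_ n z| <= C) -> (forall z, D z -> `|g z| <= C) ->
  (forall z, D z -> g_ n z @[n --> \oo] --> g z) -> orth_weight g.
Proof.
move=> Gg gnC gC cg.
have mg : measurable_fun D g.
  by apply: measurable_fun_cvg cg => n; have [] := Gg n.
split=> //; first by exists C.
move=> P pP; have [mP [C' PC']] := polyfun_sph pP.
have [] := @dominated_convergence _ _ R mu2 D (@measurable_D2 R)
  (fun n z => (H z * (g_ n z * P (sph z)))%:E) (fun z => (H z * (g z * P (sph z)))%:E)
  (fun z => (`|H z| * (C * C'))%:E).
- by move=> n; have [mgn _ _] := Gg n; exact: measurable_int (HgP_integrable mgn (gnC n) pP).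
- exact: measurable_int (HgP_integrable mg gC pP).
- apply: aeW => z Dz; apply: cvg_EFin; first by near=> n.
  by apply: cvgMl_tmp; apply: cvgMr_tmp; exact: cg.
- have := integrableZl (@measurable_D2 R) (C * C') (integrable_norm iH).
  by apply: eq_integrable => [|z _]; [exact: measurable_D2|rewrite /= -EFinM mulrC].
- apply: aeW => z n Dz; rewrite lee_fin !normrM ler_wpM2l// ler_pM//.
    exact: gnC.
  exact: PC'.
move=> iHg _ cv.
have z0 n : (\int[mu2]_(z in D) (H z * (g_ n z * P (sph z)))%:E = 0)%E.
  have [mgn _ /(_ P pP)] := Gg n; rewrite /Rintegral => h; rewrite -[LHS]fineK ?h//.
  exact: (integrable_fin_num (@measurable_D2 R) (HgP_integrable mgn (gnC n) pP)).
have c0 : (fun n => \int[mu2]_(z in D) (H z * (g_ n z * P (sph z)))%:E)%E @ \oo --> (0 : \bar R).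
  by rewrite (funext z0); exact: cvg_cst.
by rewrite /Rintegral (cvg_unique _ cv c0).
Unshelve. all: by end_near. Qed.

Lemma orth_weight_ext g g' C : orth_weight g -> measurable_fun D g' -> (forall z, D z -> `|g' z| <= C) ->
  (forall z, D z -> H z != 0 -> g z = g' z) -> orth_weight g'.
Proof.
move=> [mg bg og] mg' gC gg'; split=> //; first by exists C.
move=> P pP; rewrite -(og P pP); apply: eq_Rintegral => z /[!inE] Dz.
have [->|Hz] := eqVneq (H z) 0; first by rewrite !mul0r.
by rewrite gg'.
Qed.

Lemma orth_weight1 : orth_weight (fun=> 1).
Proof.
split; [exact: measurable_cst|by exists 1 => z _; rewrite normr1|].
by move=> P pP; rewrite -[RHS](oH pP); apply: eq_Rintegral => z _; rewrite mul1r.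
Qed.

Lemma orth_weightB g g' : orth_weight g -> orth_weight g' -> orth_weight (fun z => g z - g' z).
Proof.
move=> [mg [C gC] og] [mg' [C' gC'] og']; split; first exact: measurable_funB.
  by exists (C + C') => z Dz; apply: le_trans (ler_normB _ _) _; rewrite lerD ?gC ?gC'.
move=> P pP; transitivity (\int[mu2]_(z in D) (H z * (g z * P (sph z)) - H z * (g' z * P (sph z)))).
  by apply: eq_Rintegral => z _; rewrite mulrBl mulrBr.
rewrite (RintegralB (@measurable_D2 R) (HgP_integrable mg gC pP) (HgP_integrable mg' gC' pP)).
by rewrite og// og'// subrr.
Qed.

Lemma orth_weight_polyfun g P : orth_weight g -> polyfun P -> orth_weight (fun z => g z * P (sph z)).
Proof.
move=> [mg [C gC] og] pP; have [mP [C' PC']] := polyfun_sph pP; split.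
- exact: measurable_funM.
- by exists (C * C') => z Dz; rewrite normrM ler_pM ?gC ?PC'.
- move=> Q pQ; rewrite -[RHS](og _ (polyfun_mul pP pQ)); apply: eq_Rintegral => z _.
  by rewrite !mulrA.
Qed.

(** Demanding stability for every multiplier, and not only for 1, makes
    intersections immediate; these sets form a sigma-algebra. *)
Definition orth_stable (A : set (R * R)) := measurable A /\ forall g, orth_weight g -> orth_weight (fun z => g z * \1_A z).

Lemma indic_bound g C (A : set (R * R)) z : `|g z| <= C -> `|g z * \1_A z| <= C.
Proof.
move=> gC; rewrite indicE; case: (z \in A); rewrite ?mulr1 ?mulr0 ?normr0//.
exact: le_trans gC.
Qed.

Lemma measurable_gA g (A : set (R * R)) : measurable A -> measurable_fun D g ->
  measurable_fun D (fun z => g z * \1_A z : R).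
Proof.
by move=> mA mg; apply: measurable_funM.
Qed.

Lemma orth_stable_ext A A' : orth_stable A -> measurable A' -> (forall z, D z -> H z != 0 -> A z <-> A' z) -> orth_stable A'.
Proof.
move=> [mA SA] mA' AA'; split=> // g Gg; have [mg [C gC] _] := Gg.
apply: (@orth_weight_ext _ _ C (SA g Gg)); first exact: measurable_gA.
  by move=> z Dz; apply: indic_bound; exact: gC.
move=> z Dz Hz; rewrite !indicE; congr (_ * (nat_of_bool _)%:R).
by apply/idP/idP; rewrite !inE => /(AA' z Dz Hz).
Qed.

Lemma orth_stable0 : orth_stable set0.
Proof.
split=> // g Gg; have := orth_weightB Gg Gg; congr orth_weight; apply/funext => z.
by rewrite indic0 mulr0 subrr.
Qed.

Lemma orth_stableC A : orth_stable A -> orth_stable (~` A).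
Proof.
move=> [mA SA]; split; first exact: measurableC.
move=> g Gg; have := orth_weightB Gg (SA g Gg); congr orth_weight; apply/funext => z.
by rewrite !indicE in_setC; case: (z \in A) => /=; rewrite ?mulr0 ?mulr1 ?subrr ?subr0.
Qed.

Lemma orth_stableI A B : orth_stable A -> orth_stable B -> orth_stable (A `&` B).
Proof.
move=> [mA SA] [mB SB]; split; first exact: measurableI.
move=> g Gg; have := SB _ (SA g Gg); congr orth_weight; apply/funext => z.
by rewrite !indicE in_setI; case: (z \in A); case: (z \in B); rewrite /= ?mulr0 ?mul0r ?mulr1.
Qed.

Lemma orth_stableU A B : orth_stable A -> orth_stable B -> orth_stable (A `|` B).
Proof. by move=> SA SB; rewrite -[A `|` B]setCK setCU; apply: orth_stableC; apply: orth_stableI; exact: orth_stableC. Qed.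

Lemma orth_stableT : orth_stable setT.
Proof. by rewrite -setC0; apply: orth_stableC; exact: orth_stable0. Qed.

Lemma orth_stable_bigcup (F : nat -> set (R * R)) : (forall n, orth_stable (F n)) -> orth_stable (\bigcup_n F n).
Proof.
move=> SF; pose B n := \big[setU/set0]_(i < n) F i.
have SB n : orth_stable (B n).
  rewrite /B; elim: n => [|n IH]; first by rewrite big_ord0; exact: orth_stable0.
  by rewrite big_ord_recr; exact: orth_stableU.
split; first by apply: bigcupT_measurable => n; have [] := SF n.
move=> g Gg; have [mg [C gC] _] := Gg.
apply: (@orth_weight_lim (fun n z => g z * \1_(B n) z) _ C).
- by move=> n; have [_] := SB n; exact.
- by move=> n z Dz; apply: indic_bound; exact: gC.
- by move=> z Dz; apply: indic_bound; exact: gC.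
- move=> z Dz; apply: cvgMl_tmp.
  have [[m _ Fm]|nF] := pselect ((\bigcup_n F n) z).
    apply: (@cvg_near_cst _ _ _ _ _) => //.
    rewrite indicE mem_set; last by exists m.
    exists m.+1 => // n /= mn; rewrite indicE mem_set//.
    by rewrite /B -bigcup_mkord; exists m.
  rewrite (_ : (fun n => _) = fun=> \1_(\bigcup_n F n) z); first exact: cvg_cst.
  apply/funext => n; rewrite !indicE [in RHS]memNset// memNset// /B -bigcup_mkord.
  by move=> [i _ Fi]; apply: nF; exists i.
Qed.

(** The affine function, rescaled to take values in [0, 1], is inserted in the
    polynomials threshold n. *)
Lemma orth_stable_halfspace (a : E3) (b : R) : orth_stable [set z | dot (sph z) a + b < 0].
Proof.
have mset : measurable [set z : R * R | dot (sph z) a + b < 0].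
  apply: open_measurable_prod.
  have cl : continuous (fun z : R * R => dot (sph z) a + b).
    apply: contD; last by move=> z; exact: cvg_cst.
    move=> z; apply: (@continuous_comp _ _ _ (@sph R) (fun x => dot x a)); first exact: continuous_sph.
    exact: continuous_dotr.
  rewrite (_ : [set z | _] = (fun z => dot (sph z) a + b) @^-1` [set t | t < 0])//.
  by move/continuousP: cl; apply; exact: open_lt.
split=> // g Gg; have [mg [C gC] _] := Gg.
have [_ [B0 HB0]] := polyfun_bounded (polyfun_affine a b).
pose B := `|B0| + 1.
have Bp : 0 < B by rewrite /B ltr_pwDr.
have HB x : S2 x -> `|dot x a + b| <= B.
  move=> Sx; apply: le_trans (HB0 x Sx) _; apply: le_trans (ler_norm _) _.
  by rewrite /B lerDl.
pose t x := dot x ((2 * B)^-1 *: a) + ((2 * B)^-1 * b + 2^-1).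
have tE x : t x = (dot x a + b) / (2 * B) + 2^-1.
  by rewrite /t dotC dotZl dotC; field; rewrite gt_eqF.
have t01 x : S2 x -> 0 <= t x <= 1.
  move=> Sx; have := HB x Sx; rewrite ler_norml tE => /andP[h1 h2].
  have e1 : (dot x a + b) / (2 * B) <= 2^-1.
    by rewrite ler_pdivrMr ?mulr_gt0//; lra.
  have e2 : - 2^-1 <= (dot x a + b) / (2 * B).
    by rewrite ler_pdivlMr ?mulr_gt0//; lra.
  by apply/andP; split; lra.
apply: (@orth_weight_lim (fun n z => g z * threshold n (t (sph z))) _ C).
- move=> n; apply: (@orth_weight_polyfun g (fun x => threshold n (t x))) => //.
  apply: polyfun_X; apply: (@polyfun_ext _ (fun x => 1 + (-1) * t x ^+ n)).
    apply: polyfun_add; first exact: polyfun_cst.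
    apply: polyfun_mul; first exact: polyfun_cst.
    by apply: polyfun_X; exact: polyfun_affine.
  by move=> x; rewrite mulN1r.
- move=> n z Dz; have /andP[h1 h2] := threshold_bound n (t01 _ (sph_S2 z)).
  rewrite normrM (ger0_norm h1) -[leRHS]mulr1 ler_pM// gC//.
- by move=> z Dz; apply: indic_bound; exact: gC.
- move=> z Dz; apply: cvgMl_tmp.
  have -> : \1_[set z | dot (sph z) a + b < 0] z = (t (sph z) < 2^-1)%R%:R :> R.
    have -> : (t (sph z) < 2^-1) = (dot (sph z) a + b < 0).
      by rewrite tE -[X in _ < X]add0r ltrD2r pmulr_llt0 ?invr_gt0 ?mulr_gt0.
    by rewrite indicE; congr (_%:R); congr nat_of_bool; apply/idP/idP; rewrite inE.
  exact: cvg_threshold (t01 _ (sph_S2 z)).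
Qed.

Lemma measurable_fst_lt (a : R) : measurable [set z : R * R | z.1 < a].
Proof.
apply: open_measurable_prod; rewrite (_ : [set z : R * R | z.1 < a] = fst @^-1` [set t | t < a])//.
by apply: open_comp; [move=> z _; exact: cvg_fst|exact: open_lt].
Qed.

Lemma measurable_snd_lt (a : R) : measurable [set z : R * R | z.2 < a].
Proof.
apply: open_measurable_prod; rewrite (_ : [set z : R * R | z.2 < a] = snd @^-1` [set t | t < a])//.
by apply: open_comp; [move=> z _; exact: cvg_snd|exact: open_lt].
Qed.

Lemma orth_stable_theta (a : R) : orth_stable [set z | z.1 < a].
Proof.
have mA := measurable_fst_lt a.
have [a0|a0] := leP a 0.
  apply: (orth_stable_ext orth_stable0 mA) => z Dz /(sH Dz)[/andP[h _] _]; split=> //= h2.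
  by move: (lt_trans h h2); rewrite ltNge a0.
have [ap|ap] := leP pi a.
  by apply: (orth_stable_ext orth_stableT mA) => z Dz /(sH Dz)[/andP[_ h] _]; split=> // _; exact: lt_le_trans ap.
apply: (orth_stable_ext (orth_stable_halfspace (- 'e_2%:R) (cos a)) mA) => z Dz /(sH Dz)[/andP[h1 h2] _] /=.
have -> : dot (sph z) (- 'e_2%:R) = - cos z.1.
  by rewrite dotE !mxE /=; ring.
rewrite addrC subr_lt0 ltr_cos//; by rewrite in_itv /= !ltW.
Qed.

Lemma sin_lt0_pi2 (t : R) : pi < t < 2 * pi -> sin t < 0.
Proof.
move=> /andP[h1 h2]; rewrite -(subrK pi t) sinDpi oppr_lt0; apply: sin_gt0_pi.
by rewrite subr_gt0 h1 /= ltrBlDr -mulr2n -mulr_natl.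
Qed.

(** The sector 0 < phi < b is an intersection of two half-spaces if b <= pi and
    the complement of one if b > pi. *)
Lemma orth_stable_phi (b : R) : orth_stable [set z | z.2 < b].
Proof.
have mA := measurable_snd_lt b.
have [b0|b0] := leP b 0.
  apply: (orth_stable_ext orth_stable0 mA) => z Dz /(sH Dz)[_ /andP[h _]]; split=> //= h2.
  by move: (lt_trans h h2); rewrite ltNge b0.
have [bp|bp] := leP (2 * pi) b.
  by apply: (orth_stable_ext orth_stableT mA) => z Dz /(sH Dz)[_ /andP[_ h]]; split=> // _; exact: lt_le_trans bp.
pose vb : E3 := \row_(i < 3) [:: - sin b; cos b; 0]`_i.
have vbE z : dot (sph z) vb + 0 = sin z.1 * sin (z.2 - b).
  by rewrite dotE !mxE /= sinB; ring.
have eE z : dot (sph z) 'e_1 + 0 = sin z.1 * sin z.2.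
  by rewrite dotE !mxE /=; ring.
have eNE z : dot (sph z) (- 'e_1) + 0 = - (sin z.1 * sin z.2).
  by rewrite dotE !mxE /=; ring.
have [bpi|bpi] := leP b pi.
  apply: (orth_stable_ext (orth_stableI (orth_stable_halfspace (- 'e_1) 0) (orth_stable_halfspace vb 0)) mA) => z Dz /(sH Dz)[h1 /andP[h2 h3]] /=.
  rewrite vbE eNE oppr_lt0; have s1 : 0 < sin z.1 by exact: sin_gt0_pi.
  rewrite pmulr_rgt0// pmulr_rlt0//; split=> [[h4 h5]|h4].
    rewrite ltNge; apply/negP => h6; move: h5; rewrite ltNge => /negP; apply.
    apply: sin_ge0_pi; rewrite subr_ge0 h6 /=.
    have h7 : z.2 < pi.
      rewrite ltNge; apply/negP => h7; move: h4; rewrite ltNge => /negP; apply.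
      move: h7; rewrite le_eqVlt => /predU1P[<-|h7]; first by rewrite sinpi.
      by apply: ltW; apply: sin_lt0_pi2; rewrite h7.
    by lra.
  split; first by apply: sin_gt0_pi; rewrite h2 /= (lt_le_trans h4).
  by rewrite -opprB sinN oppr_lt0; apply: sin_gt0_pi; apply/andP; split; lra.
apply: (orth_stable_ext (orth_stableC (orth_stableI (orth_stable_halfspace 'e_1 0) (orth_stableC (orth_stable_halfspace vb 0)))) mA) => z Dz /(sH Dz)[h1 /andP[h2 h3]] /=.
rewrite vbE eE; have s1 : 0 < sin z.1 by exact: sin_gt0_pi.
rewrite !pmulr_rlt0//; split=> [h4|h4].
  rewrite ltNge; apply/negP => h5; apply: h4; split.
    by apply: sin_lt0_pi2; rewrite (lt_le_trans bpi h5).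
  apply/negP; rewrite -leNgt; apply: sin_ge0_pi; apply/andP; split; lra.
move=> [h5 /negP]; rewrite -leNgt => h6.
have h7 : pi < z.2.
  rewrite ltNge; apply/negP => h7; move: h5; rewrite ltNge => /negP; apply.
  by apply: sin_ge0_pi; rewrite (ltW h2).
move: h6; rewrite leNgt => /negP; apply.
by rewrite -opprB sinN oppr_lt0; apply: sin_gt0_pi; apply/andP; split; lra.
Qed.

Lemma orth_stable_sigma (T : Type) (f : R * R -> T) : sigma_algebra setT [set B : set T | orth_stable (f @^-1` B)].
Proof.
split=> [|B SB|F SF] /=.
- by rewrite preimage_set0; exact: orth_stable0.
- by rewrite setTD preimage_setC; exact: orth_stableC.
- by rewrite preimage_bigcup; exact: orth_stable_bigcup.
Qed.

Lemma orth_stable_fst (B : set R) : measurable B -> orth_stable (fst @^-1` B).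
Proof.
move=> mB; have : (@RGenInftyO.G R).-sigma.-measurable B by rewrite -RGenInftyO.measurableE.
apply: (smallest_sub (orth_stable_sigma fst)) => _ [a ->] /=.
rewrite (_ : _ @^-1` _ = [set z | z.1 < a]); first exact: orth_stable_theta.
by apply/seteqP; split=> z /=; rewrite in_itv.
Qed.

Lemma orth_stable_snd (B : set R) : measurable B -> orth_stable (snd @^-1` B).
Proof.
move=> mB; have : (@RGenInftyO.G R).-sigma.-measurable B by rewrite -RGenInftyO.measurableE.
apply: (smallest_sub (orth_stable_sigma snd)) => _ [a ->] /=.
rewrite (_ : _ @^-1` _ = [set z | z.2 < a]); first exact: orth_stable_phi.
by apply/seteqP; split=> z /=; rewrite in_itv.
Qed.

Lemma orth_stable_all (A : set (R * R)) : measurable A -> orth_stable A.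
Proof.
move=> mA; have : g_sigma_preimageU (fst : R * R -> R) (snd : R * R -> R) A by exact: mA.
apply: (smallest_sub (orth_stable_sigma id)) => B [] [C mC <-]; rewrite setTI.
  exact: orth_stable_fst.
exact: orth_stable_snd.
Qed.

Lemma int_half_zero (c : R) (A : set (R * R)) : measurable A ->
  (forall z, D z -> `|H z * \1_A z| = c * (H z * \1_A z)) ->
  ae_eq mu2 D (fun z => (H z * \1_A z)%:E) (cst 0%E).
Proof.
move=> mA HA; have [mg [C gC] og] := (orth_stable_all mA).2 _ orth_weight1.
have iA := HgP_integrable mg gC (polyfun_cst 1).
have E z : (H z * (1 * \1_A z * 1))%:E = (H z * \1_A z)%:E by rewrite mul1r mulr1.
have m1 : measurable_fun D (fun z => (H z * \1_A z)%:E).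
  by have := measurable_int mu2 iA; rewrite (funext E).
apply/(ae_eq_integral_abs mu2 (@measurable_D2 R) m1).
transitivity (\int[mu2]_(z in D) (c%:E * (H z * (1 * \1_A z * 1))%:E))%E.
  by apply: eq_integral => z; rewrite inE => Dz; rewrite E /= HA.
rewrite (integralZl (@measurable_D2 R) iA).
have h := og _ (polyfun_cst 1); rewrite /Rintegral in h.
rewrite -[X in (_ * X)%E]fineK ?h ?mule0//.
exact: (integrable_fin_num (@measurable_D2 R) iA).
Qed.

(** The sigma-algebra of stable sets contains the half-spaces, hence all Borel
    sets, and the sets where H > 0 and where H < 0 can be inserted. *)
Theorem orthogonal_zero : {ae mu2, forall z, D z -> H z = 0}.
Proof.
have mH : measurable_fun D H by apply/measurable_EFinP; exact: measurable_int iH.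
pose A := D `&` H @^-1` `]0, +oo[%classic.
pose B := D `&` H @^-1` `]-oo, 0[%classic.
have mA : measurable A by apply: mH; [exact: measurable_D|exact: measurable_itv].
have mB : measurable B by apply: mH; [exact: measurable_D|exact: measurable_itv].
have aA : ae_eq mu2 D (fun z => (H z * \1_A z)%:E) (cst 0%E).
  apply: (@int_half_zero 1) => // z Dz; rewrite indicE mul1r.
  case: (boolP (z \in A)); rewrite ?mulr0 ?normr0// inE mulr1 => -[_ /=].
  by rewrite in_itv/= andbT => /ltW /ger0_norm.
have aB : ae_eq mu2 D (fun z => (H z * \1_B z)%:E) (cst 0%E).
  apply: (@int_half_zero (-1)) => // z Dz; rewrite indicE mulN1r.
  case: (boolP (z \in B)); rewrite ?mulr0 ?normr0 ?oppr0// inE mulr1 => -[_ /=].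
  by rewrite in_itv/= => /ltW /ler0_norm.
have [[N [mN N0 sN]] [M [mM M0 sM]]] := (aA, aB).
exists (N `|` M); split; first exact: measurableU.
  exact: null_set_setU.
move=> z /= nP; have /not_implyP[Dz Hz] := nP.
have [h|h|h] := ltgtP (H z) 0; last by [].
  right; apply: sM => /= /(_ Dz); rewrite indicE mem_set ?mulr1; first by case.
  by split => //=; rewrite in_itv.
left; apply: sN => /= /(_ Dz); rewrite indicE mem_set ?mulr1; first by case.
by split => //=; rewrite in_itv/= andbT.
Qed.

End Uniqueness.

(** * Weakly harmonic functions, the Green function and f_g *)

Section SphereUnique.
Variable R : realType.
Local Notation E3 := 'rV[R]_3.
Local Notation mu2 := (@mu2 R).
Local Notation D := (@sph_dom R).
Implicit Types (u f g h : E3 -> R) (x y p : E3) (z : R * R).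

Lemma ae_off_meridians (a b : R) (P : R * R -> Prop) :
  (forall z, D z -> z.2 != a -> z.2 != b -> P z) -> {ae mu2, forall z, D z -> P z}.
Proof.
have mab : measurable [set a; b] by apply: measurableU; exact: measurable_set1.
move=> H; exists (setT `*` [set a; b]); split.
- exact: (@measurableX _ _ (measurableTypeR R) (measurableTypeR R)).
- rewrite mu2X//; rewrite [X in (_ * X)%E](_ : _ = 0%E) ?mule0//.
  by apply: countable_lebesgue_measure0; exact: finite_set_countable.
- move=> z /= /not_implyP[Dz nP]; split=> //.
  have [->|za] := eqVneq z.2 a; first by left.
  have [->|zb] := eqVneq z.2 b; first by right.
  by exfalso; apply: nP; exact: H.
Qed.

(** The factor sin theta discards the values at the poles of the coordinates. *)
Definition s_ae_eq f g := {ae mu2, forall z, D z -> f (sph z) * sin z.1 = g (sph z) * sin z.1}.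

Lemma s_ae_eq_int f g : measurable_fun D (fun z => f (sph z) * sin z.1) ->
  measurable_fun D (fun z => g (sph z) * sin z.1) -> s_ae_eq f g -> s_int f = s_int g.
Proof.
move=> mf mg fg; rewrite /s_int /Rintegral; congr fine.
apply: ae_eq_integral; [exact: measurable_D2|exact/measurable_EFinP|exact/measurable_EFinP|].
by apply: ae_D_sub fg => z _ ->.
Qed.

Lemma s_ae_eq_integrable f g : measurable_fun D (fun z => f (sph z) * sin z.1) ->
  s_integrable g -> s_ae_eq f g -> s_integrable f.
Proof.
move=> mf ig fg; have mg := s_integrable_meas ig.
have /integrableP[mg' gfin] := ig.
apply/integrableP; split; first exact/measurable_EFinP.
rewrite (_ : (\int[mu2]_(x in D) _)%E = (\int[mu2]_(z in D) `|(g (sph z) * sin z.1)%:E|)%E)//.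
apply: ae_eq_integral.
- exact: measurable_D2.
- by apply: measurableT_comp => //; exact/measurable_EFinP.
- by apply: measurableT_comp => //; exact/measurable_EFinP.
by apply: ae_D_sub fg => z _ ->.
Qed.

(** Minus its mean, h is orthogonal to all polynomials by orth_poly. *)
Lemma sphere_unique h : s_integrable h ->
  (forall u, s_smooth u -> s_int (fun x => h x * laplace u x) = 0) ->
  exists c, s_ae_eq h (fun=> c).
Proof.
move=> ih hl; pose c := s_int h / (4 * pi); exists c.
have pi4 : 4 * pi != 0 :> R by rewrite mulf_neq0// lt0r_neq0// pi_gt0.
have ic := s_integrableZ (- c) (@s_integrable1 R).
pose h' x := h x + - c * 1.
have ih' : s_integrable h' by exact: s_integrableD.
have h'0 : s_int h' = 0.
  rewrite s_intD// (s_intZ _ (@s_integrable1 R)) -/(s_area R) s_areaE.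
  by rewrite /c mulNr divfK// subrr.
have lap0 u : s_smooth u -> s_int (laplace u) = 0.
  move=> su; transitivity (s_int (fun x => 1 * laplace u x)).
    by apply: eq_s_int => x _; rewrite mul1r.
  refine (eq_trans (green_smooth (@s_smooth1 R) su) _).
  transitivity (s_int (fun=> 0 * 1 : R)); last by rewrite (s_intZ 0 (@s_integrable1 R)) mul0r.
  by apply: eq_s_int => x _; rewrite laplace1 mulr0 mul0r.
have h'l u : s_smooth u -> s_int (fun x => h' x * laplace u x) = 0.
  move=> su; have sl := smooth_laplace su.
  have cl x : S2 x -> {for x, continuous (laplace u)} by exact: smooth_continuous.
  have ml : s_measurable (laplace u) by exact: continuous_s_measurable.
  have [C HC] := sphere_bounded cl.
  have i1 := s_integrableMb ih ml HC.
  have i2 := sphere_cont_integrable cl.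
  rewrite (@eq_s_int _ _ (fun x => h x * laplace u x + - c * laplace u x)); last by move=> x _; rewrite /h'; ring.
  by rewrite s_intD; [rewrite hl// (s_intZ _ i2) lap0// mulr0 addr0|exact: i1|exact: s_integrableZ].
(* without the meridian phi = 0, 2 pi, where sph is not injective *)
pose I : set (R * R) := setT `*` `]0, 2 * pi[%classic.
have mI : measurable I by apply: measurableX => //; exact: measurable_itv.
pose H z := h' (sph z) * sin z.1 * \1_I z.
have mH : measurable_fun D H by apply: measurable_gA => //; exact: s_integrable_meas.
have iH : mu2.-integrable D (EFin \o H).
  apply: (le_integrable _ _ _ ih'); first exact: measurable_D2.
    exact/measurable_EFinP.
  move=> z Dz /=; rewrite lee_fin /H indicE; case: (z \in I); rewrite ?mulr1// mulr0 normr0//.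
have eH : {ae mu2, forall z, D z -> H z = h' (sph z) * sin z.1}.
  apply: (@ae_off_meridians 0 (2 * pi)) => z [_ /=]; rewrite in_itv /= => /andP[h1 h2] h3 h4.
  rewrite /H indicE mem_set ?mulr1//; split=> //=; rewrite in_itv/=.
  by rewrite !lt_neqAle h1 h2 eq_sym h3 h4.
have sH z : D z -> H z != 0 -> 0 < z.1 < pi /\ 0 < z.2 < 2 * pi.
  move=> [/= + _]; rewrite in_itv/= => /andP[h1 h2] Hz; split; last first.
    move: Hz; rewrite /H indicE; case: (boolP (z \in I)); rewrite ?mulr0 ?eqxx//.
    by rewrite inE => -[_ /=]; rewrite in_itv.
  have sz : sin z.1 != 0 by apply: contraNneq Hz; rewrite /H => ->; rewrite mulr0 mul0r.
  rewrite !lt_neqAle h1 h2 !andbT; apply/andP; split.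
    by apply: contraNneq sz => <-; rewrite sin0.
  by apply: contraNneq sz => ->; rewrite sinpi.
have oH P : polyfun P -> \int[mu2]_(z in D) (H z * P (sph z)) = 0.
  move=> pP; have := orth_poly ih' h'l h'0 pP => <-.
  have [mP _] := polyfun_sph pP.
  rewrite /s_int /Rintegral; congr fine; apply: ae_eq_integral; first exact: measurable_D2.
  - by apply/measurable_EFinP; apply: measurable_funM.
  - apply/measurable_EFinP; rewrite (_ : (fun z => _) = (fun z => h' (sph z) * sin z.1 * P (sph z))).
      by apply: measurable_funM => //; exact: s_integrable_meas.
    by apply/funext => z; ring.
  - by apply: ae_D_sub eH => z _ ->; congr (_%:E); ring.
apply: ae_D_sub (ae_D_and (orthogonal_zero iH sH oH) eH) => z _ [HN HM].
by apply/eqP; rewrite -subr_eq0 -mulrBl; move: HN; rewrite HM /h' mulr1 => ->.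
Qed.

(** The difference with the logarithm is weakly harmonic by log_green. *)
Lemma green_ae G p : green_function G -> S2 p ->
  exists c, s_ae_eq (G^~ p) (fun x => logk p x / (4 * pi) + c).
Proof.
move=> hG Sp; have [iG _ gG] := hG p Sp.
have pi4 : 4 * pi != 0 :> R by rewrite mulf_neq0// lt0r_neq0// pi_gt0.
have il := s_integrableZ (- (4 * pi)^-1) (logk_integrable Sp).
pose h x := G x p + - (4 * pi)^-1 * logk p x.
have ih : s_integrable h by exact: s_integrableD.
have [|c Hc] := @sphere_unique h ih.
  move=> u su; have sl := smooth_laplace su.
  have cl x : S2 x -> {for x, continuous (laplace u)} by exact: smooth_continuous.
  have ml : s_measurable (laplace u) by exact: continuous_s_measurable.
  have [C HC] := sphere_bounded cl.
  have i1 := s_integrableMb iG ml HC.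
  have i2 := s_integrableMb (logk_integrable Sp) ml HC.
  rewrite (@eq_s_int _ _ (fun x => G x p * laplace u x + - (4 * pi)^-1 * (logk p x * laplace u x))); last first.
    by move=> x _; rewrite /h; ring.
  rewrite s_intD//; last exact: s_integrableZ.
  rewrite (s_intZ _ i2) (log_green Sp su).
  have := gG u su; rewrite s_areaE.
  rewrite (@eq_s_int _ _ (fun x => -1 * (G x p * laplace u x))); last by move=> x _; ring.
  rewrite (s_intZ _ i1) mulN1r => /eqP; rewrite eqr_oppLR => /eqP ->.
  by move: (4 * pi : R) pi4 => P P0; field.
exists c; apply: ae_D_sub Hc => z _ H; rewrite mulrDl -H /h mulrDl; ring.
Qed.

(** On the round sphere 4 pi chi / area = 2 kappa, so f is harmonic. *)
Lemma f_g_ae f : is_f_g f -> exists c, s_ae_eq f (fun=> c).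
Proof.
move=> [sf lf _]; apply: sphere_unique; first exact: s_smooth_integrable.
move=> u su; rewrite (green_smooth sf su).
have pi0 : pi != 0 :> R := lt0r_neq0 (pi_gt0 R).
rewrite (@eq_s_int _ _ (fun=> 0 * 1)).
  by rewrite (s_intZ 0 (@s_integrable1 R)) mul0r.
move=> x Sx; have := lf x Sx; rewrite s_areaE /euler_char /gauss_curv.
have -> : 4 * pi * 2 / (4 * pi) - 2 * 1 = 0 :> R by move: (pi : R) pi0 => P P0; field.
by move=> /eqP; rewrite oppr_eq0 => /eqP ->; rewrite mulr0 mul0r.
Qed.

End SphereUnique.

(** * The Liouville equation on the line *)

Section LiouvilleODE.
Variable R : realType.
Implicit Types (f g h K : R -> R) (t c : R).

Definition piecewise c g h t := if t <= c then g t else h t.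

Lemma is_derive_glue c g h (g' h' : R -> R) t :
  (forall t, is_derive t 1 g (g' t)) -> (forall t, is_derive t 1 h (h' t)) ->
  g c = h c -> g' c = h' c ->
  is_derive t 1 (piecewise c g h) (piecewise c g' h' t).
Proof.
move=> dg dh gh gh'; rewrite {2}/piecewise; case: (ltgtP t c) => [tc|tc|->].
- apply: (@near_eq_is_derive _ _ _ g) (dg t).
  by apply: filterS (near_lt tc) => s sc; rewrite /piecewise ltW.
- apply: (@near_eq_is_derive _ _ _ h) (dh t).
  by apply: filterS (near_gt tc) => s sc; rewrite /piecewise leNgt sc.
- have cg : s^-1 *: (g (s *: 1 + c) - g c) @[s --> 0^'] --> g' c.
    by have [/cvg_ex[l hl] <-] := dg c; rewrite /derive (cvg_lim _ hl).
  have ch : s^-1 *: (h (s *: 1 + c) - h c) @[s --> 0^'] --> g' c.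
    by rewrite gh'; have [/cvg_ex[l hl] <-] := dh c; rewrite /derive (cvg_lim _ hl).
  have cf : s^-1 *: (piecewise c g h (s *: 1 + c) - piecewise c g h c) @[s --> 0^'] --> g' c.
    apply/cvgrPdist_lt => e e0.
    move/cvgrPdist_lt: cg => /(_ e e0); move/cvgrPdist_lt: ch => /(_ e e0).
    apply: filterS2 => s Hh Hg; rewrite {2}/piecewise lexx /piecewise.
    by case: ifP => _ //; rewrite gh.
  by apply: DeriveDef; [apply/cvg_ex; exists (g' c)|apply: cvg_lim].
Qed.

(** f = e^(- w / 2) turns - w'' = 2 K e^w into f f'' - f'^2 = K; a solution is
    recorded with its first derivative. *)
Definition solves K f f1 := forall t, [/\ 0 < f t, is_derive t 1 f (f1 t) &
  is_derive t 1 f1 ((f1 t ^+ 2 + K t) / f t)].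

Lemma solves_glue c Kg Kh g g1 h h1 : solves Kg g g1 -> solves Kh h h1 ->
  g c = h c -> g1 c = h1 c -> Kg c = Kh c ->
  solves (piecewise c Kg Kh) (piecewise c g h) (piecewise c g1 h1).
Proof.
move=> sg sh e0 e1 eK t; split.
- by rewrite /piecewise; case: ifP => _; [have [] := sg t|have [] := sh t].
- apply: is_derive_glue => // s; first by have [] := sg s.
  by have [] := sh s.
- have := @is_derive_glue c g1 h1 (fun t => (g1 t ^+ 2 + Kg t) / g t) (fun t => (h1 t ^+ 2 + Kh t) / h t) t.
  have -> : piecewise c (fun t => (g1 t ^+ 2 + Kg t) / g t) (fun t => (h1 t ^+ 2 + Kh t) / h t) t =
    (piecewise c g1 h1 t ^+ 2 + piecewise c Kg Kh t) / piecewise c g h t by rewrite /piecewise; case: ifP.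
  apply; [by move=> s; have [] := sg s|by move=> s; have [] := sh s|done|].
  by rewrite e0 e1 eK.
Qed.

(** Sums of two exponentials: the solutions when K is an exponential. *)
Definition expsol (A a B b c t : R) : R := A * expR (a * (t - c)) + B * expR (b * (t - c)).

Lemma is_derive_exp (a c t : R) : is_derive t 1 (fun t => expR (a * (t - c))) (a * expR (a * (t - c))).
Proof.
have H : is_derive t 1 (fun t => a * (t - c)) a.
  by apply: isd_eq (isdZ a (isdD (isdX t) (isdC (- c) t))) _; rewrite addr0 mulr1.
by rewrite mulrC; apply: isd_comp (is_derive_expR _) H.
Qed.

Lemma is_derive_expsol (A a B b c t : R) :
  is_derive t 1 (expsol A a B b c) (expsol (A * a) a (B * b) b c t).
Proof.
apply: isd_eq (isdD (isdZ A (is_derive_exp a c t)) (isdZ B (is_derive_exp b c t))) _.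
by rewrite /expsol !mulrA.
Qed.

Lemma solves_exp (A a B b c : R) : 0 < A -> 0 < B ->
  solves (fun t => A * B * (a - b) ^+ 2 * expR ((a + b) * (t - c)))
    (expsol A a B b c) (expsol (A * a) a (B * b) b c).
Proof.
move=> A0 B0 t.
have f0 : 0 < expsol A a B b c t by rewrite addr_gt0// mulr_gt0// expR_gt0.
split; [exact: f0|exact: is_derive_expsol|].
apply: isd_eq (is_derive_expsol _ _ _ _ _ _) _.
apply: (mulIf (lt0r_neq0 f0)); rewrite divfK ?lt0r_neq0//.
rewrite /expsol [(a + b) * (t - c)]mulrDl expRD; move: (expR (a * (t - c))) (expR (b * (t - c))) => x y; ring.
Qed.

(** The initial value problem with K = k e^(2 sg (t - c)): conservation of
    energy makes the exponents sg + del and sg - del. *)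
Lemma ivp (f0 d k sg del : R) : 0 < f0 -> 0 < k -> 0 < del ->
  del ^+ 2 = (d / f0 - sg) ^+ 2 + k / f0 ^+ 2 ->
  exists A B, [/\ 0 < A, 0 < B, A + B = f0, A * (sg + del) + B * (sg - del) = d &
    A * B * (2 * del) ^+ 2 = k].
Proof.
move=> f0p kp dp dE.
have f0n : f0 != 0 := lt0r_neq0 f0p.
have dn : del != 0 := lt0r_neq0 dp.
have E : (f0 * del) ^+ 2 = (d - sg * f0) ^+ 2 + k.
  by rewrite exprMn dE; field.
have /andP[h1 h2] : - (f0 * del) < d - sg * f0 < f0 * del.
  rewrite -ltr_norml -(ltr_pXn2r (ltn0Sn 1)) ?nnegrE//; last by rewrite mulr_ge0// ltW.
  by rewrite real_normK ?num_real// E ltrDl.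
have e1 : (d - sg * f0) / del < f0 by rewrite ltr_pdivrMr.
have e2 : - f0 < (d - sg * f0) / del by rewrite ltr_pdivlMr// mulNr.
exists ((f0 + (d - sg * f0) / del) / 2), ((f0 - (d - sg * f0) / del) / 2); split.
- lra.
- lra.
- lra.
- by field.
- have -> : k = (f0 * del) ^+ 2 - (d - sg * f0) ^+ 2 by rewrite E; ring.
  by field.
Qed.

End LiouvilleODE.

(** * Shooting for the conical exponent *)

Section Shooting.
Variable R : realType.
Variable m : R.
Hypothesis m2 : 2 <= m.
Implicit Types (e t g : R).

(** Shooting from + oo with f = e^(- t) + e * e^t on t >= 0. On [-1, 0] the
    exponents are - m +- mid_rate, with mid_slope the logarithmic slope of
    e^(m t) f at 0 and mid_energy the weight at 0 over f(0)^2. Up to a common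
    factor mid_value and mid_deriv are the values at -1 of e^(m t) f and of its
    derivative, and left_rate2 is the square of the exponent on t <= -1. *)
Definition mid_slope e := (e - 1) / (1 + e) + m.
Definition mid_energy e := 4 * e / (1 + e) ^+ 2.
Definition mid_rate e := Num.sqrt (mid_slope e ^+ 2 + mid_energy e).
Definition mid_value e := expR (mid_rate e) + expR (- mid_rate e) - mid_slope e / mid_rate e * (expR (mid_rate e) - expR (- mid_rate e)).
Definition mid_deriv e := mid_slope e * (expR (mid_rate e) + expR (- mid_rate e)) - mid_rate e * (expR (mid_rate e) - expR (- mid_rate e)).
Definition left_rate2 e := (mid_deriv e / mid_value e - m) ^+ 2 + 4 * mid_energy e / mid_value e ^+ 2.

Lemma mid_slope_ge1 e : 0 <= e -> 1 <= mid_slope e.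
Proof.
move=> e0; have d0 : 0 < 1 + e by lra.
have : -1 <= (e - 1) / (1 + e) by rewrite ler_pdivlMr//; lra.
by rewrite /mid_slope; have := m2; lra.
Qed.

Lemma mid_energy_ge0 e : 0 <= e -> 0 <= mid_energy e.
Proof. by move=> e0; rewrite /mid_energy divr_ge0 ?sqr_ge0// mulr_ge0. Qed.

Lemma mid_rate2 e : 0 <= e -> mid_rate e ^+ 2 = mid_slope e ^+ 2 + mid_energy e.
Proof. by move=> e0; rewrite /mid_rate sqr_sqrtr// addr_ge0 ?sqr_ge0 ?mid_energy_ge0. Qed.

Lemma mid_slope_le_rate e : 0 <= e -> mid_slope e <= mid_rate e.
Proof.
move=> e0; have r1 := mid_slope_ge1 e0.
rewrite -(ler_pXn2r (ltn0Sn 1)) ?nnegrE ?sqrtr_ge0//; last by lra.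
by rewrite mid_rate2// lerDl mid_energy_ge0.
Qed.

Lemma mid_rate_gt0 e : 0 <= e -> 0 < mid_rate e.
Proof. by move=> e0; have := mid_slope_le_rate e0; have := mid_slope_ge1 e0; lra. Qed.

Lemma mid_value_gt0 e : 0 <= e -> 0 < mid_value e.
Proof.
move=> e0; have d0 := mid_rate_gt0 e0; have rd := mid_slope_le_rate e0.
have q1 : mid_slope e / mid_rate e <= 1 by rewrite ler_pdivrMr// mul1r.
have S0 : 0 <= expR (mid_rate e) - expR (- mid_rate e) by rewrite subr_ge0 ler_expR; lra.
have X0 : 0 < expR (- mid_rate e) by exact: expR_gt0.
have : mid_slope e / mid_rate e * (expR (mid_rate e) - expR (- mid_rate e)) <= 1 * (expR (mid_rate e) - expR (- mid_rate e)).
  by rewrite ler_wpM2r.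
rewrite /mid_value; lra.
Qed.

Lemma left_rate2_continuous e : 0 <= e -> {for e, continuous left_rate2}.
Proof.
move=> e0; have d1 : 1 + e != 0 by rewrite lt0r_neq0//; lra.
have cr : mid_slope t @[t --> e] --> mid_slope e.
  apply: cvgD; last exact: cvg_cst.
  apply: cvgM; first by apply: cvgB; [exact: cvg_id|exact: cvg_cst].
  by apply: cvgV => //; apply: cvgD; [exact: cvg_cst|exact: cvg_id].
have cq : mid_energy t @[t --> e] --> mid_energy e.
  apply: cvgM; first by apply: cvgMl_tmp; exact: cvg_id.
  apply: cvgV; first by rewrite expf_neq0.
  by apply: (@cvgM _ _ _ _ (fun t => 1 + t) (fun t => 1 + t)); apply: cvgD; try exact: cvg_cst; exact: cvg_id.
have cd : mid_rate t @[t --> e] --> mid_rate e.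
  apply: (@continuous_cvg _ _ _ _ _ (fun t => mid_slope t ^+ 2 + mid_energy t) Num.sqrt); first exact: sqrt_continuous.
  by apply: cvgD cq; apply: (@cvgM _ _ _ _ mid_slope mid_slope).
have c1 : expR (mid_rate t) @[t --> e] --> expR (mid_rate e) by apply: continuous_cvg cd; exact: continuous_expR.
have c2 : expR (- mid_rate t) @[t --> e] --> expR (- mid_rate e).
  by apply: (@continuous_cvg _ _ _ _ _ (fun t => - mid_rate t) expR); [exact: continuous_expR|exact: cvgN].
have dn : mid_rate e != 0 by rewrite lt0r_neq0// mid_rate_gt0.
have cS : expR (mid_rate t) - expR (- mid_rate t) @[t --> e] --> expR (mid_rate e) - expR (- mid_rate e) by exact: cvgB.
have cC : expR (mid_rate t) + expR (- mid_rate t) @[t --> e] --> expR (mid_rate e) + expR (- mid_rate e) by exact: cvgD.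
have cQ : mid_slope t / mid_rate t @[t --> e] --> mid_slope e / mid_rate e by apply: cvgM; [exact: cr|exact: cvgV].
have cP : mid_value t @[t --> e] --> mid_value e.
  apply: cvgB; first exact: cC.
  apply: (@cvgM _ _ _ _ (fun t => mid_slope t / mid_rate t) (fun t => expR (mid_rate t) - expR (- mid_rate t))); first exact: cQ.
  exact: cS.
have cPs : mid_deriv t @[t --> e] --> mid_deriv e.
  apply: cvgB.
    by apply: (@cvgM _ _ _ _ mid_slope (fun t => expR (mid_rate t) + expR (- mid_rate t))); [exact: cr|exact: cC].
  by apply: (@cvgM _ _ _ _ mid_rate (fun t => expR (mid_rate t) - expR (- mid_rate t))); [exact: cd|exact: cS].
have Pn : mid_value e != 0 by rewrite lt0r_neq0// mid_value_gt0.
have cR : mid_deriv t / mid_value t - m @[t --> e] --> mid_deriv e / mid_value e - m.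
  by apply: cvgB; [apply: cvgM; [exact: cPs|exact: cvgV]|exact: cvg_cst].
have cR2 : (mid_deriv t / mid_value t - m) ^+ 2 @[t --> e] --> (mid_deriv e / mid_value e - m) ^+ 2.
  by apply: (@cvgM _ _ _ _ (fun t => mid_deriv t / mid_value t - m) (fun t => mid_deriv t / mid_value t - m)); exact: cR.
have cP2 : mid_value t ^+ 2 @[t --> e] --> mid_value e ^+ 2 by apply: (@cvgM _ _ _ _ mid_value mid_value); exact: cP.
apply: cvgD; first exact: cR2.
apply: (@cvgM _ _ _ _ (fun t => 4 * mid_energy t) (fun t => (mid_value t ^+ 2)^-1)).
  by apply: cvgMl_tmp; exact: cq.
by apply: cvgV; [rewrite expf_neq0|exact: cP2].
Qed.

(** For e = 0 the solution is e^(- t) on the three pieces. *)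
Lemma left_rate2_0 : left_rate2 0 = 1.
Proof.
have r0 : mid_slope 0 = m - 1 by rewrite /mid_slope addr0 divr1; ring.
have q0 : mid_energy 0 = 0 by rewrite /mid_energy mulr0 mul0r.
have m1 : 0 < m - 1 by have := m2; lra.
have d0 : mid_rate 0 = m - 1 by rewrite /mid_rate r0 q0 addr0 sqrtr_sqr ger0_norm// ltW.
rewrite /left_rate2 /mid_deriv /mid_value r0 q0 d0; have X0 := expR_gt0 (- (m - 1)).
move: (expR (- (m - 1))) X0 => X X0; move: (expR (m - 1)) => Y.
rewrite mulfV ?lt0r_neq0// mulr0 mul0r addr0 mul1r.
have -> : (m - 1) * (Y + X) - (m - 1) * (Y - X) = (m - 1) * (2 * X) by ring.
have -> : Y + X - (Y - X) = 2 * X by ring.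
by rewrite mulfK ?mulf_neq0 ?lt0r_neq0//; ring.
Qed.

(** It suffices that mid_deriv 1 <= 0; since mid_rate 1 = d with d^2 = m^2 + 1,
    this follows from e^d >= (1 + d / 2)^2 >= d + m. *)
Lemma left_rate2_1 : m ^+ 2 <= left_rate2 1.
Proof.
have r1 : mid_slope 1 = m by rewrite /mid_slope subrr mul0r add0r.
have q1 : mid_energy 1 = 1 by rewrite /mid_energy; field.
have l0 : (0 : R) <= 1 by [].
have d2 : mid_rate 1 ^+ 2 = m ^+ 2 + 1 by rewrite mid_rate2// r1 q1.
have d0 := mid_rate_gt0 l0; have md : m <= mid_rate 1 by rewrite -{1}r1 mid_slope_le_rate.
have P0 := mid_value_gt0 l0.
suff Ps : mid_deriv 1 <= 0.
  have h : mid_deriv 1 / mid_value 1 <= 0 by rewrite ler_pdivrMr// mul0r.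
  have h2 : 0 <= 4 * mid_energy 1 / mid_value 1 ^+ 2 by rewrite q1 mulr1 divr_ge0 ?sqr_ge0.
  rewrite /left_rate2; have := m2; nra.
rewrite /mid_deriv r1 expRN; set d := mid_rate 1 in d2 d0 md *; set X := expR d.
have X0 : 0 < X by exact: expR_gt0.
have hX : d + m <= X.
  have h1 : (1 + d / 2) ^+ 2 <= X.
    rewrite (_ : X = expR (d / 2) ^+ 2); last by rewrite expr2 -expRD -splitr.
    by rewrite ler_pXn2r ?nnegrE ?expR_ge0 ?expR_ge1Dx// addr_ge0// divr_ge0// ltW.
  apply: le_trans h1; have -> : (1 + d / 2) ^+ 2 = 1 + d + d ^+ 2 / 4 by field.
  rewrite d2; have h3 := sqr_ge0 (m - 2).
  have -> : m ^+ 2 = (m - 2) ^+ 2 + 4 * m - 4 by ring.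
  lra.
have key : d + m <= (d - m) * X ^+ 2.
  have h : (d + m) ^+ 2 <= X ^+ 2.
    by rewrite ler_pXn2r ?nnegrE// ltW//; have := m2; lra.
  have dm1 : (d - m) * (d + m) = 1.
    have -> : (d - m) * (d + m) = d ^+ 2 - m ^+ 2 by ring.
    by rewrite d2; ring.
  have dm0 : 0 <= d - m by lra.
  apply: (@le_trans _ _ ((d - m) * (d + m) ^+ 2)); last by rewrite ler_wpM2l.
  by rewrite expr2 mulrA dm1 mul1r.
have -> : m * (X + X^-1) - d * (X - X^-1) = ((d + m) - (d - m) * X ^+ 2) / X.
  by field; exact: lt0r_neq0.
by rewrite ler_pdivrMr// mul0r subr_le0.
Qed.

Lemma shooting g : 1 < g < m -> exists2 e, 0 < e <= 1 & left_rate2 e = g ^+ 2.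
Proof.
move=> /andP[g1 gm].
have cG : {within `[0, 1], continuous left_rate2}.
  apply: continuous_in_subspaceT => e /[!inE] /=; rewrite in_itv /= => /andP[e0 _].
  exact: left_rate2_continuous.
have [|e] := @IVT R left_rate2 0 1 (g ^+ 2) ler01 cG.
  rewrite left_rate2_0; apply/andP; split.
    by rewrite ge_min; apply/orP; left; nra.
  by rewrite le_max; apply/orP; right; apply: le_trans left_rate2_1; nra.
rewrite in_itv /= => /andP[e0 e1] eG; exists e => //; rewrite e1 andbT lt_neqAle e0 andbT.
by apply/eqP => e00; move: eG; rewrite -e00 left_rate2_0; nra.
Qed.

Definition cyl_weight t : R := piecewise (-1) (fun=> expR (2 * m)) (piecewise 0 (fun t => expR (- 2 * m * t)) (fun=> 1)) t.

Lemma solves_ext K K' (f f1 : R -> R) : (forall t, K t = K' t) -> solves K f f1 -> solves K' f f1.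
Proof. by move=> KK s t; rewrite -KK; exact: s. Qed.

(** The exponents of f are 1 at + oo, a regular pole, and g at - oo, a conical
    point of angle 2 pi g. The pieces are glued at 0 and -1, where the weight is
    continuous and the value and slope of f are propagated by ivp. *)
Lemma conical_family g : 1 < g < m -> exists e f f1, [/\ 0 < e, solves (fun t => 4 * e * cyl_weight t) f f1,
  (forall t, 0 < t -> f t = expR (- t) + e * expR t /\ f1 t = - expR (- t) + e * expR t) &
  exists A B, [/\ 0 < A, 0 < B & forall t, t <= -1 ->
    f t = A * expR (- (g * t)) + B * expR (g * t) /\
    f1 t = - (g * A) * expR (- (g * t)) + g * B * expR (g * t)]].
Proof.
move=> gm; have [e /andP[e0 e1] eG] := shooting gm; have /andP[g1 _] := gm.
have f00 : 0 < 1 + e by lra.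
have k0 : 0 < 4 * e by rewrite mulr_gt0.
have e0' := ltW e0.
have dp := mid_rate_gt0 e0'; have Pp := mid_value_gt0 e0'.
have [|A1 [B1 [A10 B10 AB1 ABd ABk]]] := @ivp R (1 + e) (e - 1) (4 * e) (- m) (mid_rate e) f00 k0 dp.
  by rewrite opprK mid_rate2.
pose fR := expsol 1 (-1) e 1 0; pose fR1 := expsol (1 * -1) (-1) (e * 1) 1 0.
have sR := @solves_exp R 1 (-1) e 1 0 ltr01 e0.
pose fM := expsol A1 (- m + mid_rate e) B1 (- m - mid_rate e) 0.
pose fM1 := expsol (A1 * (- m + mid_rate e)) (- m + mid_rate e) (B1 * (- m - mid_rate e)) (- m - mid_rate e) 0.
have sM := @solves_exp R A1 (- m + mid_rate e) B1 (- m - mid_rate e) 0 A10 B10.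
have dn : mid_rate e != 0 := lt0r_neq0 dp.
have fn : 1 + e != 0 := lt0r_neq0 f00.
have AmB : A1 - B1 = (1 + e) * (mid_slope e / mid_rate e).
  apply: (mulIf dn).
  have -> : (A1 - B1) * mid_rate e = A1 * (- m + mid_rate e) + B1 * (- m - mid_rate e) + m * (A1 + B1) by ring.
  by rewrite ABd AB1 /mid_slope; field; rewrite dn fn.
have A1E : A1 = (1 + e) * (1 + mid_slope e / mid_rate e) / 2.
  have : 2 * A1 = (A1 + B1) + (A1 - B1) by ring.
  by rewrite AB1 AmB => h; apply: (mulfI (lt0r_neq0 (ltr0n R 2))); rewrite h; field.
have B1E : B1 = (1 + e) * (1 - mid_slope e / mid_rate e) / 2.
  have : 2 * B1 = (A1 + B1) - (A1 - B1) by ring.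
  by rewrite AB1 AmB => h; apply: (mulfI (lt0r_neq0 (ltr0n R 2))); rewrite h; field.
have x1 : expR ((- m + mid_rate e) * (-1 - 0)) = expR m * expR (- mid_rate e) by rewrite -expRD; congr expR; ring.
have x2 : expR ((- m - mid_rate e) * (-1 - 0)) = expR m * expR (mid_rate e) by rewrite -expRD; congr expR; ring.
have FE : fM (-1) = (1 + e) * expR m * mid_value e / 2.
  by rewrite /fM /expsol x1 x2 A1E B1E /mid_value; field.
have DE : fM1 (-1) = - m * fM (-1) + (1 + e) * expR m * mid_deriv e / 2.
  by rewrite FE /fM1 /expsol x1 x2 A1E B1E /mid_value /mid_deriv; field.
have X0 := expR_gt0 m.
have F0 : 0 < fM (-1) by rewrite FE divr_gt0// !mulr_gt0.
have kL : 0 < 4 * e * expR (2 * m) by rewrite mulr_gt0// expR_gt0.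
have gp : 0 < g by lra.
have [|A2 [B2 [A20 B20 AB2 ABd2 ABk2]]] := @ivp R (fM (-1)) (fM1 (-1)) (4 * e * expR (2 * m)) 0 g F0 kL gp.
  rewrite -eG subr0 DE FE /left_rate2 /mid_energy.
  have -> : expR (2 * m) = expR m ^+ 2 by rewrite -expRM_natl mulr_natl.
  by field; rewrite fn (lt0r_neq0 X0) (lt0r_neq0 Pp).
pose fL := expsol A2 (0 + g) B2 (0 - g) (-1).
pose fL1 := expsol (A2 * (0 + g)) (0 + g) (B2 * (0 - g)) (0 - g) (-1).
have sL := @solves_exp R A2 (0 + g) B2 (0 - g) (-1) A20 B20.
exists e, (piecewise (-1) fL (piecewise 0 fM fR)), (piecewise (-1) fL1 (piecewise 0 fM1 fR1)); split=> //.
- have z0 : expR (0 : R) = 1 := expR0 R.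
  have KM t : A1 * B1 * (- m + mid_rate e - (- m - mid_rate e)) ^+ 2 * expR ((- m + mid_rate e + (- m - mid_rate e)) * (t - 0)) =
      4 * e * expR (- 2 * m * t).
    by rewrite -ABk; congr (_ * expR _); ring.
  have KR t : 1 * e * (-1 - 1) ^+ 2 * expR ((-1 + 1) * (t - 0)) = 4 * e.
    have -> : -1 + 1 = 0 :> R by ring.
    by rewrite mul0r z0; ring.
  have KL t : A2 * B2 * (0 + g - (0 - g)) ^+ 2 * expR ((0 + g + (0 - g)) * (t - -1)) = 4 * e * expR (2 * m).
    have -> : 0 + g + (0 - g) = 0 by ring.
    by rewrite mul0r z0 mulr1 -ABk2; congr (_ * _); ring.
  have s1 : solves (fun t => 4 * e * piecewise 0 (fun t => expR (- 2 * m * t)) (fun=> 1) t) (piecewise 0 fM fR) (piecewise 0 fM1 fR1).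
    apply: (solves_ext _ (solves_glue sM sR _ _ _)).
    - by move=> t; rewrite /piecewise; case: ifP => _; rewrite ?KM// KR mulr1.
    - by rewrite /fM /fR /expsol !subrr !mulr0 !z0 !mulr1 AB1.
    - by rewrite /fM1 /fR1 /expsol !subrr !mulr0 !z0 !mulr1 ABd mul1r addrC.
    - by rewrite KM KR mulr0 z0 mulr1.
  apply: (solves_ext _ (solves_glue sL s1 _ _ _)).
  + by move=> t; rewrite /cyl_weight {1 3}/piecewise; case: ifP => _ //; rewrite KL.
  + rewrite /piecewise ifT; last by lra.
    by rewrite /fL /expsol !opprK !addNr !mulr0 !z0 !mulr1 AB2.
  + rewrite /piecewise ifT; last by lra.
    by rewrite /fL1 /expsol !opprK !addNr !mulr0 !z0 !mulr1 ABd2.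
  + rewrite KL /piecewise ifT; last by lra.
    by congr (_ * expR _); ring.
- move=> t t0; rewrite /piecewise ifF; last by apply/negbTE; rewrite -ltNge; lra.
  rewrite ifF; last by apply/negbTE; rewrite -ltNge.
  rewrite ifF; last by apply/negbTE; rewrite -ltNge; lra.
  rewrite ifF; last by apply/negbTE; rewrite -ltNge.
  by rewrite /fR /fR1 /expsol subr0 !mul1r !mulN1r mulr1.
- exists (B2 * expR (- g)), (A2 * expR g); split; rewrite ?mulr_gt0 ?expR_gt0// => t t1.
  rewrite /piecewise !t1 /fL /fL1 /expsol !add0r.
  have y1 : expR (g * (t - -1)) = expR g * expR (g * t) by rewrite -expRD; congr expR; ring.
  have y2 : expR (- g * (t - -1)) = expR (- g) * expR (- (g * t)) by rewrite -expRD; congr expR; ring.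
  by rewrite y1 y2; split; ring.
Qed.

End Shooting.

(** * From the line to zonal functions on the sphere *)

Section LipschitzBound.
Variable R : realType.

Lemma derive_bounded_lipschitz (q q' : R -> R) (P : set R) (C : R) : is_interval P ->
  (forall s : R, P s -> is_derive s 1 q (q' s)) -> (forall s : R, P s -> `|q' s| <= C) ->
  forall a b : R, P a -> P b -> `|q a - q b| <= C * `|a - b|.
Proof.
move=> iP dq bq.
have H a b : P a -> P b -> a <= b -> `|q a - q b| <= C * `|a - b|.
  move=> Pa Pb; rewrite le_eqVlt => /orP[/eqP ->|ab]; first by rewrite !subrr normr0 mulr0.
  have Pab s : s \in `[a, b] -> P s by rewrite in_itv /=; exact: iP Pa Pb _.
  have [|s sab sE] := @MVT R q q' a b ab (fun s h => dq s (Pab s (subset_itv_oo_cc h))).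
    apply: continuous_in_subspaceT => s /[!inE] /= /Pab /dq; exact: isd_cont.
  rewrite distrC sE normrM distrC ler_wpM2r//; apply: bq; apply: Pab.
  exact: subset_itv_oo_cc.
move=> a b Pa Pb; case: (leP a b) => [|/ltW]; first exact: H.
by rewrite distrC [`|a - b|]distrC; exact: H.
Qed.

End LipschitzBound.

Section CylinderCoordinate.
Variable R : realType.
Implicit Types s t : R.

(** The conformal coordinate of the sphere minus the poles: s is the height
    towards the pole that becomes t = - oo. *)
Definition cyl s := (ln (1 - s) - ln (1 + s)) / 2.

Lemma is_derive_cyl s : -1 < s < 1 -> is_derive s 1 cyl (- (1 - s ^+ 2)^-1).
Proof.
move=> /andP[s1 s2]; have m0 : 0 < 1 - s by lra.
have p0 : 0 < 1 + s by lra.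
have d1 : is_derive s 1 (fun s : R => 1 - s) (-1) by apply: isd_eq (isdD (isdC 1 s) (isdN (isdX s))) _; rewrite add0r.
have d2 : is_derive s 1 (fun s : R => 1 + s) 1 by apply: isd_eq (isdD (isdC 1 s) (isdX s)) _; rewrite add0r.
have D1 := @isd_comp R (@ln R) (fun s => 1 - s) s _ _ (is_derive1_ln m0) d1.
have D2 := @isd_comp R (@ln R) (fun s => 1 + s) s _ _ (is_derive1_ln p0) d2.
have D := isdM (isdD D1 (isdN D2)) (isdC 2^-1 s).
apply: isd_eq D _; rewrite mulr0 addr0.
have -> : 1 - s ^+ 2 = (1 - s) * (1 + s) by ring.
by field; rewrite !lt0r_neq0.
Qed.

Lemma expR_cyl s : -1 < s < 1 -> expR (2 * cyl s) = (1 - s) / (1 + s).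
Proof.
move=> /andP[s1 s2]; have -> : 2 * cyl s = ln (1 - s) + - ln (1 + s) by rewrite /cyl; field.
by rewrite expRD expRN !lnK// posrE; lra.
Qed.

End CylinderCoordinate.

Section Profile.
Variable R : realType.
Variables (K f f1 : R -> R) (k a : R).
Hypothesis sf : solves (fun t => k * K t) f f1.
Hypothesis cK : continuous K.
Implicit Types s t : R.

(** Solved for v, the identity e^v (1 - s)^a = 1 / (f^2 (1 - s^2)): the conformal
    factor 1 - s^2 of the cylinder, the conical factor (1 - s)^a, and
    w = - 2 ln f on the cylinder. *)
Definition profile s := - 2 * ln (f (cyl s)) - (1 + a) * ln (1 - s) - ln (1 + s).
Definition slope s := 2 * f1 (cyl s) / f (cyl s) + 2 * s + a * (1 + s).
Definition slope' s := 2 + a - 2 * (k * K (cyl s)) / (f (cyl s) ^+ 2 * (1 - s ^+ 2)).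
Definition profile' s := slope s / (1 - s ^+ 2).
Definition profile'' s := (slope' s + 2 * s * profile' s) / (1 - s ^+ 2).

Let f0 t : 0 < f t. Proof. by have [] := sf t. Qed.

Let one_sub s : -1 < s < 1 -> 0 < 1 - s ^+ 2.
Proof. by move=> /andP[? ?]; rewrite -[1](expr1n _ 2) subr_sqr mulr_gt0 ?expr1n; lra. Qed.

Lemma is_derive_profile s : -1 < s < 1 -> is_derive s 1 profile (profile' s).
Proof.
move=> sb; have /andP[s1 s2] := sb; have m0 : 0 < 1 - s by lra.
have p0 : 0 < 1 + s by lra.
have dt := is_derive_cyl sb; have [_ df _] := sf (cyl s).
have D0 := @isd_comp R (@ln R) (fun s => f (cyl s)) s _ _ (is_derive1_ln (f0 _)) (@isd_comp R f (@cyl R) s _ _ df dt).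
have d1 : is_derive s 1 (fun s : R => 1 - s) (-1) by apply: isd_eq (isdD (isdC 1 s) (isdN (isdX s))) _; rewrite add0r.
have d2 : is_derive s 1 (fun s : R => 1 + s) 1 by apply: isd_eq (isdD (isdC 1 s) (isdX s)) _; rewrite add0r.
have D1 := @isd_comp R (@ln R) (fun s => 1 - s) s _ _ (is_derive1_ln m0) d1.
have D2 := @isd_comp R (@ln R) (fun s => 1 + s) s _ _ (is_derive1_ln p0) d2.
apply: isd_eq (isdD (isdD (isdZ (-2) D0) (isdN (isdZ (1 + a) D1))) (isdN D2)) _.
rewrite /profile' /slope; have fp := f0 (cyl s); move: (f (cyl s)) (f1 (cyl s)) fp => F F1 Fp.
have -> : 1 - s ^+ 2 = (1 - s) * (1 + s) by ring.
by field; rewrite !lt0r_neq0.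
Qed.

Lemma is_derive_slope s : -1 < s < 1 -> is_derive s 1 slope (slope' s).
Proof.
move=> sb; have dt := is_derive_cyl sb; have [_ df df1] := sf (cyl s).
have fn := lt0r_neq0 (f0 (cyl s)).
have D1 := @isd_comp R f1 (@cyl R) s _ _ df1 dt.
have D0 := @isd_comp R f (@cyl R) s _ _ df dt.
have d2 : is_derive s 1 (fun s : R => 1 + s) 1 by apply: isd_eq (isdD (isdC 1 s) (isdX s)) _; rewrite add0r.
apply: isd_eq (isdD (isdD (isdM (isdZ 2 D1) (@isdV R (fun s => f (cyl s)) s _ fn D0)) (isdZ 2 (isdX s))) (isdZ a d2)) _.
rewrite /slope'; have w0 := lt0r_neq0 (one_sub sb).
move: (f (cyl s)) (f1 (cyl s)) (K (cyl s)) fn => F F1 KK Fn.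
by field; rewrite w0 Fn.
Qed.

Let is_derive_w s : is_derive s 1 (fun s => 1 - s ^+ 2) (- 2 * s).
Proof.
apply: isd_eq (isdD (isdC 1 s) (isdN (isdM (isdX s) (isdX s)))) _; ring.
Qed.

Lemma is_derive_profile' s : -1 < s < 1 -> is_derive s 1 profile' (profile'' s).
Proof.
move=> sb; have w0 := lt0r_neq0 (one_sub sb).
apply: isd_eq (isdM (is_derive_slope sb) (@isdV R (fun s => 1 - s ^+ 2) s _ w0 (is_derive_w s))) _.
rewrite /profile'' /profile'; move: (slope s) (slope' s) => S S'; by field.
Qed.

Lemma continuous_profile'' s : -1 < s < 1 -> {for s, continuous profile''}.
Proof.
move=> sb; have w0 := lt0r_neq0 (one_sub sb).
have ct := isd_cont (is_derive_cyl sb).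
have cKt : {for s, continuous (fun s => K (cyl s))} by apply: continuous_comp ct _; exact: cK.
have cf : {for s, continuous (fun s => f (cyl s))}.
  by apply: continuous_comp ct _; have [_ df _] := sf (cyl s); exact: isd_cont df.
have cw : {for s, continuous (fun s : R => 1 - s ^+ 2)} := isd_cont (is_derive_w s).
have cp := isd_cont (is_derive_profile' sb).
have cS : {for s, continuous slope'}.
  apply: (@cvgB _ _ _ _ _ (fun=> 2 + a)); first exact: cvg_cst.
  apply: (@cvgM _ _ _ _ (fun s => 2 * (k * K (cyl s))) (fun s => (f (cyl s) ^+ 2 * (1 - s ^+ 2))^-1)).
    by apply: cvgMl_tmp; apply: cvgMl_tmp; exact: cKt.
  apply: cvgV; first by rewrite mulf_neq0// expf_neq0// lt0r_neq0.
  apply: (@cvgM _ _ _ _ (fun s => f (cyl s) ^+ 2) (fun s => 1 - s ^+ 2)); last exact: cw.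
  by apply: (@cvgM _ _ _ _ (fun s => f (cyl s)) (fun s => f (cyl s))); exact: cf.
apply: (@cvgM _ _ _ _ (fun s => slope' s + 2 * s * profile' s) (fun s => (1 - s ^+ 2)^-1)); last by apply: cvgV.
apply: (@cvgD _ _ _ _ _ slope' (fun s => 2 * s * profile' s)); first exact: cS.
apply: (@cvgM _ _ _ _ (fun s => 2 * s) profile'); last exact: cp.
by apply: cvgMl_tmp; exact: cvg_id.
Qed.

Lemma profile_eq s : -1 < s < 1 ->
  (1 - s ^+ 2) * profile'' s - 2 * s * profile' s =
  2 + a - 2 * k * (K (cyl s) * (expR (a * ln (1 - s)) * expR (profile s))).
Proof.
move=> sb; have w0 := one_sub sb; have /andP[s1 s2] := sb.
have m0 : 0 < 1 - s by lra.
have p0 : 0 < 1 + s by lra.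
have fp := f0 (cyl s).
have -> : expR (a * ln (1 - s)) * expR (profile s) = (f (cyl s) ^+ 2 * (1 - s ^+ 2))^-1.
  rewrite -expRD /profile.
  have -> : a * ln (1 - s) + (- 2 * ln (f (cyl s)) - (1 + a) * ln (1 - s) - ln (1 + s)) =
    - (2 * ln (f (cyl s)) + (ln (1 - s) + ln (1 + s))) by ring.
  rewrite expRN !expRD expRM_natl !lnK ?posrE//; congr (_ * _)^-1; ring.
rewrite /profile'' mulrC divfK ?lt0r_neq0// addrK /slope'.
have fn := lt0r_neq0 fp; have wn := lt0r_neq0 w0.
move: (f (cyl s)) (K (cyl s)) fn => F KK Fn; by field; rewrite wn Fn.
Qed.

End Profile.

(** * Bounds for the zonal profile *)

Section ConicalProfile.
Variable R : realType.
Variable m : R.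
Hypothesis m2 : 2 <= m.
Implicit Types s t a : R.

Lemma cyl_weight_clamp t : cyl_weight m t = expR (2 * m * Num.min 1 (Num.max 0 (- t))).
Proof.
rewrite /cyl_weight /piecewise; case: ifPn => [h|]; last rewrite -ltNge => h.
  by rewrite (@max_idPr _ _ 0 (- t) _) ?(@min_idPl _ _ 1 (- t) _) ?mulr1//; lra.
case: ifPn => [h0|]; last rewrite -ltNge => h0.
  by rewrite (@max_idPr _ _ 0 (- t) _) ?(@min_idPr _ _ 1 (- t) _); [congr expR; ring|lra|lra].
by rewrite (@max_idPl _ _ 0 (- t) _) ?(@min_idPr _ _ 1 0 _) ?mulr0 ?expR0//; lra.
Qed.

Lemma cyl_weight_gt0 t : 0 < cyl_weight m t. Proof. by rewrite cyl_weight_clamp expR_gt0. Qed.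

Lemma cyl_weight_le t : cyl_weight m t <= expR (2 * m).
Proof.
rewrite cyl_weight_clamp ler_expR -[leRHS]mulr1 ler_wpM2l ?ge_min ?lexx//.
by rewrite mulr_ge0//; have := m2; lra.
Qed.

Lemma continuous_cyl_weight : continuous (cyl_weight m).
Proof.
rewrite (funext cyl_weight_clamp) => t; apply: (@continuous_cvg _ _ _ _ _ (fun t => 2 * m * Num.min 1 (Num.max 0 (- t))) expR).
  exact: continuous_expR.
apply: cvgMl_tmp; apply: (@continuous_min _ _ (fun=> 1) (fun t => Num.max 0 (- t))); first exact: cst_continuous.
apply: (@continuous_max _ _ (fun=> 0) (fun t => - t)); first exact: cst_continuous.
by apply: cvgN; exact: cvg_id.
Qed.

(** The exponents of f, 1 at + oo and 1 + a at - oo, are what makes slope vanish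
    at s = -1 and at s = 1 to the order of 1 - s^2. *)
Lemma profile'_bounded (K f f1 : R -> R) (k a g e A B : R) :
  solves (fun t => k * K t) f f1 -> 1 < g -> a = g - 1 -> 0 < e -> 0 < A -> 0 < B ->
  (forall t, 0 < t -> f t = expR (- t) + e * expR t /\ f1 t = - expR (- t) + e * expR t) ->
  (forall t, t <= -1 -> f t = A * expR (- (g * t)) + B * expR (g * t) /\
     f1 t = - (g * A) * expR (- (g * t)) + g * B * expR (g * t)) ->
  exists C, forall s, -1 < s < 1 -> `|profile' f f1 a s| <= C.
Proof.
move=> sf g1 aE e0 A0 B0 hR hL.
have [c hc] : exists c, forall t, t \in `[(-1 : R), 0] -> `|f1 t / f t| <= c.
  have [|t0 t0i ht0] := @EVT_max R (fun t => `|f1 t / f t|) (-1) 0 (lerN10 R).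
    apply: continuous_subspaceT => t; have [f0 df df1] := sf t.
    apply: (@continuous_comp _ _ _ (fun t => f1 t / f t) Num.norm); last exact: norm_continuous.
    apply: (@cvgM _ _ _ _ f1 (fun t => (f t)^-1)); first exact: isd_cont df1.
    by apply: cvgV; [exact: lt0r_neq0|exact: isd_cont df].
  by exists `|f1 t0 / f t0|.
have a0 : 0 < a by lra.
(* one summand for each of 0 < t, t <= -1 and -1 < t <= 0 *)
pose C := (2 + a + 4 / e) + (2 + a + 4 * g * (B / A)) + (2 * c + 2 + 2 * a) * expR 2.
have c0 : 0 <= c by apply: le_trans (normr_ge0 _) (hc 0 _); rewrite in_itv /= lexx lerN10.
have p1 : 0 <= 2 + a + 4 / e by rewrite addr_ge0 ?divr_ge0//; lra.
have q1 : 0 <= B / A by rewrite divr_ge0 ?ltW.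
have p2 : 0 <= 2 + a + 4 * g * (B / A) by rewrite addr_ge0 ?(mulr_ge0 _ q1)//; lra.
have p3 : 0 <= (2 * c + 2 + 2 * a) * expR 2 by rewrite mulr_ge0 ?expR_ge0//; lra.
exists C => s sb; have /andP[s1 s2] := sb.
have m0 : 0 < 1 - s by lra.
have q0 : 0 < 1 + s by lra.
have wE : 1 - s ^+ 2 = (1 - s) * (1 + s) by ring.
have w0 : 0 < 1 - s ^+ 2 by rewrite wE mulr_gt0.
have f0 : 0 < f (cyl s) by have [] := sf (cyl s).
rewrite /profile' normrM normfV (gtr0_norm w0) ler_pdivrMr//.
have E2 := expR_cyl sb; set t := cyl s in f0 E2 *.
case: (ltP 0 t) => [t0|t0].
- have [fE f1E] := hR _ t0.
  have ss : s < 0.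
    have : 1 < expR (2 * t) by rewrite expR_gt1 mulr_gt0.
    by rewrite E2 ltr_pdivlMr//; lra.
  have -> : slope f f1 a s = (2 + a) * (1 + s) - 4 * (expR (- t) / f t).
    by rewrite /slope -/t f1E; move: f0; rewrite fE => /lt0r_neq0 fn; field.
  have h0 : 0 <= expR (- t) / f t by rewrite divr_ge0 ?expR_ge0// ltW.
  have h1 : expR (- t) / f t <= (1 + s) / e.
    have x0 := expR_gt0 t; have y0 := expR_gt0 (- t).
    have -> : 1 + s = (1 - s) * expR (- t) / expR t.
      have : expR (2 * t) = expR t ^+ 2 by rewrite expRM_natl.
      rewrite E2 => h; rewrite expRN -mulrA -expr2 exprVn -h; by field; rewrite !lt0r_neq0.
    have fl : e * expR t <= f t by rewrite fE; lra.
    apply: (@le_trans _ _ (expR (- t) / (e * expR t))).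
      by rewrite (ler_wpM2l (ltW y0))// lef_pV2// posrE// mulr_gt0.
    have -> : (1 - s) * expR (- t) / expR t / e = (1 - s) * (expR (- t) / (e * expR t)).
      by field; rewrite !lt0r_neq0.
    by rewrite ler_peMl ?divr_ge0 ?mulr_ge0 ?ltW//; lra.
  have h2 : `|(2 + a) * (1 + s) - 4 * (expR (- t) / f t)| <= (2 + a + 4 / e) * (1 + s).
    have -> : (2 + a + 4 / e) * (1 + s) = (2 + a) * (1 + s) + 4 * ((1 + s) / e) by ring.
    apply: le_trans (ler_normB _ _) _; rewrite (ger0_norm (mulr_ge0 (ler0n R 4) h0)) ger0_norm; first by lra.
    by rewrite mulr_ge0//; lra.
  apply: (le_trans h2); apply: (@le_trans _ _ ((2 + a + 4 / e) * (1 - s ^+ 2))).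
    by rewrite ler_wpM2l// wE ler_peMl//; lra.
  by rewrite (ler_wpM2r (ltW w0))// /C; lra.
- case: (leP t (-1)) => t1.
  + have [fE f1E] := hL _ t1.
    have ss : 0 < s.
      have : expR (2 * t) < 1 by rewrite expR_lt1; lra.
      by rewrite E2 ltr_pdivrMr//; lra.
    have -> : slope f f1 a s = - ((2 + a) * (1 - s)) + 4 * g * (B * expR (g * t) / f t).
      by rewrite /slope -/t f1E aE; move: f0; rewrite fE => /lt0r_neq0 fn; field.
    have h0 : 0 <= B * expR (g * t) / f t by rewrite divr_ge0 ?mulr_ge0 ?expR_ge0// ltW.
    have h1 : B * expR (g * t) / f t <= B / A * (1 - s).
      have x0 := expR_gt0 (g * t); have y0 := expR_gt0 (- (g * t)).
      have fl : A * expR (- (g * t)) <= f t by rewrite fE; have := mulr_gt0 B0 x0; lra.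
      apply: (@le_trans _ _ (B * expR (g * t) / (A * expR (- (g * t))))).
        by rewrite (ler_wpM2l (ltW (mulr_gt0 B0 x0)))// lef_pV2// posrE// mulr_gt0.
      have -> : B * expR (g * t) / (A * expR (- (g * t))) = B / A * expR (2 * (g * t)).
        have : expR (2 * (g * t)) = expR (g * t) ^+ 2 by rewrite expRM_natl.
        by move=> ->; rewrite expRN; field; rewrite !lt0r_neq0.
      rewrite ler_wpM2l//; apply: (@le_trans _ _ (expR (2 * t))); first by rewrite ler_expR; nra.
      by rewrite E2 ler_pdivrMr// ler_peMr//; lra.
    have h2 : `|- ((2 + a) * (1 - s)) + 4 * g * (B * expR (g * t) / f t)| <= (2 + a + 4 * g * (B / A)) * (1 - s).
      have -> : (2 + a + 4 * g * (B / A)) * (1 - s) = (2 + a) * (1 - s) + 4 * g * (B / A * (1 - s)) by ring.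
      apply: le_trans (ler_normD _ _) _; have g40 : 0 <= 4 * g by lra.
      rewrite normrN (ger0_norm (mulr_ge0 g40 h0)) ger0_norm; last by rewrite mulr_ge0//; lra.
      by apply: lerD => //; rewrite ler_wpM2l.
    apply: (le_trans h2); apply: (@le_trans _ _ ((2 + a + 4 * g * (B / A)) * (1 - s ^+ 2))).
      by rewrite ler_wpM2l// wE ler_peMr//; lra.
    by rewrite (ler_wpM2r (ltW w0))// /C; lra.
  + have h := hc t; rewrite in_itv /= (ltW t1) t0 in h; have {}h := h isT.
    have ss : 0 <= s.
      have : expR (2 * t) <= 1 by rewrite expR_le1; lra.
      by rewrite E2 ler_pdivrMr//; lra.
    have w1 : 1 <= expR 2 * (1 - s ^+ 2).
      have h1 : expR (- 2) <= expR (2 * t) by rewrite ler_expR; lra.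
      have h2 : (1 - s) / (1 + s) <= 1 - s ^+ 2.
        by rewrite wE (ler_wpM2l (ltW m0))//; apply: (@le_trans _ _ 1); [rewrite invf_le1//|]; lra.
      rewrite -(ler_pM2l (expR_gt0 (-2))) mulr1 mulrA -expRD addNr expR0 mul1r.
      by apply: le_trans h1 _; rewrite E2; apply: le_trans h2 _.
    have h2 : `|slope f f1 a s| <= 2 * c + 2 + 2 * a.
      rewrite /slope -/t -mulrA; apply: le_trans (ler_normD _ _) _.
      have as0 : 0 <= a * (1 + s) by rewrite mulr_ge0//; lra.
      apply: lerD; last by rewrite (ger0_norm as0); nra.
      apply: le_trans (ler_normD _ _) _; rewrite normrM (ger0_norm (ler0n R 2)).
      have s20 : 0 <= 2 * s by lra.
      by rewrite (ger0_norm s20); lra.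
    have c20 : 0 <= 2 * c + 2 + 2 * a by lra.
    apply: (le_trans h2); apply: (@le_trans _ _ ((2 * c + 2 + 2 * a) * expR 2 * (1 - s ^+ 2))).
      by rewrite -mulrA ler_peMr.
    by rewrite (ler_wpM2r (ltW w0))// /C; lra.
Qed.

End ConicalProfile.

Section Solution.
Variable R : realType.
Implicit Types s t a : R.

Let I : set R := `]-1, 1[.

Lemma continuous_restrict_measurable (q : R -> R) :
  (forall s, -1 < s < 1 -> {for s, continuous q}) -> measurable_fun setT (q \_ I).
Proof.
move=> cq; apply/(measurable_restrictT _ (measurable_itv _)).
apply: open_continuous_measurable_fun; first exact: interval_open.
by move=> s; rewrite inE /I /= in_itv; exact: cq.
Qed.

Lemma restrictE (q : R -> R) s : -1 < s < 1 -> (q \_ I) s = q s.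
Proof. by move=> sb; rewrite patchE mem_set// /I /= in_itv. Qed.

Lemma restrict0 (q : R -> R) s : ~~ (-1 < s < 1) -> (q \_ I) s = 0.
Proof.
move=> sb; rewrite patchE memNset// => Is; move: sb.
by rewrite /I /= in_itv /= in Is; rewrite Is.
Qed.

Lemma near_restrict (q : R -> R) s : -1 < s < 1 -> \forall t \near s, q t = (q \_ I) t.
Proof.
move=> /andP[s1 s2]; apply: filterS2 (near_gt s1) (near_lt s2) => t t1 t2.
by rewrite restrictE// t1 t2.
Qed.

Lemma is_derive_restrict (q q' : R -> R) s : -1 < s < 1 -> is_derive s 1 q (q' s) ->
  is_derive s 1 (q \_ I) ((q' \_ I) s).
Proof.
move=> sb dq; rewrite restrictE//; apply: (@near_eq_is_derive _ _ _ q) dq.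
by apply: filterS (near_restrict q sb) => t ->.
Qed.

Lemma continuous_near_restrict (q : R -> R) s : -1 < s < 1 -> {for s, continuous q} ->
  {for s, continuous (q \_ I)}.
Proof.
move=> sb cq; apply: cvg_trans (_ : q t @[t --> s] --> (q \_ I) s); last by rewrite restrictE.
by apply: near_eq_cvg; exact: near_restrict.
Qed.

(** The functions are cut off to 0 outside ]-1, 1[, which makes them measurable
    on the line. *)
Lemma zonal_solution (m a : R) : 2 <= m -> 0 < a -> 1 + a < m ->
  exists (k : R) (w w1 w2 : R -> R) (C : R), [/\ 0 < k,
    [/\ measurable_fun setT w, measurable_fun setT w1 & measurable_fun setT w2],
    (forall s : R, -1 < s < 1 -> [/\ is_derive s 1 w (w1 s), is_derive s 1 w1 (w2 s) & {for s, continuous w2}]),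
    (forall s, [/\ `|w s| <= C, `|w1 s| <= C & (1 - s ^+ 2) * `|w2 s| <= C]) &
    (forall s, -1 < s < 1 -> (1 - s ^+ 2) * w2 s - 2 * s * w1 s =
       2 + a - k * (cyl_weight m (cyl s) * (expR (a * ln (1 - s)) * expR (w s))))].
Proof.
move=> m2 a0 am; have [|e [f [f1 [e0 sf hR [A [B [A0 B0 hL]]]]]]] := conical_family m2 (g := 1 + a).
  by apply/andP; split; lra.
have cK := @continuous_cyl_weight R m.
have d1 := is_derive_profile a sf; have d2 := is_derive_profile' a sf; have c2 := @continuous_profile'' R (cyl_weight m) f f1 (4 * e) a sf cK.
have [||C1 b1] := @profile'_bounded R (cyl_weight m) f f1 (4 * e) a (1 + a) e A B sf _ _ e0 A0 B0 hR hL; [lra|ring|].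
set w := profile f a in d1 *; set w1 := profile' f f1 a in d1 d2 b1 *.
set w2 := profile'' (cyl_weight m) f f1 (4 * e) a in d2 c2 *.
have E := profile_eq a sf; rewrite -/w -/w1 -/w2 in E.
have C10 : 0 <= C1 by apply: le_trans (normr_ge0 _) (b1 0 _); apply/andP; split; lra.
pose C0 := `|w 0| + C1.
have b0 s : -1 < s < 1 -> `|w s| <= C0.
  move=> sb; have iI : is_interval [set s : R | -1 < s < 1].
    move=> x y /= /andP[x1 x2] /andP[y1 y2] z /andP[z1 z2]; apply/andP; split; lra.
  have /= H := @derive_bounded_lipschitz R w w1 _ C1 iI d1 b1 s 0 sb.
  have {}H : `|w s - w 0| <= C1 * `|s - 0| by apply: H; apply/andP; split; lra.
  have s1 : `|s| <= 1 by rewrite ler_norml; move: sb => /andP[? ?]; apply/andP; split; lra.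
  rewrite -(subrK (w 0) (w s)) addrC; apply: le_trans (ler_normD _ _) _; rewrite lerD2l.
  by apply: le_trans H _; rewrite subr0 -[leRHS]mulr1 ler_wpM2l.
pose C2 := 2 + a + 2 * (4 * e) * (expR (2 * m) * (expR (a * ln 2) * expR C0)) + 2 * C1.
have b2 s : -1 < s < 1 -> (1 - s ^+ 2) * `|w2 s| <= C2.
  move=> sb; have /andP[s1 s2] := sb.
  have q0 : 0 <= 1 - s ^+ 2 by nra.
  have -> : (1 - s ^+ 2) * `|w2 s| = `|(2 + a - 2 * (4 * e) * (cyl_weight m (cyl s) * (expR (a * ln (1 - s)) * expR (w s)))) + 2 * s * w1 s|.
    by rewrite -E// subrK [RHS]normrM (ger0_norm q0).
  apply: le_trans (ler_normD _ _) _; apply: lerD; last first.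
    rewrite -mulrA normrM (ger0_norm (ler0n R 2)) ler_pM2l// normrM.
    have ns : `|s| <= 1 by rewrite ler_norml; apply/andP; split; lra.
    by rewrite -[leRHS]mul1r; apply: ler_pM => //; exact: b1.
  apply: le_trans (ler_normB _ _) _; apply: lerD; first by rewrite ger0_norm//; lra.
  have k0 := cyl_weight_gt0 m (cyl s).
  rewrite ger0_norm; last by rewrite !mulr_ge0 ?expR_ge0// ltW.
  apply: ler_wpM2l; first by rewrite !mulr_ge0// ltW.
  apply: ler_pM; [exact: ltW|by rewrite mulr_ge0 ?expR_ge0|exact: cyl_weight_le|].
  apply: ler_pM; rewrite ?expR_ge0// ler_expR.
    by rewrite ler_pM2l// ler_ln ?posrE; lra.
  by apply: le_trans (ler_norm _) _; exact: b0.
have C00 : 0 <= C0 by rewrite addr_ge0.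
have C20 : 0 <= C2.
  rewrite !addr_ge0 ?mulr_ge0 ?expR_ge0//; by rewrite ltW.
exists (2 * (4 * e)), (w \_ I), (w1 \_ I), (w2 \_ I), (C0 + C1 + C2); split.
- by rewrite !mulr_gt0.
- split; apply: continuous_restrict_measurable => // s sb.
    exact: isd_cont (d1 s sb).
  exact: isd_cont (d2 s sb).
- move=> s sb; split; [|exact: is_derive_restrict (d2 s sb)|exact: continuous_near_restrict (c2 s sb)].
  exact: is_derive_restrict (d1 s sb).
- move=> s; have [sb|sb] := boolP (-1 < s < 1); last first.
    by rewrite !restrict0// normr0 mulr0; split; lra.
  rewrite !restrictE//; split.
  + by apply: le_trans (b0 s sb) _; lra.
  + by apply: le_trans (b1 s sb) _; lra.
  + by apply: le_trans (b2 s sb) _; lra.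
- by move=> s sb; rewrite !restrictE// E.
Qed.

End Solution.

(** * The curvature function on the sphere *)

Section Weight.
Variable R : realType.
Local Notation E3 := 'rV[R]_3.
Implicit Types (s m : R) (x p : E3).

(** The height s with cyl s = -1. *)
Definition cyl_m1 : R := (1 - expR (-2)) / (1 + expR (-2)).

(** Clamping the height keeps cyl away from the poles, where ln is taken at 0. *)
Definition zonal_weight (m : R) p x : R :=
  expR (- 2 * m * cyl (Num.min cyl_m1 (Num.max 0 (dot x p)))).

Lemma cyl_m1_in : 0 < cyl_m1 < 1.
Proof.
have e0 := expR_gt0 (- 2 : R); have e1 : expR (- 2 : R) < 1 by rewrite expR_lt1; lra.
rewrite /cyl_m1 ltr_pdivrMr ?divr_gt0; lra.
Qed.

Lemma zonal_weight_gt0 m p x : 0 < zonal_weight m p x.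
Proof. exact: expR_gt0. Qed.

Lemma zonal_weightE m p x : 2 <= m -> -1 < dot x p < 1 -> zonal_weight m p x = cyl_weight m (cyl (dot x p)).
Proof.
move=> m2; rewrite cyl_weight_clamp /zonal_weight; move: (dot x p) => s sb.
have /andP[c0 c1] := cyl_m1_in; have cb : -1 < cyl_m1 < 1 by rewrite c1 andbT; lra.
have cE : cyl cyl_m1 = -1.
  apply: (mulfI (lt0r_neq0 (ltr0n R 2))); apply: expR_inj; rewrite expR_cyl// mulrN1.
  have e0 := expR_gt0 (- 2 : R); rewrite /cyl_m1; move: (expR (-2)) e0 => e e0; field.
  by rewrite !lt0r_neq0//; lra.
have cyl0 : cyl 0 = 0 :> R by rewrite /cyl subr0 addr0 subrr mul0r.
have mono (u v : R) : -1 < u < 1 -> -1 < v < 1 -> u <= v -> cyl v <= cyl u.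
  move=> /andP[u1 u2] /andP[v1 v2] uv; rewrite /cyl ler_pM2r// lerB// ler_ln ?posrE; lra.
have zb : -1 < (0 : R) < 1 by apply/andP; split; lra.
congr expR; case: (boolP (s <= 0)) => [s0|].
  have h := mono _ _ sb zb s0; rewrite cyl0 in h.
  rewrite (@max_idPl _ _ 0 s _)// (@min_idPr _ _ cyl_m1 0 _) ?ltW// cyl0.
  by rewrite (@max_idPl _ _ 0 (- cyl s) _) ?(@min_idPr _ _ 1 0 _) ?mulr0//; lra.
rewrite -ltNge => s0; have h := mono _ _ zb sb (ltW s0); rewrite cyl0 in h.
rewrite (@max_idPr _ _ 0 s _) ?ltW// (@max_idPr _ _ 0 (- cyl s) _) ?oppr_ge0//.
case: (boolP (cyl_m1 <= s)) => [sc|].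
  have h1 := mono _ _ cb sb sc; rewrite cE in h1.
  have h2 : 1 <= - cyl s by lra.
  rewrite (@min_idPl _ _ 1 (- cyl s) h2) (@min_idPl _ _ cyl_m1 s sc).
  by rewrite cE; ring.
rewrite -ltNge => sc; have h1 := mono _ _ sb cb (ltW sc); rewrite cE in h1.
have h2 : - cyl s <= 1 by lra.
rewrite (@min_idPr _ _ 1 (- cyl s) h2) (@min_idPr _ _ cyl_m1 s (ltW sc)).
by ring.
Qed.

Lemma zonal_weight_lipschitz m p : 0 <= m -> lipschitz_S2 (zonal_weight m p).
Proof.
move=> m0; have /andP[c0 c1] := cyl_m1_in.
pose q s := expR (- 2 * m * cyl s); pose q' s := q s * (2 * m / (1 - s ^+ 2)).
pose P : set R := [set s | 0 <= s <= cyl_m1].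
have Pb s : P s -> -1 < s < 1 by move=> /andP[? ?]; apply/andP; split; lra.
have iP : is_interval P.
  by move=> x y /= /andP[x1 x2] /andP[y1 y2] z /andP[z1 z2]; apply/andP; split; lra.
have dq s : P s -> is_derive s 1 q (q' s).
  move=> /Pb sb; have D := isdZ (- 2 * m) (is_derive_cyl sb).
  apply: isd_eq (@isd_comp R (@expR R) (fun s => - 2 * m * cyl s) s _ _ (is_derive_expR _) D) _.
  by rewrite /q' /q; ring.
have [C hC] : exists C, forall s, P s -> `|q' s| <= C.
  have cq : {within `[0, cyl_m1], continuous (fun s => `|q' s|)}.
    apply: continuous_in_subspaceT => s; rewrite inE /= in_itv /= => Ps.
    apply: (@continuous_comp _ _ _ q' Num.norm); last exact: norm_continuous.
    apply: (@cvgM _ _ _ _ q (fun s => 2 * m / (1 - s ^+ 2))); first exact: isd_cont (dq s Ps).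
    apply: cvgMl_tmp; apply: cvgV.
      by have /andP[? ?] := Pb s Ps; rewrite lt0r_neq0//; nra.
    apply: cvgB; first exact: cvg_cst.
    by apply: (@cvgM _ _ _ _ (fun s => s) (fun s => s)); exact: cvg_id.
  have [s0 s0i hs0] := EVT_max (ltW c0) cq.
  by exists `|q' s0| => s Ps; apply: hs0; rewrite in_itv.
have C0 : 0 <= C by apply: le_trans (normr_ge0 _) (hC 0 _); rewrite /P /= lexx ltW.
exists (C * \sum_(i < 3) `|p 0 i|) => -[x y] /= [Sx Sy].
have cl s : P (Num.min cyl_m1 (Num.max 0 s)).
  by rewrite /P /= le_min le_max lexx (ltW c0)/= ge_min lexx.
apply: le_trans (derive_bounded_lipschitz iP dq hC (cl _) (cl _)) _.
rewrite -mulrA ler_wpM2l//.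
apply: (@le_trans _ _ `|dot x p - dot y p|).
  move: (dot x p) (dot y p) => s t; rewrite /Num.min /Num.max.
  by repeat case: ifPn; rewrite -?leNgt => *; rewrite ?subrr ?normr0//; rewrite ler_norml; apply/andP; split;
    case: (ger0P (s - t)) => ?; lra.
rewrite /dot -sumrB; apply: le_trans (ler_norm_sum _ _ _) _.
rewrite mulr_suml; apply: ler_sum => i _.
rewrite -mulrBl normrM mulrC ler_wpM2l//.
have -> : x 0 i - y 0 i = (x - y) 0 i by rewrite !mxE.
rewrite [leRHS]/Num.Def.normr/= mx_normrE.
exact: (le_bigmax _ (fun ij => `|(x - y) ij.1 ij.2|) (0, i)).
Qed.

End Weight.

(** * The weak solution *)

Section Assembly.
Variable R : realType.
Local Notation E3 := 'rV[R]_3.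
Local Notation D := (@sph_dom R).
Implicit Types (u f g : E3 -> R) (x y p : E3) (z : R * R).

(** A density of class L^1 need not be measurable by itself at the poles. *)
(** Integrability constrains only the density f sin theta; dividing it by
    sin theta, written with exp and ln, recovers a measurable f off the poles. *)
Lemma measurable_density_div f : measurable_fun D (fun z => f (sph z) * sin z.1) ->
  measurable_fun D (fun z => f (sph z) * sin z.1 * expR (- ln (sin z.1))).
Proof.
move=> mf; apply: measurable_funM => //; apply: (measurableT_comp (@measurable_expR R)).
by apply: measurableT_comp => //; apply: (measurableT_comp (@measurable_ln R)); exact: measurable_sin1.
Qed.

Lemma density_div f z : D z -> sin z.1 != 0 ->
  f (sph z) * sin z.1 * expR (- ln (sin z.1)) = f (sph z).
Proof.
move=> Dz s0; have sp : 0 < sin z.1 by rewrite lt_neqAle eq_sym s0 D_sin.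
by rewrite expRN lnK// mulfK.
Qed.

Lemma K_tilde1 (G : E3 -> E3 -> R) f_g K p (a : R) x :
  K_tilde G f_g K (fun _ : 'I_1 => p) (fun _ : 'I_1 => a) x =
  K x * expR (f_g x - 4 * pi * (a * G x p)).
Proof. by rewrite /K_tilde big_ord1. Qed.

Lemma rho_geo1 (a : R) : rho_geo (fun _ : 'I_1 => a) = 4 * pi * (2 + a).
Proof. by rewrite /rho_geo big_ord1. Qed.

Lemma s_ae_eq_trans f g h : s_ae_eq f g -> s_ae_eq g h -> s_ae_eq f h.
Proof. by move=> fg gh; apply: ae_D_sub (ae_D_and fg gh) => z _ [-> ->]. Qed.

Section Nonlinearity.
Variables (G : E3 -> E3 -> R) (f_g K : E3 -> R) (p : E3) (a : R) (v : E3 -> R).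
Hypothesis hG : green_function G.
Hypothesis hf : is_f_g f_g.
Hypothesis Sp : S2 p.
Hypothesis mK : s_measurable K.
Hypothesis mv : s_measurable v.

Let F x := K_tilde G f_g K (fun _ : 'I_1 => p) (fun _ : 'I_1 => a) x * expR (v x).

Lemma nonlinearity_measurable : measurable_fun D (fun z => F (sph z) * sin z.1).
Proof.
have [iG _ _] := hG Sp; have [sf _ _] := hf.
have mG := measurable_density_div (s_integrable_meas iG).
have mf := s_smooth_measurable sf.
apply: (@eq_measurable_fun _ _ _ _ D (fun z => K (sph z) * expR (f_g (sph z) - 4 * pi *
  (a * (G (sph z) p * sin z.1 * expR (- ln (sin z.1))))) * expR (v (sph z)) * sin z.1)).
- move=> z; rewrite inE => Dz; have [s0|s0] := eqVneq (sin z.1) 0; first by rewrite s0 !mulr0.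
  by rewrite /F K_tilde1 (@density_div (G^~ p)).
- apply: measurable_funM; last exact: measurable_sin1.
  apply: measurable_funM; last by apply: (measurableT_comp (@measurable_expR R)).
  apply: measurable_funM => //; apply: (measurableT_comp (@measurable_expR R)).
  apply: measurable_funB => //; apply: measurable_funM; first exact: measurable_cst.
  by apply: measurable_funM; first exact: measurable_cst.
Qed.

(** f_g is constant, and - 4 pi a G(., p) is a ln (1 - dot x p) plus a constant. *)
Lemma nonlinearity_ae : exists2 c : R, 0 < c &
  s_ae_eq F (fun x => c * (K x * (expR (a * ln (1 - dot x p)) * expR (v x)))).
Proof.
have [cG Gc] := green_ae hG Sp; have [cf fc] := f_g_ae hf.
exists (expR (cf - 4 * pi * (a * cG))); first exact: expR_gt0.
apply: ae_D_sub (ae_D_and Gc fc) => z Dz [HG Hf].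
have [s0|s0] := eqVneq (sin z.1) 0; first by rewrite s0 !mulr0.
have Ef : f_g (sph z) = cf by exact: mulIf s0 _ _ Hf.
have EG : G (sph z) p = logk p (sph z) / (4 * pi) + cG by exact: mulIf s0 _ _ HG.
congr (_ * _); rewrite /F K_tilde1 Ef EG.
move: (K _) (v _) => k w; rewrite /logk; move: (ln _) => l.
have pi4 : pi != 0 :> R := lt0r_neq0 (pi_gt0 R).
have -> : cf - 4 * pi * (a * (- l / (4 * pi) + cG)) = cf - 4 * pi * (a * cG) + a * l.
  by move: (pi : R) pi4 => P P0; field.
by rewrite expRD; ring.
Qed.

End Nonlinearity.

Lemma zonal_weight_measurable (m : R) p : s_measurable (zonal_weight m p).
Proof.
apply: (@s_measurable_zonal _ (fun s => expR (- 2 * m * cyl (Num.min (cyl_m1 R) (Num.max 0 s))))).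
have mc : measurable_fun setT (@cyl R).
  apply: measurable_funM; last exact: measurable_cst.
  by apply: measurable_funB; apply: (measurableT_comp (@measurable_ln R));
    [apply: measurable_funB|apply: measurable_funD]; exact: measurable_cst || exact: measurable_id.
apply: (measurableT_comp (@measurable_expR R)); apply: measurable_funM; first exact: measurable_cst.
apply: (measurableT_comp mc); apply: measurable_minr; first exact: measurable_cst.
by apply: measurable_maxr; [exact: measurable_cst|exact: measurable_id].
Qed.

Section WeakSolution.
Variables (w w1 w2 : R -> R) (C : R) (p : E3).
Hypothesis Sp : S2 p.
Hypothesis mw : measurable_fun setT w.
Hypothesis mw1 : measurable_fun setT w1.
Hypothesis mw2 : measurable_fun setT w2.
Hypothesis dw : forall s : R, -1 < s < 1 -> is_derive s 1 w (w1 s).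
Hypothesis dw1 : forall s : R, -1 < s < 1 -> is_derive s 1 w1 (w2 s).
Hypothesis cw2 : forall s : R, -1 < s < 1 -> {for s, continuous w2}.
Hypothesis bw : forall s : R, `|w s| <= C.
Hypothesis bw1 : forall s : R, `|w1 s| <= C.
Hypothesis bw2 : forall s : R, (1 - s ^+ 2) * `|w2 s| <= C.

Let C0 : 0 <= C. Proof. exact: le_trans (normr_ge0 _) (bw 0). Qed.

Definition zonal_gradient x : E3 := w1 (dot x p) *: (p - dot x p *: x).

Definition zonal_laplace x : R := (1 - dot x p ^+ 2) * w2 (dot x p) - 2 * dot x p * w1 (dot x p).

Lemma dot_zonal_gradient x y : dot (zonal_gradient x) y = w1 (dot x p) * (dot p y - dot x p * dot x y).
Proof.
rewrite /zonal_gradient dotZl; congr (_ * _); move: (dot x p) => s.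
by rewrite !dotE !mxE; ring.
Qed.

Lemma zonal_H1 : H1_with_grad (fun x => w (dot x p)) zonal_gradient.
Proof.
have mp : s_measurable (fun x => dot x p).
  by apply: continuous_s_measurable => x _; exact: continuous_dotr.
split.
- split; first exact: s_measurable_zonal.
  apply: (@s_bounded_integrable _ _ (C ^+ 2)).
    by apply: measurable_funX; exact: s_measurable_zonal.
  by move=> x _; rewrite normrX ler_pXn2r// nnegrE.
- by move=> x Sx; rewrite dot_zonal_gradient (S2_dot Sx) mulr1 (dotC x p) subrr mulr0.
- move=> i; have ct : forall x, S2 x -> {for x, continuous (fun x : E3 => p 0 i - dot x p * x 0 i)}.
    move=> x _; apply: (@continuousB _ _ _ (fun=> p 0 i) (fun x : E3 => dot x p * x 0 i)); first exact: cst_continuous.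
    apply: (@continuousM _ _ (fun x : E3 => dot x p) (fun x : E3 => x 0 i)); first exact: continuous_dotr.
    exact: coord_continuous.
  have [C1 HC1] := sphere_bounded ct.
  have mW : s_measurable (fun x => zonal_gradient x 0 i).
    apply: (@eq_s_measurable _ (fun x => w1 (dot x p) * (p 0 i - dot x p * x 0 i))).
      by move=> x _; rewrite !mxE.
    apply: s_measurableM; first exact: s_measurable_zonal.
    exact: continuous_s_measurable.
  split=> //; apply: (@s_bounded_integrable _ _ ((C * C1) ^+ 2)).
    by apply: measurable_funX.
  have C10 : 0 <= C1 := le_trans (normr_ge0 _) (HC1 p Sp).
  move=> x Sx; rewrite normrX ler_pXn2r ?nnegrE ?mulr_ge0// !mxE normrM.
  by apply: ler_pM => //; exact: HC1.
- move=> X sX; have [tX _] := sX.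
  rewrite (zonal_singular_ibp Sp dw (fun s sb => isd_cont (dw1 sb)) mw mw1 (fun s _ => bw s) sX (fun s _ => bw1 s)).
  rewrite opprK; apply: eq_s_int => x Sx.
  by rewrite dot_zonal_gradient (dotC x (X x)) tX// mulr0 subr0.
Qed.

Lemma zonal_weak_laplace u : s_smooth u ->
  s_int (fun x => dot (zonal_gradient x) (s_grad u x)) = - s_int (fun x => zonal_laplace x * u x).
Proof.
move=> su; have [tu _] := smooth_field_grad su.
have H := zonal_singular_green Sp dw1 cw2 mw1 mw2 (fun s _ => bw1 s) su (fun s _ => bw2 s).
refine (eq_trans _ H); apply: eq_s_int => x Sx.
by rewrite dot_zonal_gradient (dotC x (s_grad u x)) tu// mulr0 subr0.
Qed.

Lemma zonal_laplace_measurable : s_measurable zonal_laplace.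
Proof.
apply: (@s_measurable_zonal _ (fun s => (1 - s ^+ 2) * w2 s - 2 * s * w1 s)).
apply: measurable_funB; apply: measurable_funM => //.
by apply: measurable_funB; [exact: measurable_cst|apply: measurable_funX; exact: measurable_id].
Qed.

Lemma zonal_laplace_bounded x : S2 x -> `|zonal_laplace x| <= C + 2 * C.
Proof.
move=> Sx; have /andP[d1 d2] := dot_S2_le1 Sx Sp; rewrite /zonal_laplace; move: (dot x p) d1 d2 => s s1 s2.
apply: le_trans (ler_normB _ _) _; apply: lerD.
  rewrite normrM ger0_norm//; have -> : 1 - s ^+ 2 = (1 - s) * (1 + s) by ring.
  by rewrite mulr_ge0//; lra.
rewrite -mulrA normrM ger0_norm// ler_pM2l// normrM -[leRHS]mul1r.
by apply: ler_pM => //; rewrite ler_norml s1 s2.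
Qed.

Variables (G : E3 -> E3 -> R) (f_g K : E3 -> R) (a k : R).
Hypothesis hG : green_function G.
Hypothesis hf : is_f_g f_g.
Hypothesis mK : s_measurable K.
Hypothesis k0 : 0 < k.
Hypothesis a0 : 0 < a.
Hypothesis eqK : forall x, -1 < dot x p < 1 ->
  zonal_laplace x = 2 + a - k * (K x * (expR (a * ln (1 - dot x p)) * expR (w (dot x p)))).

(** Testing the equation with 1 computes the integral of the nonlinearity, which
    turns the factor k into rho over that integral. *)
Lemma zonal_weak_solution :
  weak_solution G f_g K (fun _ : 'I_1 => p) (fun _ : 'I_1 => a) (rho_geo (fun _ : 'I_1 => a))
    (fun x => w (dot x p)).
Proof.
pose E x := k^-1 * (2 + a + -1 * zonal_laplace x).
have mv := s_measurable_zonal p mw.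
rewrite /weak_solution; set F := fun x => _.
have mF : measurable_fun D (fun z => F (sph z) * sin z.1) := nonlinearity_measurable a hG hf Sp mK mv.
have [c c0 Fc] := nonlinearity_ae K a (fun x => w (dot x p)) hG hf Sp.
have FE : s_ae_eq F (fun x => c * E x).
  apply: s_ae_eq_trans Fc _; apply: (ae_off_poles Sp) => z Dz zb; congr (_ * _); congr (_ * _).
  by rewrite /E eqK//; field; exact: lt0r_neq0.
have iL : s_integrable zonal_laplace.
  exact: s_bounded_integrable zonal_laplace_measurable zonal_laplace_bounded.
have i2 : s_integrable (fun=> 2 + a).
  by apply: (@s_bounded_integrable _ _ `|2 + a|) => //; exact: s_measurable_cst.
have iE1 : s_integrable (fun x => 2 + a + -1 * zonal_laplace x).
  by apply: s_integrableD => //; exact: s_integrableZ.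
have iE : s_integrable E by exact: s_integrableZ.
have pi0 := pi_gt0 R.
have IL : s_int zonal_laplace = 0.
  have := zonal_weak_laplace (@s_smooth1 R).
  rewrite (@eq_s_int _ _ (fun=> 0 * 1)); last first.
    by move=> x _; rewrite s_grad1 dotE !mxE; ring.
  rewrite (s_intZ 0 (@s_integrable1 R)) mul0r => /esym/eqP; rewrite oppr_eq0 => /eqP H.
  by rewrite -[RHS]H; apply: eq_s_int => x _; rewrite mulr1.
have IE : s_int E = k^-1 * ((2 + a) * (4 * pi)).
  rewrite (s_intZ _ iE1) (s_intD i2 (s_integrableZ _ iL)) (s_intZ _ iL) IL mulr0 addr0; congr (_ * _).
  rewrite -s_areaE -(s_intZ _ (@s_integrable1 R)).
  by apply: eq_s_int => x _; rewrite mulr1.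
have icE : s_integrable (fun x => c * E x) by exact: s_integrableZ.
have IF : s_int F = c * (k^-1 * ((2 + a) * (4 * pi))).
  by rewrite (s_ae_eq_int mF (s_integrable_meas icE) FE) (s_intZ _ iE) IE.
have a2 : 0 < 2 + a by rewrite addr_gt0.
have IF0 : 0 < s_int F by rewrite IF !mulr_gt0 ?invr_gt0.
split=> //; first exact: s_ae_eq_integrable mF icE FE.
exists zonal_gradient; first exact: zonal_H1.
move=> u su; rewrite zonal_weak_laplace// rho_geo1.
have [B hB] := sphere_bounded (fun x => @s_smooth_continuous _ u x su).
have mu := s_smooth_measurable su.
have iLu : s_integrable (fun x => zonal_laplace x * u x).
  apply: (@s_integrableMb _ _ _ B) => // x Sx; by rewrite -(radial_S2 u Sx); exact: hB.
have ci := s_integrableZ (- (4 * pi * (2 + a))^-1) iLu.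
rewrite (@s_ae_eq_int _ (fun x => (F x / s_int F - (s_area R)^-1) * u x) (fun x => - (4 * pi * (2 + a))^-1 * (zonal_laplace x * u x))).
- rewrite (s_intZ _ iLu) mulrA mulrN mulfV ?mulN1r//.
  by rewrite lt0r_neq0// !mulr_gt0.
- rewrite (_ : (fun z => _) = (fun z => ((F (sph z) * sin z.1) / s_int F - (s_area R)^-1 * sin z.1) * u (sph z))); last by apply/funext => z; ring.
  apply: measurable_funM => //; apply: measurable_funB.
    by apply: measurable_funM => //; exact: measurable_cst.
  by apply: measurable_funM; [exact: measurable_cst|exact: measurable_sin1].
- exact: s_integrable_meas ci.
- apply: ae_D_sub FE => z Dz H; have [s0|s0] := eqVneq (sin z.1) 0; first by rewrite s0 !mulr0.
  congr (_ * _); have {}H : F (sph z) = c * E (sph z) by apply: (mulIf s0).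
  rewrite mulrA; congr (_ * _); rewrite H IF s_areaE /E.
  move: (pi : R) pi0 (zonal_laplace _) => P P0 L.
  by field; rewrite !lt0r_neq0//; lra.
Qed.

End WeakSolution.

Lemma conical_sphere_solution G f_g p (m a : R) : green_function G -> is_f_g f_g -> S2 p ->
  2 <= m -> 0 < a -> 1 + a < m ->
  exists v, weak_solution G f_g (zonal_weight m p) (fun _ : 'I_1 => p) (fun _ : 'I_1 => a)
    (rho_geo (fun _ : 'I_1 => a)) v.
Proof.
move=> hG hf Sp m2 a0 am.
have [k [w [w1 [w2 [C [k0 [mw mw1 mw2] dw bw eqw]]]]]] := zonal_solution m2 a0 am.
exists (fun x => w (dot x p)).
apply: (@zonal_weak_solution w w1 w2 C p Sp mw mw1 mw2 _ _ _ _ _ _ G f_g (zonal_weight m p) a k) => //.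
- by move=> s /dw[].
- by move=> s /dw[].
- by move=> s /dw[].
- by move=> s; have [] := bw s.
- by move=> s; have [] := bw s.
- by move=> s; have [] := bw s.
- exact: zonal_weight_measurable.
- by move=> x xb; rewrite /zonal_laplace eqw// zonal_weightE.
Qed.

End Assembly.

Unset Implicit Arguments.

Theorem theorem1p9 (R : realType)
  (G : 'rV[R]_3 -> 'rV[R]_3 -> R) (hG : green_function G)
  (f_g : 'rV[R]_3 -> R) (hf : is_f_g f_g)
  (p1 : 'rV[R]_3) (hp1 : S2 p1) :
  (forall N : nat, (1 <= N)%N ->
    exists2 C : set ('rV[R]_3 -> R), C !=set0 &
      forall K, C K ->
        [/\ lipschitz_S2 K, positive_S2 K &
            exists2 delta : R, 0 < delta &
              forall eps : R, 0 < eps < delta ->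
                let alpha1 := 2 * (N%:R - 1) + eps / (4 * pi) in
                let p := fun _ : 'I_1 => p1 in
                let alpha := fun _ : 'I_1 => alpha1 in
                [/\ 0 < alpha1, rho_geo alpha = 8 * pi * N%:R + eps &
                    exists v, weak_solution G f_g K p alpha (rho_geo alpha) v]])
  /\
  (forall N : nat, (2 <= N)%N ->
    exists2 C : set ('rV[R]_3 -> R), C !=set0 &
      forall K, C K ->
        [/\ lipschitz_S2 K, positive_S2 K &
            exists2 delta : R, 0 < delta &
              forall eps : R, 0 < eps < delta ->
                let alpha1 := 2 * (N%:R - 1) - eps / (4 * pi) in
                let p := fun _ : 'I_1 => p1 in
                let alpha := fun _ : 'I_1 => alpha1 in
                [/\ 0 < alpha1, rho_geo alpha = 8 * pi * N%:R - eps &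
                    exists v, weak_solution G f_g K p alpha (rho_geo alpha) v]]).
Proof.
have P0 : 0 < 4 * pi :> R by rewrite mulr_gt0// pi_gt0.
pose m (N : nat) : R := 2 * N%:R.
have small (eps : R) : 0 < eps < 4 * pi -> 0 < eps / (4 * pi) < 1.
  by move=> /andP[e0 e1]; rewrite divr_gt0// ltr_pdivrMr// mul1r.
have rho (N : nat) (e : R) : 4 * pi * (2 + (2 * (N%:R - 1) + e / (4 * pi))) = 8 * pi * N%:R + e.
  have := lt0r_neq0 (pi_gt0 R); move: (pi : R) => P h; by field.
split=> N N1; exists [set zonal_weight (m N) p1]; try by exists (zonal_weight (m N) p1).
- move=> _ ->; have N1' : 1 <= N%:R :> R by rewrite ler1n.
  have m2 : 2 <= m N by rewrite /m; lra.
  split; [by apply: zonal_weight_lipschitz; lra|by move=> x _; exact: zonal_weight_gt0|].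
  exists (4 * pi) => // eps heps alpha1 p alpha.
  have /andP[e0 e1] := small _ heps.
  have a0 : 0 < alpha1 by rewrite /alpha1; lra.
  split=> //; first by rewrite rho_geo1 rho.
  have am : 1 + alpha1 < m N by rewrite /alpha1 /m; lra.
  exact: conical_sphere_solution hG hf hp1 m2 a0 am.
- move=> _ ->; have N1' : 2 <= N%:R :> R by rewrite ler_nat.
  have m2 : 2 <= m N by rewrite /m; lra.
  split; [by apply: zonal_weight_lipschitz; lra|by move=> x _; exact: zonal_weight_gt0|].
  exists (4 * pi) => // eps heps alpha1 p alpha.
  have /andP[e0 e1] := small _ heps.
  have a0 : 0 < alpha1 by rewrite /alpha1; lra.
  split=> //; first by rewrite rho_geo1 -rho mulNr.
  have am : 1 + alpha1 < m N by rewrite /alpha1 /m; lra.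
  exact: conical_sphere_solution hG hf hp1 m2 a0 am.
Qed.
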